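(* Let $G$ be a 2-connected graph. If $G$ is claw-$o$-heavy and $S$-$f$-heavy, where $S\in\{P_6,Z_2,W,N\}$, then $G$ is Hamiltonian.
   Context: All graphs are finite and simple. $d(v)$ denotes the degree of $v$ in $G$, and $d_{G'}(u,v)$ denotes the distance between $u$ and $v$ in a graph $G'$. A graph is Hamiltonian if it has a cycle through all its vertices. $o$-heavy: Let $G$ be a graph on $n$ vertices. For a given graph $H$, $G$ is $H$-$o$-heavy if for every induced subgraph $G'$ of $G$ isomorphic to $H$ there exist two nonadjacent vertices $x,y\in V(G')$ such that $d(x)+d(y)\geq n$ (degrees taken in $G$). Claw-$o$-heavy means $K_{1,3}$-$o$-heavy. $f$-heavy: Let $G$ be a graph on $n$ vertices. For a given graph $H$, $G$ is $H$-$f$-heavy if for every induced subgraph $G'$ of $G$ isomorphic to $H$ and every two vertices $u,v\in V(G')$, $d_{G'}(u,v)=2$ implies $\max\{d(u),d(v)\}\geq n/2$ (degrees taken in $G$). Particular graphs: $P_6$ is the path on $6$ vertices; $Z_2$ is obtained from a triangle by attaching a path with two edges at one of its vertices; $N$ (net) is obtained from a triangle by attaching one pendant edge at each of its three vertices; $W$ (wounded) has vertices $a_1,a_2,a_3,b_1,b_2,c_1$ and edges $a_1a_2,a_2a_3,a_3a_1,a_1b_1,b_1c_1,a_2b_2$. *)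

(* Defs.v *)
From mathcomp Require Import all_boot.

Set Implicit Arguments.
Unset Strict Implicit.
Unset Printing Implicit Defensive.

Record sgraph := SGraph {
  vertex :> finType;
  adj : rel vertex;
  adj_sym : symmetric adj;
  adj_irr : irreflexive adj }.

Definition deg (G : sgraph) (x : G) : nat := #|[set y | adj x y]|.

Definition isomorphic (G H : sgraph) : Prop :=
  exists2 f : G -> H, bijective f & forall x y, adj (f x) (f y) = adj x y.

Section Induced.
Variables (G : sgraph) (A : {set G}).

Definition induced_adj : rel {x : G | x \in A} :=
  [rel u v | adj (val u) (val v)].

Lemma induced_sym : symmetric induced_adj.
Proof. by move=> u v; apply: adj_sym. Qed.

Lemma induced_irr : irreflexive induced_adj.
Proof. by move=> u; apply: adj_irr. Qed.

Definition induced : sgraph := SGraph induced_sym induced_irr.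
End Induced.

(* The distance is a relation, so that no value has to be chosen for two
   vertices in different components. *)
Definition is_dist (G : sgraph) (u v : G) (k : nat) : Prop :=
  (exists p : seq G, [/\ path (@adj G) u p, last u p = v & size p = k]) /\
  (forall p : seq G, path (@adj G) u p -> last u p = v -> k <= size p).

Definition connected (G : sgraph) : Prop :=
  forall x y : G, connect (@adj G) x y.

Definition k_connected (k : nat) (G : sgraph) : Prop :=
  k < #|G| /\ forall X : {set G}, #|X| < k -> connected (induced (~: X)).

(* The size condition excludes an edge traversed back and forth, which
   [ucycle] accepts as a cycle on two vertices. *)
Definition hamiltonian (G : sgraph) : Prop :=
  exists c : seq G, [/\ ucycle (@adj G) c, 3 <= size c & forall x, x \in c].

Definition o_heavy (H G : sgraph) : Prop :=
  forall A : {set G}, isomorphic H (induced A) ->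
  exists x y : G, [/\ x \in A, y \in A, x != y, ~~ adj x y
                    & #|G| <= deg x + deg y].

(* The last inequality is max {d(u), d(v)} >= n / 2 with the denominator
   cleared; distances are taken in the induced subgraph, degrees in G. *)
Definition f_heavy (H G : sgraph) : Prop :=
  forall A : {set G}, isomorphic H (induced A) ->
  forall u v : induced A, is_dist u v 2 ->
  #|G| <= 2 * maxn (deg (val u)) (deg (val v)).

Section EdgeList.
Variables (n : nat) (E : seq (nat * nat)).

Definition edges_adj : rel 'I_n :=
  [rel i j : 'I_n | (i != j) &&
     (((i : nat, j : nat) \in E) || ((j : nat, i : nat) \in E))].

Lemma edges_sym : symmetric edges_adj.
Proof. by move=> i j; rewrite /edges_adj /= eq_sym orbC. Qed.

Lemma edges_irr : irreflexive edges_adj.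
Proof. by move=> i; rewrite /edges_adj /= eqxx. Qed.

Definition graph_of_edges : sgraph := SGraph edges_sym edges_irr.
End EdgeList.

Definition claw : sgraph := graph_of_edges 4 [:: (0, 1); (0, 2); (0, 3)].

Definition P6 : sgraph :=
  graph_of_edges 6 [:: (0, 1); (1, 2); (2, 3); (3, 4); (4, 5)].

Definition Z2 : sgraph :=
  graph_of_edges 5 [:: (0, 1); (1, 2); (2, 0); (0, 3); (3, 4)].

Definition net : sgraph :=
  graph_of_edges 6 [:: (0, 1); (1, 2); (2, 0); (0, 3); (1, 4); (2, 5)].

(* a1, a2, a3, b1, b2, c1 are 0, 1, 2, 3, 4, 5. *)
Definition wounded : sgraph :=
  graph_of_edges 6 [:: (0, 1); (1, 2); (2, 0); (0, 3); (3, 5); (1, 4)].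

(* Main.v *)
(* Write x ~ y if x and y are adjacent or d(x) + d(y) >= n. By Ore's crossing argument a cycle
   for ~ yields a cycle of G on at least the same vertices. The heavy vertices, those with
   d(x) >= n/2, are pairwise joined by ~, so there is a cycle through all of them; let C be a
   longest one. If C misses a vertex, 2-connectivity gives a path R outside C between two
   vertices u, v of C, and no cycle for ~ covers C together with some vertices of R.

   For N, W and Z2, let u and v grow along C to disjoint ends D1 and D2, as large as possible
   subject to the flexibility expressed by [end3]. Between D1 and D2 there are then at most three
   pairs x ~ y, no two of them sharing a vertex, so by degree sums ~ is adjacency inside one of the
   ends, say D2. A shortest path between the two exits of D2 together with a shortest path from v
   to it then contains a net, a wounded graph and a Z2, which give two heavy vertices in D2. Hence
   D1 has no heavy vertex, ~ is adjacency inside D1 as well, and D1 has two heavy vertices after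
   all. For W and Z2 this needs that v is not adjacent to the second to last vertex of the
   path u, R, and likewise for u; R can be chosen so, unless R is a single vertex r and uv is an
   edge, and then the pattern is found on the triangle u, v, r.

   For P6, induced paths through R show that u and v are adjacent and heavy. Choose C and R so that
   one of the two arcs M of C between u and v is as short as possible. Bypassing the heavy
   neighbours of u and v on M leaves a connected part of M, in which a shortest path between
   neighbours of u and v gives an induced P6 or a cycle longer than C. *)

Require Import Defs.
From mathcomp Require Import all_boot zify.

Set Implicit Arguments.
Unset Strict Implicit.
Unset Printing Implicit Defensive.

(** * Paths with prescribed ends *)

(** Claws only yield pairs x ~ y, whereas the other patterns need edges and non-edges of G.
    Non-edges come from pairs x ~ y that are excluded because they would close a longer cycle; edges
    are available where ~ is adjacency, that is, inside a clean end and between light vertices.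
    Hence the effort to confine heavy vertices: a heavy vertex of one end is joined to every heavy
    vertex of the other, and two cross pairs never share a vertex. Since C passes through all heavy
    vertices, every vertex of R is light, so a pattern with a vertex of R forces a heavy vertex
    elsewhere. A net needs at most one vertex of R beyond v; W and Z2 may need a second one, whence
    the condition on the vertex before the end of R. For P6 both u and v are heavy, so each other
    vertex of C not joined to one of them is light, and two such vertices with x ~ y are
    adjacent. *)

Section Trails.
Variables (T : eqType) (e : rel T).
Hypothesis e_sym : symmetric e.

(** Both ends are named, so that a cycle glued from pieces is checked by looking up one edge for
    each joint. *)
Definition trail (s : seq T) (x y : T) : bool :=
  if s is z :: s' then [&& z == x, path e z s' & last z s' == y] else false.

Lemma trailE x s y z :
  trail (x :: s) y z = [&& x == y, path e x s & last x s == z].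
Proof. by []. Qed.

Lemma trail1 x : trail [:: x] x x.
Proof. by rewrite /= !eqxx. Qed.

Lemma trail_path x s : path e x s -> trail (x :: s) x (last x s).
Proof. by move=> p; rewrite /= p !eqxx. Qed.

Lemma trail_cat s t x y z w :
  trail s x y -> trail t z w -> e y z -> trail (s ++ t) x w.
Proof.
case: s => // a s; case: t => // b t.
case/and3P=> /eqP-> ps /eqP<- /and3P[/eqP-> pt /eqP<-] eyz.
by rewrite /= cat_path last_cat /= ps eyz pt !eqxx.
Qed.

Lemma trail_rev s x y : trail s x y -> trail (rev s) y x.
Proof.
case: s => // a s /and3P[/eqP-> ps /eqP<-] {a}.
have -> : rev (x :: s) = last x s :: rev (belast x s).
  by rewrite lastI rev_rcons.
rewrite /= rev_path eqxx /=.
have -> : path (fun z => e^~ z) x s by under eq_path => ? ? do rewrite e_sym.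
by case: s {ps} => [|b s] /=; rewrite ?eqxx // rev_cons last_rcons eqxx.
Qed.

Lemma trail_split s t x y : s != [::] -> t != [::] -> trail (s ++ t) x y ->
  exists a b, [/\ trail s x a, e a b & trail t b y].
Proof.
case: s => // a s _; case: t => // b t _ /and3P[/eqP->].
rewrite cat_path last_cat /= => /and3P[ps eb pt] /eqP<-.
by exists (last x s), b; rewrite ps pt eb !eqxx.
Qed.

Lemma trail_hd x s y z : trail (x :: s) y z -> x = y.
Proof. by case/and3P=> /eqP. Qed.

Lemma trail_last s x y z : trail (rcons s x) y z -> x = z.
Proof.
case: s => [|a s] /=; first by case/andP=> _ /eqP.
by rewrite last_rcons => /and3P[_ _ /eqP].
Qed.

Lemma trail_mem s x y : trail s x y -> (x \in s) && (y \in s).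
Proof.
by case: s => // a s /and3P[/eqP<- _ /eqP<-]; rewrite mem_head mem_last.
Qed.

Lemma trail_neq0 s x y : trail s x y -> s != [::].
Proof. by case: s. Qed.

(** Only the interior vertices are listed: a link may be empty, and its ends belong to other
    pieces. *)
Definition link (s : seq T) (x y : T) : bool := path e x (rcons s y).

Lemma link_rev s x y : link s x y -> link (rev s) y x.
Proof.
move=> h; have : trail (rcons (x :: s) y) x y.
  by rewrite /= !eqxx last_rcons eqxx andbT; exact: h.
by move/trail_rev; rewrite rev_rcons rev_cons => /and3P[].
Qed.

Lemma link0 x y : link [::] x y = e x y.
Proof. by rewrite /link /= andbT. Qed.

Lemma link_cons z s x y : link (z :: s) x y = e x z && link s z y.
Proof. by []. Qed.

Lemma link_rcons z s x y : link (rcons s z) x y = link s x z && e z y.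
Proof. by rewrite /link rcons_path last_rcons. Qed.

Lemma link_cat s t x y z :
  link (s ++ z :: t) x y = link s x z && link t z y.
Proof. by rewrite /link -cat_rcons rcons_cat cat_path last_rcons. Qed.

Lemma link_trail s x y : link s x y -> s != [::] ->
  exists a b, [/\ trail s a b, e x a & e b y].
Proof.
case: s => // a s; rewrite /link /= rcons_path => /and3P[ea ps el] _.
by exists a, (last a s); rewrite /= ps !eqxx.
Qed.

Lemma link_of_trail s x y : x != y -> trail s x y ->
  exists2 m, s = x :: rcons m y & link m x y.
Proof.
move=> nxy; case: s => // a s /and3P[/eqP-> ps /eqP].
case/lastP: s ps => [|s z] /=; first by move=> _ /eqP; rewrite (negPf nxy).
by rewrite last_rcons => ps <-; exists s.
Qed.

End Trails.

Lemma sub_trail (T : eqType) (e e' : rel T) s x y :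
  subrel e e' -> trail e s x y -> trail e' s x y.
Proof.
move=> sub; case: s => // a s /and3P[h1 h2 h3]; rewrite /= h1 h3 andbT /=.
exact: sub_path h2.
Qed.

Section Shortest.
Variables (T : finType) (e : rel T).

Definition shortest (P : pred T) (x : T) (p : seq T) : Prop :=
  [/\ path e x p, P (last x p) &
      forall q, path e x q -> P (last x q) -> size p <= size q].

Lemma shortest_exists (P : pred T) x p : path e x p -> P (last x p) ->
  exists q, shortest P x q.
Proof.
move=> pp Pp.
pose A m := [exists t : m.-tuple T, path e x t && P (last x t)].
have exA : exists m, A m.
  by exists (size p); apply/existsP; exists (in_tuple p); rewrite pp Pp.
case: (ex_minnP exA) => m /existsP[t /andP[pt Pt]] min.
exists t; split=> // q pq Pq; rewrite size_tuple; apply: min.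
by apply/existsP; exists (in_tuple q); rewrite pq Pq.
Qed.

Lemma path_take i p x : i <= size p -> path e x p ->
  path e x (take i p) /\ last x (take i p) = nth x (x :: p) i.
Proof.
move=> ip; rewrite -{1}(cat_take_drop i p) cat_path => /andP[h _]; split=> //.
case: i ip h => [|i] ip h; first by rewrite take0.
by rewrite (last_nth x) size_takel //= nth_take.
Qed.

Lemma path_drop j p x : 0 < j <= size p -> path e x p ->
  exists q, [/\ drop j.-1 p = nth x (x :: p) j :: q, path e (nth x (x :: p) j) q,
     last (nth x (x :: p) j) q = last x p & size q = size p - j].
Proof.
case: j => // j /= jp pp; exists (drop j.+1 p).
have d := drop_nth x jp; rewrite d size_drop; split=> //.
  by move: pp; rewrite -{1}(cat_take_drop j p) cat_path d /= => /and3P[].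
by rewrite -[in RHS](cat_take_drop j p) last_cat d.
Qed.

Lemma shortest_nontarget P x p i : shortest P x p -> i < size p ->
  ~~ P (nth x (x :: p) i).
Proof.
case=> pp _ min ip; apply/negP => Pi.
have [h1 h2] := path_take (ltnW ip) pp.
by have := min _ h1; rewrite h2 size_takel ?(ltnW ip) // leqNgt ip => /(_ Pi).
Qed.

Lemma shortest_chord P x p i j : shortest P x p -> i < j <= size p ->
  e (nth x (x :: p) i) (nth x (x :: p) j) -> j = i.+1.
Proof.
case=> pp Pp min /andP[ij jp] eij.
have [h1 h2] := path_take (leq_trans (ltnW ij) jp) pp.
have j0 : 0 < j <= size p by lia.
have [q [_ q1 q2 q3]] := path_drop j0 pp.
have := min (take i p ++ nth x (x :: p) j :: q).
rewrite cat_path h1 h2 /= eij q1 last_cat /= q2 => /(_ isT Pp).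
by rewrite size_cat /= q3 size_takel; lia.
Qed.

Lemma shortest_uniq P x p : shortest P x p -> uniq (x :: p).
Proof.
move=> [pp Pp min]; apply/negPn/negP => /(uniqPn x)[i [j [ij]]] /=; rewrite ltnS => jp eij.
have [h1 h2] := path_take (leq_trans (ltnW ij) jp) pp.
have j0 : 0 < j <= size p by lia.
have [q [_ q1 q2 q3]] := path_drop j0 pp.
have := min (take i p ++ q).
rewrite cat_path h1 h2 eij q1 last_cat h2 eij q2 => /(_ isT Pp).
by rewrite size_cat /= q3 size_takel; lia.
Qed.
End Shortest.

Lemma trail_cycle (T : eqType) (e : rel T) t x y :
  trail e t x y -> e y x -> cycle e t.
Proof.
by case: t => // a t /and3P[/eqP-> pt /eqP<-]; rewrite /= rcons_path pt => ->.
Qed.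

(** * Trading an Ore cycle for a cycle *)

Section Ore.
Variable G : sgraph.
Implicit Types (x y z : G) (s t c p : seq G).

Notation adj := (@adj G).

Definition ore : rel G :=
  [rel x y | (x != y) && (adj x y || (#|G| <= deg x + deg y))].

Definition heavy (x : G) : bool := #|G| <= 2 * deg x.

Lemma oreE x y : ore x y = (x != y) && (adj x y || (#|G| <= deg x + deg y)).
Proof. by []. Qed.

Lemma adj_neq x y : adj x y -> x != y.
Proof. by apply: contraTneq => ->; rewrite adj_irr. Qed.

Lemma ore_sym : symmetric ore.
Proof. by move=> x y; rewrite /ore /= eq_sym adj_sym addnC. Qed.

Lemma ore_neq x y : ore x y -> x != y.
Proof. by case/andP. Qed.

Lemma adj_ore : subrel adj ore.
Proof. by move=> x y h; rewrite /ore /= h adj_neq. Qed.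

Lemma heavy_ore x y : heavy x -> heavy y -> x != y -> ore x y.
Proof. by rewrite /heavy /ore /= => hx hy ->; apply/orP; right; lia. Qed.

Lemma ore_light x y : ore x y -> ~~ heavy x -> ~~ heavy y -> adj x y.
Proof. by rewrite /heavy /ore /= => /andP[_ /orP[]] //; lia. Qed.

(** If both alternatives fail, the path predecessors of the neighbours of [x] are disjoint from the
    neighbours of the last vertex, which allows at most [size p] path neighbours in all, and no
    outside vertex is adjacent to both ends. As the path has [size p + 1] vertices, the degree sum
    is at most n - 1. *)
Lemma crossing x p : uniq (x :: p) -> p != [::] -> #|G| <= deg x + deg (last x p) ->
  (exists w, [/\ w \notin x :: p, adj x w & adj (last x p) w]) \/
  exists s a b t, [/\ x :: p = s ++ a :: b :: t, adj x b & adj (last x p) a].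
Proof.
move=> up p0 hd; set z := last x p in hd *.
have [/existsP[w /and3P[h1 h2 h3]]|no1] :=
   boolP [exists w, [&& w \notin x :: p, adj x w & adj z w]].
  by left; exists w.
pose f i := nth x (x :: p) i.
have [/existsP[i /andP[h1 h2]]|no2] :=
   boolP [exists i : 'I_(size p), adj x (f i.+1) && adj z (f i)].
  right; exists (take i (x :: p)), (f i), (f i.+1), (drop i.+2 (x :: p)); split=> //.
  have ip := ltn_ord i.
  rewrite /f -!drop_nth ?cat_take_drop //=; lia.
pose A := [set i : 'I_(size p) | adj x (f i.+1)].
pose B := [set i : 'I_(size p) | adj z (f i)].
pose V := [set y | y \in x :: p].
have cV : #|V| = (size p).+1 by rewrite cardsE (card_uniqP up).
have disAB : #|A| + #|B| <= size p.
  have AB0 : A :&: B = set0.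
    apply/setP=> i; rewrite !inE; apply: contraNF no2 => h.
    by apply/existsP; exists i.
  have := max_card (mem (A :|: B)).
  by rewrite card_ord -cardsUI AB0 cards0 addn0.
pose NX := [set y | adj x y] :\: V; pose NZ := [set y | adj z y] :\: V.
have disN : #|NX| + #|NZ| <= #|~: V|.
  rewrite -cardsUI.
  have -> : NX :&: NZ = set0.
    apply/setP=> w; rewrite !inE; apply: contraNF no1 => /andP[/andP[h1 h2] /andP[_ h3]].
    by apply/existsP; exists w; rewrite inE h1 h2 h3.
  rewrite cards0 addn0 subset_leq_card //; apply/subsetP=> w; rewrite !inE.
  by case/orP=> /andP[].
have dx : deg x <= #|A| + #|NX|.
  rewrite /deg -(cardsID V [set y | adj x y]) leq_add2r.
  apply: leq_trans (leq_imset_card (fun i : 'I_(size p) => f i.+1) A).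
  apply/subset_leq_card/subsetP=> w; rewrite !inE => /andP[xw /predU1P[wx | wp]].
    by move: xw; rewrite wx adj_irr.
  have ip : index w p < size p by rewrite index_mem.
  have fw : f (index w p).+1 = w by rewrite /f /= nth_index.
  by apply/imsetP; exists (Ordinal ip); rewrite ?inE /= fw.
have dz : deg z <= #|B| + #|NZ|.
  rewrite /deg -(cardsID V [set y | adj z y]) leq_add2r.
  apply: leq_trans (leq_imset_card (fun i : 'I_(size p) => f i) B).
  apply/subset_leq_card/subsetP=> w; rewrite 2!inE [w \in V]inE => /andP[zw wp].
  have fw : f (index w (x :: p)) = w by rewrite /f nth_index.
  have ip : index w (x :: p) < size p.
    have : index w (x :: p) < size (x :: p) by rewrite index_mem.
    rewrite [size _]/= ltnS leq_eqVlt => /predU1P[iw|//].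
    have : w = z by rewrite -fw iw /f /z (last_nth x).
    by move=> wz; move: zw; rewrite wz adj_irr.
  by apply/imsetP; exists (Ordinal ip); rewrite ?inE /= fw.
have := cardsC V; rewrite cV; lia.
Qed.

(** The extra pairs form a list, so that they can be eliminated by induction. *)
Definition addp (ps : seq (G * G)) : rel G :=
  [rel x y | [|| adj x y, (x, y) \in ps | (y, x) \in ps]].

Lemma addp_sym ps : symmetric (addp ps).
Proof. by move=> x y; rewrite /addp /= adj_sym; congr orb; rewrite orbC. Qed.

(* The pairs in [ps] are removed one at a time, each by [crossing]: if [y z] is removed,
   the rest of the cycle is a path from [z] to [y] whose ends have degree sum at least n. *)
Lemma addp_step q ps c : ore q.1 q.2 -> ucycle (addp (q :: ps)) c -> 2 < size c ->
  exists2 c', ucycle (addp ps) c' & {subset c <= c'}.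
Proof.
move=> oq /andP[cc uc] sc.
have [/allP h|] := boolP (all (fun y => addp ps y (next c y)) c).
  by exists c => //; rewrite /ucycle uc andbT; apply: cycle_from_next.
case/allPn=> y yc hy.
have [i c' ec] := rot_to yc.
have uc' : uniq (y :: c') by rewrite -ec rot_uniq.
have cc' : cycle (addp (q :: ps)) (y :: c') by rewrite -ec rot_cycle.
have nc : next c y = next (y :: c') y by rewrite -ec next_rot.
have mc : y :: c' =i c by move=> w; rewrite -ec mem_rot.
have sc' : 2 < size (y :: c') by rewrite -ec size_rot.
case: c' => [//|z s] in ec uc' cc' nc mc sc'.
have {nc}hy : ~~ addp ps y z by move: hy; rewrite nc /= eqxx.
move: cc'; rewrite /= => /andP[eyz pz].
have [qyz oyz] : (q = (y, z) \/ q = (z, y)) /\ ore y z.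
  move: hy; rewrite /addp /= !negb_or => /and3P[h1 h2 h3].
  move: eyz; rewrite /addp /= !inE (negPf h1) (negPf h2) (negPf h3) !orbF /=.
  by case/orP=> /eqP qe; move: oq; rewrite -qe /= => oq; split; auto; rewrite ore_sym.
have hd : #|G| <= deg z + deg (last z (rcons s y)).
  rewrite last_rcons addnC.
  by move: oyz hy; rewrite /ore /addp /= => /andP[_ /orP[->|]].
have s0 : s != [::] by case: (s) sc'.
(* The removed pair does not occur again: the edges before the last avoid [y], and the last one
   starts at a vertex other than [z], since the cycle has more than two vertices. *)
have {}pz : path (addp ps) z (rcons s y).
  case/lastP: s => [//|s l] in ec uc' mc sc' s0 pz hd *.
  have ny : y \notin z :: rcons s l by case/andP: uc'.
  have nz : z \notin rcons s l by case/and3P: uc'.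
  have sub a b : (a, b) != q -> (b, a) != q -> addp (q :: ps) a b -> addp ps a b.
    rewrite /addp /= !inE => /negPf-> /negPf->; by [].
  move: pz; rewrite rcons_path [path (addp ps) _ _]rcons_path !last_rcons.
  case/andP=> pz el; apply/andP; split; last first.
    have [ny' nz'] : y != l /\ z != l.
      by move: ny nz; rewrite !(inE, mem_rcons) !negb_or => /and3P[_ -> _] /andP[->].
    by apply: sub el; apply/eqP=> e; case: qyz => q'; move: e ny' nz';
      rewrite q' => -[e1 e2]; rewrite ?e1 ?e2 ?eqxx // -?e1 -?e2 ?eqxx.
  move: pz; apply: (@sub_in_path _ (predC1 y)).
    move=> a b; rewrite !inE => ay b_y; apply: sub; apply/eqP=> e.
      by case: qyz e => -> [? ?]; subst; rewrite eqxx in ay b_y.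
    by case: qyz e => -> [? ?]; subst; rewrite eqxx in ay b_y.
  by apply/allP=> w wi /=; apply: contraNneq ny => <-.
have us : uniq (z :: rcons s y) by rewrite -rcons_cons -rot1_cons rot_uniq.
have ms w : (w \in c) = (w \in z :: rcons s y) by rewrite -mc -rcons_cons -rot1_cons mem_rot.
have p0 : rcons s y != [::] by rewrite -size_eq0 size_rcons.
have adj_addp a b : adj a b -> addp ps a b by rewrite /addp /= => ->.
(* A common neighbour outside closes the path from [z] to [y]; a crossing pair [a], [b] closes it
   after the part from [b] on is reversed. *)
case: (crossing us p0 hd) => [[w [w1 w2 w3]]|[t1 [a [b [t2 [e1 e2 e3]]]]]].
  exists (w :: z :: rcons s y); last by move=> v; rewrite ms => h; rewrite in_cons h orbT.
  rewrite /ucycle cons_uniq w1 us andbT /= rcons_path pz last_rcons.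
  by rewrite last_rcons in w3; rewrite !adj_addp // adj_sym.
exists (rcons t1 a ++ rev (b :: t2)).
  rewrite /ucycle; apply/andP; split; last first.
    by rewrite (perm_uniq (s2 := z :: rcons s y)) // e1 -cat_rcons perm_cat2l perm_rev.
  have tt := trail_path pz; rewrite e1 -cat_rcons in tt.
  have [||u [v [h1 _ h3]]] := trail_split _ _ tt; [by case: (t1)|by []|].
  have ua := trail_last h1; have vb := trail_hd h3; subst u v.
  apply: (trail_cycle (x := z) (y := b)); last by rewrite adj_addp // adj_sym.
  apply: (trail_cat h1 (trail_rev (addp_sym ps) h3)).
  by rewrite adj_addp // adj_sym.
by move=> v; rewrite ms e1 -cat_rcons !mem_cat mem_rev.
Qed.

Lemma ore_cycle c : ucycle ore c -> 2 < size c ->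
  exists c', [/\ ucycle adj c', 2 < size c' & {subset c <= c'}].
Proof.
pose ps := [seq q <- enum [set: G * G] | ore q.1 q.2].
have hps : all (fun q => ore q.1 q.2) ps by rewrite /ps all_filter; apply/allP=> q _; apply/implyP.
have sub : subrel ore (addp ps).
  move=> x y xy; have xyp : (x, y) \in ps by rewrite mem_filter xy mem_enum inE.
  by rewrite /addp /= xyp orbT.
move=> /andP[cc uc] sc.
have {sub} : ucycle (addp ps) c by rewrite /ucycle uc andbT; apply: sub_cycle cc.
elim: ps hps c sc {cc uc} => [|q ps IH] /=.
  move=> _ c sc cc; exists c; split=> //; move: cc; rewrite /ucycle => /andP[cc ->].
  by rewrite andbT; apply: sub_cycle cc => x y; rewrite /addp /= orbF.
case/andP=> hq hps c sc cc; have [c' cc' sub] := addp_step hq cc sc.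
have sc' : 2 < size c'.
  by apply: leq_trans sc _; apply: uniq_leq_size sub; case/andP: cc.
have [d [d1 d2 d3]] := IH hps _ sc' cc'.
by exists d; split=> // w /sub /d3.
Qed.
End Ore.

(** * Heavy vertices in induced subgraphs *)

Lemma induced_iso (S G : sgraph) (f : S -> G) : injective f ->
  (forall i j, adj (f i) (f j) = adj i j) ->
  exists2 A : {set G}, (forall x, x \in A -> exists i, x = f i) &
  exists2 g : S -> induced A, bijective g /\ (forall i, val (g i) = f i) &
  isomorphic S (induced A).
Proof.
move=> finj fadj; pose A := [set f i | i : S].
have fA i : f i \in A by apply: imset_f.
pose g i : induced A := exist _ (f i) (fA i).
have gbij : bijective g.
  apply: inj_card_bij; first by move=> i j /(congr1 val) /finj.
  have cA : #|A| = #|S| by rewrite card_imset.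
  by rewrite card_sig -cA; apply/eq_leq/eq_card => x; rewrite !inE.
exists A; first by move=> x /imsetP[i _ ->]; exists i.
by exists g => //; exists g => // i j; rewrite -fadj.
Qed.

Lemma f_heavy_pair (S G : sgraph) (f : S -> G) i m j : f_heavy S G -> injective f ->
  (forall i j, adj (f i) (f j) = adj i j) ->
  i != j -> adj i m -> adj m j -> ~~ adj i j -> heavy (f i) || heavy (f j).
Proof.
move=> hS finj fadj nij im mj nadj.
have [A _ [g [_ gf] iso]] := induced_iso finj fadj.
have gadj a b : adj (g a) (g b) = adj a b by rewrite -fadj -!gf.
have := hS A iso (g i) (g j); rewrite !gf /heavy.
suff d2 : is_dist (g i) (g j) 2 by move/(_ d2); lia.
split; first by exists [:: g m; g j]; have := gadj i m; have := gadj m j; rewrite im mj /= => -> ->.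
case=> [|a [|b p]] //=.
  by move=> _ /(congr1 val); rewrite !gf => /finj e; rewrite e eqxx in nij.
by rewrite andbT => + e; have := gadj i j; rewrite e (negPf nadj) /= => ->.
Qed.

Section Patterns.
Variables (n : nat) (E : seq (nat * nat)).

Definition edge (i j : nat) : bool := (i != j) && (((i, j) \in E) || ((j, i) \in E)).

(* If no two vertices of a pattern have the same neighbours, then the adjacencies alone force
   the vertices of a copy to be distinct; so [P6_cover], [Z2_cover], [net_cover] and
   [wounded_cover] need no disequalities. The claw has twins. *)
Definition twin_free : bool :=
  all (fun i => all (fun j => (i == j) || has (fun k => edge i k != edge j k) (iota 0 n))
    (iota 0 n)) (iota 0 n).

Variables (G : sgraph) (x0 : G) (vs : seq G).
Hypothesis adj_vs : forall i j, i < j < n -> adj (nth x0 vs i) (nth x0 vs j) = edge i j.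

Lemma adj_nth i j : i < n -> j < n -> adj (nth x0 vs i) (nth x0 vs j) = edge i j.
Proof.
move=> ni nj; case: (ltngtP i j) => [ij|ji|->].
- by apply: adj_vs; rewrite ij.
- by rewrite adj_sym adj_vs ?ji // /edge eq_sym orbC.
- by rewrite adj_irr /edge eqxx.
Qed.

Let f (i : graph_of_edges n E) : G := nth x0 vs (i : 'I_n).

Lemma pattern_adj i j : adj (f i) (f j) = adj i j.
Proof. by rewrite /f adj_nth ?ltn_ord. Qed.

Lemma twin_free_inj : twin_free -> injective f.
Proof.
move=> /allP tf i j fij; apply/val_inj.
have ni := ltn_ord (i : 'I_n); have nj := ltn_ord (j : 'I_n).
have mi : val (i : 'I_n) \in iota 0 n by rewrite mem_iota add0n ni.
have mj : val (j : 'I_n) \in iota 0 n by rewrite mem_iota add0n nj.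
have /allP/(_ _ mj)/orP[/eqP//|/hasP[k]] := tf _ mi.
rewrite mem_iota /= add0n => nk.
by rewrite -!adj_nth // -[nth x0 vs i]/(f i) fij eqxx.
Qed.

Lemma pattern_heavy i m j : f_heavy (graph_of_edges n E) G -> twin_free ->
  i < n -> m < n -> j < n -> edge i m -> edge m j -> (i != j) && ~~ edge i j ->
  heavy (nth x0 vs i) || heavy (nth x0 vs j).
Proof.
move=> hS tf ni nm nj im mj /andP[nij eij].
exact: (@f_heavy_pair _ _ f (Ordinal ni) (Ordinal nm) (Ordinal nj) hS (twin_free_inj tf)
  pattern_adj).
Qed.
End Patterns.

Section Covers.
Variable G : sgraph.

Definition P6_cover := forall v0 v1 v2 v3 v4 v5 : G,
  [&& adj v0 v1, adj v1 v2, adj v2 v3, adj v3 v4 & adj v4 v5] ->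
  [&& ~~ adj v0 v2, ~~ adj v0 v3, ~~ adj v0 v4 & ~~ adj v0 v5] ->
  [&& ~~ adj v1 v3, ~~ adj v1 v4 & ~~ adj v1 v5] ->
  [&& ~~ adj v2 v4, ~~ adj v2 v5 & ~~ adj v3 v5] ->
  [&& heavy v0 || heavy v2, heavy v1 || heavy v3, heavy v2 || heavy v4
    & heavy v3 || heavy v5].

Definition Z2_cover := forall x1 x2 x3 y z : G,
  [&& adj x1 x2, adj x2 x3, adj x1 x3, adj x1 y & adj y z] ->
  [&& ~~ adj x1 z, ~~ adj x2 y, ~~ adj x2 z, ~~ adj x3 y & ~~ adj x3 z] ->
  [&& heavy x2 || heavy y, heavy x3 || heavy y & heavy x1 || heavy z].

Definition net_cover := forall x1 x2 x3 y1 y2 y3 : G,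
  [&& adj x1 x2, adj x2 x3, adj x1 x3, adj x1 y1, adj x2 y2 & adj x3 y3] ->
  [&& ~~ adj y1 y2, ~~ adj y1 y3 & ~~ adj y2 y3] ->
  [&& ~~ adj x1 y2, ~~ adj x1 y3, ~~ adj x2 y1, ~~ adj x2 y3, ~~ adj x3 y1 & ~~ adj x3 y2] ->
  [&& heavy x1 || heavy y2, heavy x1 || heavy y3, heavy x2 || heavy y1,
     heavy x2 || heavy y3, heavy x3 || heavy y1 & heavy x3 || heavy y2].

Definition wounded_cover := forall x1 x2 x3 y1 z1 y2 : G,
  [&& adj x1 x2, adj x2 x3, adj x1 x3, adj x1 y1, adj y1 z1 & adj x2 y2] ->
  [&& ~~ adj x1 z1, ~~ adj x2 z1, ~~ adj x3 z1, ~~ adj y1 y2 & ~~ adj z1 y2] ->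
  [&& ~~ adj x1 y2, ~~ adj x2 y1, ~~ adj x3 y1 & ~~ adj x3 y2] ->
  [&& heavy x1 || heavy z1, heavy x2 || heavy y1, heavy x3 || heavy y1,
     heavy x1 || heavy y2 & heavy x3 || heavy y2].

Ltac adj_cases :=
  repeat match goal with H : is_true (~~ _) |- _ => move/negbTE: H => H end;
  case=> [|[|[|[|[|[|?]]]]]]; case=> [|[|[|[|[|[|?]]]]]];
  rewrite ?ltnS ?ltn0 ?andbF; try (by []); move=> _; rewrite /edge /=;
  match goal with H : _ |- _ = _ => rewrite H; reflexivity
     | H : _ |- _ = _ => rewrite adj_sym H; reflexivity end.

Lemma P6_heavy : f_heavy P6 G -> P6_cover.
Proof.
move=> h v0 v1 v2 v3 v4 v5 /and5P[e1 e2 e3 e4 e5] /and4P[n1 n2 n3 n4] /and3P[n5 n6 n7]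
  /and3P[n8 n9 n10].
have hadj i j : i < j < 6 -> adj (nth v0 [:: v0; v1; v2; v3; v4; v5] i)
    (nth v0 [:: v0; v1; v2; v3; v4; v5] j) =
    edge [:: (0, 1); (1, 2); (2, 3); (3, 4); (4, 5)] i j
  by clear h; move: i j; adj_cases.
have h1 i m j := @pattern_heavy _ _ _ v0 [:: v0; v1; v2; v3; v4; v5] hadj i m j h isT.
by rewrite (h1 0 1 2) ?(h1 1 2 3) ?(h1 2 3 4) ?(h1 3 4 5).
Qed.

Lemma Z2_heavy : f_heavy Z2 G -> Z2_cover.
Proof.
move=> h x1 x2 x3 y z /and5P[e1 e2 e3 e4 e5] /and5P[n1 n2 n3 n4 n5].
have hadj i j : i < j < 5 -> adj (nth x1 [:: x1; x2; x3; y; z] i)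
    (nth x1 [:: x1; x2; x3; y; z] j) =
    edge [:: (0, 1); (1, 2); (2, 0); (0, 3); (3, 4)] i j
  by clear h; move: i j; adj_cases.
have h1 i m j := @pattern_heavy _ _ _ x1 [:: x1; x2; x3; y; z] hadj i m j h isT.
by rewrite (h1 1 0 3) ?(h1 2 0 3) ?(h1 0 3 4).
Qed.

Lemma net_heavy : f_heavy net G -> net_cover.
Proof.
move=> h x1 x2 x3 y1 y2 y3 /and5P[e1 e2 e3 e4 /andP[e5 e6]] /and3P[n1 n2 n3]
  /and5P[n4 n5 n6 n7 /andP[n8 n9]].
have hadj i j : i < j < 6 -> adj (nth x1 [:: x1; x2; x3; y1; y2; y3] i)
    (nth x1 [:: x1; x2; x3; y1; y2; y3] j) =
    edge [:: (0, 1); (1, 2); (2, 0); (0, 3); (1, 4); (2, 5)] i j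
  by clear h; move: i j; adj_cases.
have h1 i m j := @pattern_heavy _ _ _ x1 [:: x1; x2; x3; y1; y2; y3] hadj i m j h isT.
by rewrite (h1 0 1 4) ?(h1 0 2 5) ?(h1 1 0 3) ?(h1 1 2 5) ?(h1 2 0 3) ?(h1 2 1 4).
Qed.

Lemma wounded_heavy : f_heavy wounded G -> wounded_cover.
Proof.
move=> h x1 x2 x3 y1 z1 y2 /and5P[e1 e2 e3 e4 /andP[e5 e6]] /and5P[n1 n2 n3 n4 n5]
  /and4P[n6 n7 n8 n9].
have hadj i j : i < j < 6 -> adj (nth x1 [:: x1; x2; x3; y1; y2; z1] i)
    (nth x1 [:: x1; x2; x3; y1; y2; z1] j) =
    edge [:: (0, 1); (1, 2); (2, 0); (0, 3); (3, 5); (1, 4)] i j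
  by clear h; move: i j; adj_cases.
have h1 i m j := @pattern_heavy _ _ _ x1 [:: x1; x2; x3; y1; y2; z1] hadj i m j h isT.
by rewrite (h1 0 3 5) ?(h1 1 0 3) ?(h1 2 0 3) ?(h1 0 1 4) ?(h1 2 1 4).
Qed.

(** With [ore] in the conclusion the claw need not be induced: an edge between two leaves satisfies
    it. *)
Definition claw_cover := forall x a b c : G, adj x a -> adj x b -> adj x c ->
  a != b -> a != c -> b != c -> [|| ore a b, ore a c | ore b c].

Lemma claw_heavy : o_heavy claw G -> claw_cover.
Proof.
move=> h x a b c xa xb xc ab ac bc.
rewrite /ore /= ab ac bc /=; case: (boolP (adj a b)) => //= nab.
case: (boolP (adj a c)) => //= nac; rewrite ?orbT //.
case: (boolP (adj b c)) => //= nbc; rewrite ?orbT //.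
pose vs := [:: x; a; b; c].
have hadj i j : i < j < 4 -> adj (nth x vs i) (nth x vs j) =
   edge [:: (0, 1); (0, 2); (0, 3)] i j by clear h; move: i j; adj_cases.
have uvs : uniq vs by rewrite /= !inE !negb_or ab ac bc !adj_neq.
have finj : injective (fun i : claw => nth x vs (i : 'I_4)).
  by move=> i j /eqP; rewrite nth_uniq ?ltn_ord // => /eqP/val_inj.
have [A hA [_ _ iso]] := induced_iso finj (pattern_adj hadj).
have [u [v [/hA[i ->] /hA[j ->] + + ]]] := h A iso.
pose D (u v : G) := #|G| <= deg u + deg v.
have Dsym p q : D p q = D q p by rewrite /D addnC.
rewrite nth_uniq ?ltn_ord // -![_ <= _]/(D _ _); move: D Dsym => D Dsym {iso hA A}.
case: i => [[|[|[|[|?]]]] ?]; case: j => [[|[|[|[|?]]]] ?];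
  try (by []); move=> _; rewrite /vs [nth _ _ _]/= [nth _ _ _]/=.
all: rewrite ?xa ?xb ?xc ?[adj _ x]adj_sym ?xa ?xb ?xc; try (by []); move=> _ d.
all: by rewrite ?d ?(Dsym a b) ?(Dsym a c) ?(Dsym b c) ?d ?orbT.
Qed.
End Covers.

(** * Longest cycles through all heavy vertices *)

Section Longest.
Variable G : sgraph.
Implicit Types (x y z u v w : G) (c C E R t : seq G).
Notation adj := (@adj G).
Notation ore := (@ore G).

Definition heavy_cycle c : bool :=
  [&& cycle adj c && uniq c, 2 < size c & [forall x, heavy x ==> (x \in c)]].

Definition longest C : Prop :=
  heavy_cycle C /\ forall c, heavy_cycle c -> size c <= size C.

Lemma longest_uniq C : longest C -> uniq C.
Proof. by case=> /and3P[/andP[_ ->]]. Qed.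

Lemma longest_light C x : longest C -> x \notin C -> ~~ heavy x.
Proof. by case=> /and3P[_ _ /forallP/(_ x)/implyP h] _; apply: contra. Qed.

(** [ore_cycle] turns [t] into a cycle on at least the same vertices, so it still contains all heavy
    ones and is longer than [C]. The rerouting contradictions below all come from here, by the
    choice of [t]. *)
Lemma longest_nocycle C E t x y : longest C -> uniq (C ++ E) -> E != [::] ->
  trail ore t x y -> ore y x -> perm_eq t (C ++ E) -> False.
Proof.
case=> /and3P[_ sC /forallP hC] maxC uCE E0 tt yx pt.
have ut : ucycle ore t.
  by rewrite /ucycle (perm_uniq pt) uCE (trail_cycle tt yx).
have st : size t = size C + size E by rewrite (perm_size pt) size_cat.
have E1 : 0 < size E by case: (E) E0.
have [|c [cc sc tc]] := ore_cycle ut; first by lia.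
have := maxC c; rewrite /heavy_cycle; move/andP: cc => [-> ->]; rewrite sc /=.
have -> : [forall x, heavy x ==> (x \in c)].
  apply/forallP=> w; apply/implyP=> hw; apply/tc.
  by rewrite (perm_mem pt) mem_cat (implyP (hC w)).
move/(_ isT) => h1; case/andP: ut => _ ut.
have := leq_trans (uniq_leq_size ut tc) h1.
by rewrite (perm_size pt) size_cat -[X in _ <= X -> _]addn0 leq_add2l leqNgt E1.
Qed.

Hypothesis hconn : k_connected 2 G.

Lemma card_G : 2 < #|G|. Proof. by case: hconn. Qed.

Lemma path_avoid w x y : x != w -> y != w ->
  exists p, [/\ path adj x p, last x p = y & w \notin x :: p].
Proof.
move=> xw yw; case: hconn => _ /(_ [set w]); rewrite cards1 => /(_ isT) conn.
have hx : x \in ~: [set w] by rewrite !inE.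
have hy : y \in ~: [set w] by rewrite !inE.
have /connectP[p pp ep] := conn (exist _ x hx) (exist _ y hy).
exists (map val p); split.
- by rewrite -[x]/(val (exist (fun z => z \in ~: [set w]) x hx)) path_map.
- by rewrite -[x]/(val (exist (fun z => z \in ~: [set w]) x hx)) last_map -ep.
- rewrite -[x]/(val (exist (fun z => z \in ~: [set w]) x hx)) -map_cons.
  by apply/mapP=> -[z _ e]; have := valP z; rewrite -e !inE eqxx.
Qed.

Lemma third x y : exists2 w, w != x & w != y.
Proof.
have : [set x; y] != setT.
  by apply/eqP=> e; have := card_G; rewrite -cardsT -e cards2; case: eqP.
rewrite -subTset => /subsetPn[w _]; rewrite !inE negb_or => /andP[h1 h2].
by exists w.
Qed.

(** Leave [y] by a neighbour [z] other than [x], found on a path avoiding [x], and return from [z]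
    to [x] avoiding [y]. *)
Lemma ore_edge_cycle x y : ore x y ->
  exists c, [/\ ucycle ore c, 2 < size c, x \in c & y \in c].
Proof.
move=> oxy; have nxy := ore_neq oxy.
have [w wx wy] := third x y.
have [|p [pp lp xp]] := @path_avoid x y w _ wx; first by rewrite eq_sym.
case: p pp lp xp => [|z p] /=; first by move=> _ e; rewrite e eqxx in wy.
case/andP=> yz _ _; rewrite !inE !negb_or => /and3P[_ xz _].
have zy : z != y by rewrite eq_sym adj_neq.
have [q [pq lq yq]] := path_avoid zy nxy.
case: (shortenP pq) lq yq => q' pq' uq' sub lq yq.
exists (y :: z :: q'); split; rewrite ?mem_head //.
- have yq' : y \notin z :: q'.
    apply: contra yq; rewrite !inE => /orP[->//|/sub ->]; by rewrite orbT.
  rewrite /ucycle cons_uniq yq' uq' !andbT.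
  apply: (trail_cycle (x := y) (y := x)) => //.
  rewrite trailE eqxx /= lq eqxx andbT adj_ore //=.
  by apply: sub_path pq'; apply: adj_ore.
- by case: q' {sub uq' pq'} lq xz => //= ->; rewrite eqxx.
- by rewrite inE -lq mem_last orbT.
Qed.

Lemma heavy_clique_cycle (c : seq G) : uniq c -> 2 < size c ->
  {in c, forall x, heavy x} -> ucycle ore c.
Proof.
move=> uc sc hc; rewrite /ucycle uc andbT.
case: c uc sc hc => // a s uc sc hc.
have pw : pairwise ore (a :: s).
  move: uc; rewrite uniq_pairwise.
  apply: (@sub_in_pairwise _ (mem (a :: s))) => [x y /hc hx /hc hy|]; last by apply/allP.
  exact: heavy_ore.
apply: (trail_cycle (x := a) (y := last a s)).
  by rewrite trail_path //; apply: (pairwise_sorted pw).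
have ls : last a s \in s by case: (s) sc => //= b s' _; apply: mem_last.
apply: heavy_ore; rewrite ?hc ?mem_head ?mem_last //.
by apply: contraTneq ls => ->; case/andP: uc.
Qed.

(** Three or more heavy vertices form a clique of [ore]; at most two are contained in a single pair
    of [ore], to which [ore_edge_cycle] applies. *)
Lemma heavy_cycle_exists : exists c, heavy_cycle c.
Proof.
suff [c [cc sc hc]] : exists c, [/\ ucycle ore c, 2 < size c & forall x, heavy x -> x \in c].
  have [d [dd sd hd]] := ore_cycle cc sc.
  exists d; rewrite /heavy_cycle; move/andP: dd => [-> ->]; rewrite sd /=.
  apply/forallP=> x; apply/implyP=> hx.
  exact/hd/hc.
pose H := [set x : G | heavy x].
have [cH|cH] := leqP 3 #|H|.
  exists (enum H); rewrite -cardE; split=> //.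
    apply: heavy_clique_cycle; rewrite ?enum_uniq -?cardE //.
    by move=> x; rewrite mem_enum inE.
  by move=> x hx; rewrite mem_enum inE.
suff [x [y [oxy sub]]] : exists x y, ore x y /\ H \subset [set x; y].
  have [c [c1 c2 c3 c4]] := ore_edge_cycle oxy.
  exists c; split=> // z hz; have : z \in [set x; y] by rewrite (subsetP sub) ?inE.
  by rewrite !inE => /orP[] /eqP->.
have nbr x : exists y, ore x y.
  have [w wx _] := third x x; have [w' w'x w'w] := third x w.
  have [||q [pq lq _]] := @path_avoid w' x w; [by rewrite eq_sym|by rewrite eq_sym|].
  case: q pq lq => [_ /= e|b q /= /andP[h _] _]; first by rewrite e eqxx in wx.
  by exists b; apply: adj_ore.
have [/eqP H0|nH0] := boolP (H == set0).
  have /card_gt0P[x _] : 0 < #|G| by apply: leq_trans card_G.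
  by have [y xy] := nbr x; exists x, y; rewrite H0 sub0set.
have [/cards1P[x Hx]|nH1] := boolP (#|H| == 1).
  by have [y xy] := nbr x; exists x, y; rewrite Hx sub1set !inE eqxx.
have /cards2P[x [y [xy Hxy]]] : #|H| == 2.
  by rewrite -cards_eq0 in nH0; move: nH0 nH1 cH; lia.
have [hx hy] : heavy x /\ heavy y.
  have [] : x \in H /\ y \in H by rewrite Hxy !inE !eqxx orbT.
  by rewrite !inE.
by exists x, y; rewrite Hxy subxx heavy_ore.
Qed.

Lemma longest_exists : exists C, longest C.
Proof.
have [c hc] := heavy_cycle_exists.
pose A m := [exists t : m.-tuple G, heavy_cycle t].
have exA : exists m, A m by exists (size c); apply/existsP; exists (in_tuple c).
have ub m : A m -> m <= #|G|.
  case/existsP=> t /and3P[/andP[_ ut] _ _].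
  by rewrite -(size_tuple t) -(card_uniqP ut) max_card.
case: (ex_maxnP exA ub) => m /existsP[t ht] max.
exists t; split=> // d hd; rewrite size_tuple; apply: max.
by apply/existsP; exists (in_tuple d).
Qed.

Lemma first_hit C x p : path adj x p -> last x p \in C -> x \notin C ->
  exists q u, [/\ path [rel a b | adj a b && (b \notin C)] x q,
    adj (last x q) u, u \in C & u \in p].
Proof.
elim: p x => [|y p IH] x /=; first by move=> _ ->.
case/andP=> xy py ly xC; have [yC|yC] := boolP (y \in C).
  by exists [::], y; rewrite mem_head.
have [q [u [h1 h2 h3 h4]]] := IH y py ly yC.
by exists (y :: q), u; rewrite /= xy yC inE h4 orbT.
Qed.

Definition outer C R u v : Prop :=
  [/\ u \in C, v \in C, u != v, R != [::] & link adj R u v /\ uniq (C ++ R)].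

(** A path from [x] first meets [C] in [u]; a second one avoiding [u] first meets it in some [v]
    other than [u]. The outer parts of both are connected through [x], and a simple path is chosen
    in their component outside [C]. *)
Lemma outer_path_exists C x : longest C -> x \notin C -> exists R u v, outer C R u v.
Proof.
move=> lC xC; have uC := longest_uniq lC.
have [sC] : 2 < size C by case: lC => /and3P[].
case: C lC xC uC sC => [//|c0 [//|c1 C0]]; set C := [:: c0, c1 & C0] => lC xC uC sC.
have [p [pp lp _]] : exists p, [/\ path adj x p, last x p = c0 & c1 \notin x :: p].
  apply: path_avoid; first by apply: contraNneq xC => ->; rewrite !inE eqxx orbT.
  by move: uC; rewrite /= inE negb_or => /andP[/andP[]].
have [|q1 [u [h1 h2 uinC _]]] := first_hit pp _ xC; first by rewrite lp mem_head.
have [c cu cC] : exists2 c, c != u & c \in C.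
  have [e|e] := eqVneq c0 u; last by exists c0; rewrite ?mem_head.
  exists c1; rewrite ?inE ?eqxx ?orbT // -e eq_sym.
  by move: uC; rewrite /= inE negb_or => /andP[/andP[]].
have xu : x != u by apply: contraNneq xC => ->.
have [p2 [pp2 lp2 up2]] := path_avoid xu cu.
have [|q2 [v [g1 g2 vinC vp2]]] := first_hit pp2 _ xC; first by rewrite lp2.
have uv : u != v by apply: contraNneq up2 => ->; rewrite inE vp2 orbT.
pose e := [rel a b : G | [&& adj a b, a \notin C & b \notin C]].
have esym : symmetric e by move=> a b; rewrite /= adj_sym; congr andb; rewrite andbC.
have tr q : path [rel a b | adj a b && (b \notin C)] x q -> path e x q.
  elim: q x xC {pp pp2 lp lp2 h1 g1 h2 g2 xu up2} => //= b q IH x xC /andP[/andP[xb bC] pq].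
  by rewrite xb xC bC /= IH.
have cn : connect e (last x q1) (last x q2).
  apply: (@connect_trans _ _ x).
    by rewrite (sym_connect_sym esym); apply/connectP; exists q1; rewrite ?tr.
  by apply/connectP; exists q2; rewrite ?tr.
have rC : last x q1 \notin C.
  by case/lastP: q1 h1 {h2 cn} => [|q l] //; rewrite rcons_path last_rcons /= => /and3P[].
case/connectP: cn => p3 pp3 lp3; case: (shortenP pp3) lp3 => q pq uq _ lq.
have qC : all (fun z => z \notin C) q.
  by elim: q (last x q1) pq {uq lq} => //= b q IH a /andP[/and3P[_ _ ->]] /IH.
exists (last x q1 :: q), u, v; split=> //; split.
  rewrite /link /= adj_sym h2 rcons_path -lq g2 andbT.
  by apply: sub_path pq => a b /and3P[].
rewrite cat_uniq uC uq andbT /= negb_or rC /=.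
by apply/hasPn=> z /(allP qC).
Qed.

(* The chord [uv] itself is not excluded. *)
Definition chordless R u v : Prop :=
  [/\ forall (t s : G) R1, R = rcons (rcons R1 t) s -> ~~ adj t v,
      forall (t s : G) R1, R = s :: t :: R1 -> ~~ adj u t &
      forall r1 r2 r3 R1, R = [:: r1, r2, r3 & R1] -> ~~ adj r1 r3 && ~~ adj u r3].

Lemma chordless_exists C R u v : outer C R u v ->
  exists2 R', outer C R' u v & chordless R' u v.
Proof.
case=> uC vC uv R0 [lR uCR].
(* [C] may be entered only at [v] and only from outside, so the edge [uv] is not a competitor for
   the shortest path. *)
pose e := [rel a b : G | adj a b && ((b \notin C) || (b == v) && (a \notin C))].
have RC z : z \in R -> z \notin C.
  by move: uCR; rewrite cat_uniq => /and3P[_ /hasPn h _] /h.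
have ext (Q : seq G) a : all (fun z => z \notin C) Q -> (Q != [::]) || (a \notin C) ->
    link adj Q a v -> path e a (rcons Q v).
  elim: Q a => [|b Q IH] a /=; first by move=> _ aC; rewrite link0 => ->; rewrite eqxx aC orbT.
  case/andP=> bC QC _; rewrite link_cons => /andP[ab lQ]; rewrite ab bC /=.
  by apply: IH => //; rewrite bC orbT.
have [p sp] : exists p, shortest e (pred1 v) u p.
  apply: (@shortest_exists _ _ _ _ (rcons R v)); last by rewrite /= last_rcons.
  by apply: ext; rewrite ?R0 //; apply/allP.
have up := shortest_uniq sp.
have nt i := shortest_nontarget (i := i) sp.
case: sp => pp lp minp.
case/lastP: p pp lp minp up nt => [|Q l] pp lp minp up nt; first by rewrite /= (negPf uv) in lp.
move: lp; rewrite last_rcons /= => /eqP ?; subst l.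
have Qv : v \notin Q by move: up; rewrite cons_uniq rcons_uniq => /and3P[].
have QC : all (fun z => z \notin C) Q.
  move: pp; rewrite rcons_path => /andP[+ _]; elim: (Q) (u) Qv => //= b Q' IH a.
  rewrite inE negb_or eq_sym => /andP[bv Qv] /andP[/andP[_ h] /IH-> //].
  by move: h; rewrite (negPf bv) orbF => ->.
have lQ : link adj Q u v by apply: sub_path pp => a b /andP[].
have Q0 : Q != [::].
  by case: (Q) pp => //=; rewrite uC vC eqxx andbF.
exists Q.
  split=> //; split=> //; move: uCR up; rewrite !cat_uniq cons_uniq rcons_uniq.
  by case/and3P=> -> _ _ /and3P[_ _ ->]; rewrite andbT; apply/hasPn => z /(allP QC).
have short (Q' : seq G) : all (fun z => z \notin C) Q' -> Q' != [::] -> link adj Q' u v ->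
    size Q <= size Q'.
  move=> h1 h2 h3; have := minp (rcons Q' v); rewrite !size_rcons last_rcons /= ltnS.
  by apply; rewrite ?eqxx // ext ?h2.
split.
- move=> t s R1 eQ; apply/negP=> tv.
  move: lQ QC short; rewrite eQ !link_rcons all_rcons all_rcons => /andP[/andP[l1 _] _].
  case/and3P=> _ tC R1C /(_ (rcons R1 t)); rewrite link_rcons l1 tv all_rcons tC R1C.
  by rewrite !size_rcons ltnn -size_eq0 size_rcons => /(_ isT isT isT).
- move=> t s R1 eQ; apply/negP=> ut.
  move: lQ QC short; rewrite eQ !link_cons /= => /and3P[_ _ l1].
  case/and3P=> _ tC R1C /(_ (t :: R1)); rewrite link_cons l1 ut /= tC R1C.
  by rewrite ltnn => /(_ isT isT isT).
- move=> r1 r2 r3 R1 eQ.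
  move: lQ QC short; rewrite eQ !link_cons /= => /and4P[e1 _ _ l1].
  case/and4P=> r1C _ r3C R1C short; apply/andP; split; apply/negP=> h.
    have := short (r1 :: r3 :: R1); rewrite !link_cons e1 h l1 /= r1C r3C R1C ltnn.
    by move/(_ isT isT isT).
  have := short (r3 :: R1); rewrite !link_cons h l1 /= r3C R1C ltnNge leqW //.
  by move/(_ isT isT isT).
Qed.
End Longest.

(** * Cycles through two attached vertices *)

Lemma link_split (T : eqType) (e : rel T) R1 z R2 u v : link e (R1 ++ z :: R2) u v ->
  (exists2 r, trail e (rcons R1 z) r z & e u r) /\
  (exists2 s, trail e (z :: R2) z s & e s v).
Proof.
rewrite link_cat /link !rcons_path => /andP[/andP[h1 h2] /andP[h3 h4]]; split.
  case: R1 h1 h2 => [|a R1] /=; first by exists z => //=; rewrite !eqxx.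
  by case/andP=> ua p1 lz; exists a => //=; rewrite eqxx rcons_path p1 lz last_rcons eqxx.
by exists (last z R2) => //; apply: trail_path.
Qed.

Ltac leaf := match goal with
  | H : is_true (trail (@ore _) ?s _ _) |- is_true (trail (@ore _) ?s _ _) => exact H
  | H : is_true (trail (@adj _) ?s _ _) |- is_true (trail (@ore _) ?s _ _) =>
      exact (sub_trail (@adj_ore _) H)
  | H : is_true (trail (@adj _) ?s _ _) |- is_true (trail (@adj _) ?s _ _) => exact H
  | H : is_true (trail (@ore _) ?s _ _) |- is_true (trail (@ore _) (rev ?s) _ _) =>
      exact (trail_rev (@ore_sym _) H)
  | H : is_true (trail (@adj _) ?s _ _) |- is_true (trail (@ore _) (rev ?s) _ _) =>
      exact (trail_rev (@ore_sym _) (sub_trail (@adj_ore _) H))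
  | H : is_true (trail (@adj _) ?s _ _) |- is_true (trail (@adj _) (rev ?s) _ _) =>
      exact (trail_rev (@adj_sym _) H)
  | |- is_true (trail _ [:: _] _ _) => exact: trail1 end.
Ltac oedge := match goal with
  | H : is_true (ore ?a ?b) |- is_true (ore ?a ?b) => exact H
  | H : is_true (ore ?b ?a) |- is_true (ore ?a ?b) => by rewrite ore_sym
  | H : is_true (adj ?a ?b) |- is_true (ore ?a ?b) => exact (adj_ore H)
  | H : is_true (adj ?b ?a) |- is_true (ore ?a ?b) => by rewrite ore_sym; exact (adj_ore H)
  | H : is_true (adj ?a ?b) |- is_true (adj ?a ?b) => exact H
  | H : is_true (adj ?b ?a) |- is_true (adj ?a ?b) => by rewrite adj_sym
  end.
Ltac trs := match goal with
  | |- is_true (trail _ (_ ++ _) _ _) => eapply trail_cat; [leaf | trs | oedge]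
  | |- _ => leaf end.
(** Counting a generic vertex turns concatenations and reversals into linear arithmetic. *)
Ltac permt := match goal with
  | H : is_true (perm_eq ?s ?t) |- is_true (perm_eq ?s ?t) => exact H
  | |- _ =>
    let p := fresh "p" in apply/permP => p;
    repeat match goal with H : is_true (perm_eq ?s ?t) |- ?g =>
      lazymatch g with context [count p s = count p t] => fail
      | _ => generalize (permP H p : count p s = count p t) end end;
    clear; rewrite ?(count_cat, count_rev) /= ?(count_cat, count_rev) /=; lia end.
(* Refutes the cycle [t] of [ore] through [C ++ E], whose pieces are read off the context. *)
Ltac nocyc lC E t :=
  eapply (@longest_nocycle _ _ E t _ _ lC);
  [ assumption | first [assumption | done] | trs | oedge | permt].

Ltac cfgt := match goal with |- is_true (perm_eq _ _) => permt
  | |- is_true (trail _ _ _ _) => trs | |- _ => oedge end.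

Section Cfg.
Variable G : sgraph.
Implicit Types (x y z u v w : G) (c C E R t M L A B : seq G).
Notation adj := (@adj G).
Notation ore := (@ore G).

(* [C] is the cycle [u M v L]. The successors of [u] and [v], and also their predecessors,
   are joined: this holds by [claw_cover] when the cycle consists of edges ([gcfg_cfg]). *)
Record cfg C u M m0 m1 v L l0 l1 : Prop := Cfg {
  cfg_M : trail ore M m0 m1;
  cfg_L : trail ore L l0 l1;
  cfg_um : ore u m0;
  cfg_mv : ore m1 v;
  cfg_vl : ore v l0;
  cfg_lu : ore l1 u;
  cfg_lm : ore l1 m0;
  cfg_ml : ore m1 l0;
  cfg_perm : perm_eq C ([:: u] ++ M ++ [:: v] ++ L) }.

Lemma cfg_swap C u M m0 m1 v L l0 l1 :
  cfg C u M m0 m1 v L l0 l1 -> cfg C v L l0 l1 u M m0 m1.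
Proof. by case=> *; split; cfgt. Qed.

Lemma cfg_rev C u M m0 m1 v L l0 l1 :
  cfg C u M m0 m1 v L l0 l1 -> cfg C u (rev L) l1 l0 v (rev M) m1 m0.
Proof. by case=> *; split; cfgt. Qed.

(** The join of [l1] and the successor [a] of [u] lets [u] slide past [A]: after [L] comes [A], then
    [u], then the rest of [M]. *)
Lemma cfg_shift C u A M a b x m1 v L l0 l1 :
  cfg C u (A ++ M) a m1 v L l0 l1 -> trail ore A a b -> trail ore M x m1 ->
  ore b u -> ore u x -> ore b x -> cfg C u M x m1 v (L ++ A) l0 b.
Proof. by case=> *; split; cfgt. Qed.

Section Facts.
Variables (C : seq G) (u v m0 m1 l0 l1 r s : G) (M L E : seq G).
Hypotheses (lC : longest C) (H : cfg C u M m0 m1 v L l0 l1).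
Hypotheses (uCE : uniq (C ++ E)) (tE : trail ore E r s).

Let E0 : E != [::]. Proof. exact: trail_neq0 tE. Qed.

(** In this and the next facts the excluded pair closes the displayed cycle. The versions numbered 2
    and 3 take [m0], or also [l0], off its arc and reinsert it through [cfg_lm] or [cfg_ml]. *)
Lemma cfg_heads : ore u r -> ore s v -> ~~ ore m0 l0.
Proof.
move=> ur sv; apply/negP=> h; case: H => *.
by nocyc lC E (E ++ [:: v] ++ rev M ++ L ++ [:: u]).
Qed.

Lemma cfg_u_head : ore u r -> ore s v -> ~~ ore u l0.
Proof.
move=> ur sv; apply/negP=> h; case: H => *.
by nocyc lC E (E ++ [:: v] ++ rev M ++ rev L ++ [:: u]).
Qed.

Lemma cfg_outer_head : ore u r -> ~~ ore s m0.
Proof.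
move=> ur; apply/negP=> h; case: H => *.
by nocyc lC E (E ++ M ++ [:: v] ++ L ++ [:: u]).
Qed.

Variables (M' L' : seq G) (m' l' : G).

Lemma cfg_heads2 : M = m0 :: M' -> trail ore M' m' m1 ->
  ore u r -> ore s v -> ~~ ore m' l0.
Proof.
move=> eM tM' ur sv; apply/negP=> h; case: H => *; subst M.
by nocyc lC E (E ++ [:: v] ++ rev M' ++ L ++ [:: m0] ++ [:: u]).
Qed.

Lemma cfg_u_head2 : M = m0 :: M' -> trail ore M' m' m1 ->
  ore u r -> ore s v -> ~~ ore v m'.
Proof.
move=> eM tM' ur sv; apply/negP=> h; case: H => *; subst M.
by nocyc lC E (rev E ++ [:: u] ++ [:: m0] ++ rev L ++ rev M' ++ [:: v]).
Qed.

Lemma cfg_heads3 : M = m0 :: M' -> trail ore M' m' m1 ->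
  L = l0 :: L' -> trail ore L' l' l1 ->
  ore u r -> ore s v -> ~~ ore m' l'.
Proof.
move=> eM tM' eL tL' ur sv; apply/negP=> h; case: H => *; subst M L.
by nocyc lC E (E ++ [:: v] ++ [:: l0] ++ rev M' ++ L' ++ [:: m0] ++ [:: u]).
Qed.

Lemma cfg_outer_head2 : M = m0 :: M' -> trail ore M' m' m1 -> ore u r -> ~~ ore s m'.
Proof.
move=> eM tM' ur; apply/negP=> h; case: H => *; subst M.
by nocyc lC E (E ++ M' ++ [:: v] ++ L ++ [:: m0] ++ [:: u]).
Qed.

End Facts.
End Cfg.

Section Runs.
Variable G : sgraph.
Implicit Types (x y z u v w : G) (c C E R t M L A B : seq G).
Notation adj := (@adj G).
Notation ore := (@ore G).

Record gcfg C u M m0 m1 v L l0 l1 : Prop := Gcfg {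
  gcfg_M : trail adj M m0 m1;
  gcfg_L : trail adj L l0 l1;
  gcfg_um : adj u m0;
  gcfg_mv : adj m1 v;
  gcfg_vl : adj v l0;
  gcfg_lu : adj l1 u;
  gcfg_perm : perm_eq C ([:: u] ++ M ++ [:: v] ++ L) }.

Lemma gcfg_swap C u M m0 m1 v L l0 l1 :
  gcfg C u M m0 m1 v L l0 l1 -> gcfg C v L l0 l1 u M m0 m1.
Proof. by case=> *; split; cfgt. Qed.

Lemma gcfg_rev C u M m0 m1 v L l0 l1 :
  gcfg C u M m0 m1 v L l0 l1 -> gcfg C u (rev L) l1 l0 v (rev M) m1 m0.
Proof. by case=> *; split; cfgt. Qed.

Lemma outer_ends C R u v : outer C R u v ->
  exists r s, [/\ trail adj R r s, adj u r, adj s v, uniq (C ++ R) & r \notin C].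
Proof.
case=> _ _ _ R0 [lR uCR]; have [r [s [tR ur sv]]] := link_trail lR R0.
exists r, s; split=> //; move: uCR; rewrite cat_uniq => /and3P[_ /hasPn h _].
by apply: h; case/andP: (trail_mem tR).
Qed.

Lemma outer_sym C R u v : outer C R u v -> outer C (rev R) v u.
Proof.
case=> uC vC uv R0 [lR uCR]; split=> //; first by rewrite eq_sym.
  by rewrite -size_eq0 size_rev size_eq0.
split; first by apply: link_rev lR; apply: adj_sym.
by move: uCR; rewrite !cat_uniq has_rev rev_uniq.
Qed.

(** An arc without inner vertices could be replaced by [R], so both arcs are nonempty. *)
Lemma gcfg_exists C R u v : longest C -> outer C R u v ->
  exists M m0 m1 L l0 l1, gcfg C u M m0 m1 v L l0 l1.
Proof.
move=> lC oR; have [r [s [tR ur sv uCR _]]] := outer_ends oR.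
have [uC vC uv R0 _] := oR.
have uniqC := longest_uniq lC.
have [/and3P[/andP[cC _] sC _] _] := lC.
have [i C' eC] := rot_to uC.
have vC' : v \in C'.
  by move: vC; rewrite -(mem_rot i) eC inE eq_sym (negPf uv).
move: cC; rewrite -(rot_cycle i) eC.
case/splitPr: vC' eC => M L eC.
rewrite /= -[path _ _ _]/(link adj (M ++ v :: L) u u) link_cat => /andP[lM lL].
have pC : perm_eq C ([:: u] ++ M ++ [:: v] ++ L).
  by rewrite perm_sym /= -eC perm_rot.
have M0 : M != [::].
  apply/eqP=> M0; move: lM lL pC; rewrite M0 link0 /= => lM lL pC.
  have L0 : L != [::].
    by apply: contraTneq sC => L0; rewrite (perm_size pC) L0.
  have [l0 [l1 [tL vl lu]]] := link_trail lL L0.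
  by nocyc lC R (R ++ [:: v] ++ L ++ [:: u]).
have L0 : L != [::].
  apply/eqP=> L0; move: lM lL pC; rewrite L0 link0 /= => lM lL pC.
  have [m0 [m1 [tM um mv]]] := link_trail lM M0.
  by nocyc lC R (R ++ [:: v] ++ rev M ++ [:: u]).
have [l0 [l1 [tL vl lu]]] := link_trail lL L0.
have [m0 [m1 [tM um mv]]] := link_trail lM M0.
by exists M, m0, m1, L, l0, l1.
Qed.

Hypothesis hclaw : claw_cover G.

(** Take the claw at [u] with leaves [r], [l1], [m0]: if [r] were joined to [l1] or [m0], it could
    be inserted into the cycle next to [u]. *)
Lemma gcfg_chord C R u M m0 m1 v L l0 l1 : longest C -> outer C R u v ->
  gcfg C u M m0 m1 v L l0 l1 -> ore l1 m0.
Proof.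
move=> lC oR H; have [r [s [tR ur sv uCR rC]]] := outer_ends oR.
have R0 := trail_neq0 tR.
case: H => tM tL um mv vl lu pC.
have mC : m0 \in C.
  by rewrite (perm_mem pC) !mem_cat; case/andP: (trail_mem tM) => ->; rewrite orbT.
have l1C : l1 \in C.
  by rewrite (perm_mem pC) !mem_cat; case/andP: (trail_mem tL) => _ ->; rewrite !orbT.
have lm : l1 != m0.
  have := longest_uniq lC; rewrite (perm_uniq pC) catA.
  rewrite 2!cat_uniq => /and3P[/and3P[_ /hasPn h1 _] /hasPn h2 _].
  apply: contraTneq (trail_mem tL) => e; rewrite e.
  apply/nandP; right; apply/negP => h3.
  have := h2 m0; rewrite !mem_cat h3 orbT => /(_ isT).
  by case/andP: (trail_mem tM) => ->; rewrite orbT.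
have ul : adj u l1 by rewrite adj_sym.
have rl : r != l1 by apply: contraNneq rC => ->.
have rm : r != m0 by apply: contraNneq rC => ->.
have uCr : uniq (C ++ [:: r]) by rewrite cats1 rcons_uniq rC longest_uniq.
case/or3P: (hclaw ur ul um rl rm lm) => // h; exfalso.
  by nocyc lC [:: r] ([:: r] ++ [:: u] ++ M ++ [:: v] ++ L).
by nocyc lC [:: r] ([:: r] ++ M ++ [:: v] ++ L ++ [:: u]).
Qed.

Lemma run_exists u M m0 m1 : trail adj M m0 m1 -> adj u m0 -> ~~ adj u m1 ->
  exists A x x' B, [/\ M = A ++ [:: x, x' & B], all (adj u) A, adj u x & ~~ adj u x'].
Proof.
elim: M m0 => // a [|b M] IH m0 /and3P[/eqP-> pM lM] um0 um1.
  by move: lM um1 => /= /eqP<-; rewrite um0.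
have [ub|ub] := boolP (adj u b); last by exists [::], m0, b, M.
have [|A [x [x' [B [-> h1 h2 h3]]]]] := IH b _ ub um1.
  by move: pM lM => /= /andP[_ ->] ->; rewrite eqxx.
by exists (m0 :: A), x, x', B; rewrite /= um0.
Qed.

Lemma cfg_run_shift C u A M m0 m1 v L l0 l1 x :
  cfg C u (A ++ M) m0 m1 v L l0 l1 -> trail ore M x m1 -> all (adj u) A -> adj u x ->
  exists l2, cfg C u M x m1 v (L ++ A) l0 l2.
Proof.
move=> H tM uA ux; case: A H uA => [|a A] H uA.
  have e : m0 = x.
    by move: (cfg_M H) tM => /=; case: (M) => // z M' /and3P[/eqP<- _ _] /and3P[/eqP<-].
  by exists l1; rewrite cats0; move: H; rewrite e.
have M0 := trail_neq0 tM.
have [p [q [h1 h2 h3]]] := trail_split (s := a :: A) isT M0 (cfg_M H).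
have eq : q = x by case: (M) tM h3 => // z M' /and3P[/eqP<- _ _] /and3P[/eqP<-].
subst q; exists p; apply: (cfg_shift H h1 tM) => //; last by oedge.
by rewrite ore_sym adj_ore //; apply: (allP uA); case/andP: (trail_mem h1).
Qed.

(* [x] is the last vertex of the initial run of neighbours of [u] after [u] on the cycle,
   and [x'] is next; likewise for [y], [y'] and [v]. *)
Record runs R u v x x' y y' : Prop := Runs {
  runs_adj : [/\ adj u x, adj x x', adj v y & adj y y'];
  runs_nadj : ~~ adj u x' && ~~ adj v y';
  runs_xy : [&& ~~ ore x y, ~~ ore x' y, ~~ ore x y' & ~~ ore x' y'];
  runs_uv : [&& ~~ ore u y, ~~ ore u y', ~~ ore v x & ~~ ore v x'];
  runs_R : forall z, z \in R -> [&& ~~ ore z x, ~~ ore z x', ~~ ore z y & ~~ ore z y'] }.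

Lemma outer_prefix C R u v z : outer C R u v -> z \in R ->
  exists E r, [/\ trail ore E r z, ore u r & uniq (C ++ E)].
Proof.
case=> _ _ _ _ [lR uCR] zR; case/splitPr: zR lR uCR => R1 R2 lR uCR.
have [[r tE ur] _] := link_split lR.
exists (rcons R1 z), r; split; [exact: (sub_trail (@adj_ore _) tE)|exact: adj_ore|].
by move: uCR; rewrite -cat_rcons catA cat_uniq => /andP[].
Qed.

Lemma gcfg_cfg C R u M m0 m1 v L l0 l1 : longest C -> outer C R u v ->
  gcfg C u M m0 m1 v L l0 l1 -> cfg C u M m0 m1 v L l0 l1.
Proof.
move=> lC oR H; have lm := gcfg_chord lC oR H.
have ml := gcfg_chord lC (outer_sym oR) (gcfg_swap H).
by case: H => *; split; cfgt.
Qed.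

Lemma cfg_u_tail C R u M m0 m1 v L l0 l1 : longest C -> outer C R u v ->
  cfg C u M m0 m1 v L l0 l1 -> ~~ ore u m1.
Proof.
move=> lC oR H; have [r [s [tR ur sv uCR _]]] := outer_ends oR.
apply: (cfg_u_head lC (cfg_rev H) uCR (sub_trail (@adj_ore _) tR)); exact: adj_ore.
Qed.

(** [cfg_run_shift] slides [u] and then [v] to the end of its run. Afterwards [x] and [y] head the
    two arcs and [x'] and [y'] come second, which are the positions treated by the facts on
    [cfg]. *)
Lemma runs_exist C R u v : longest C -> outer C R u v ->
  exists x x' y y', runs R u v x x' y y'.
Proof.
move=> lC oR; have [r [s [tR ur sv uCR _]]] := outer_ends oR.
have [M [m0 [m1 [L [l0 [l1 H]]]]]] := gcfg_exists lC oR.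
have K := gcfg_cfg lC oR H.
have um1 : ~~ adj u m1 by apply: contra (cfg_u_tail lC oR K); apply: adj_ore.
have vl1 : ~~ adj v l1.
  by apply: contra (cfg_u_tail lC (outer_sym oR) (cfg_swap K)); apply: adj_ore.
have [A [x [x' [B [eM uA ux ux']]]]] := run_exists (gcfg_M H) (gcfg_um H) um1.
have [A' [y [y' [B' [eL vA' vy vy']]]]] := run_exists (gcfg_L H) (gcfg_vl H) vl1.
have tl (e : rel G) (T a : seq G) (b t p q : G) : trail e (a ++ [:: b, t & T]) p q ->
   trail e [:: b, t & T] b q /\ e b t.
  case: a => [|a0 a] /and3P[/eqP ea]; first by move=> /= /andP[e1 e2] e3; rewrite eqxx e1 e2 e3.
  by rewrite cat_path last_cat /= => /and3P[_ _ /andP[-> ->]] ->; rewrite eqxx.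
have [tM xx'] : trail adj [:: x, x' & B] x m1 /\ adj x x'.
  by apply: (tl _ _ A _ _ m0); rewrite -eM (gcfg_M H).
have [tL yy'] : trail adj [:: y, y' & B'] y l1 /\ adj y y'.
  by apply: (tl _ _ A' _ _ l0); rewrite -eL (gcfg_L H).
rewrite eM in K; have [l2 K1] := cfg_run_shift K (sub_trail (@adj_ore _) tM) uA ux.
have {K1} := cfg_swap K1; rewrite eL -catA => K1.
have tL2 : trail ore ([:: y, y' & B'] ++ A) y l2.
  by case: (tl _ (B' ++ A) A' y y' _ _ (cfg_M K1)).
have [m2 K2] := cfg_run_shift K1 tL2 vA' vy.
have {}K2 := cfg_swap K2.
have tM2 := cfg_M K2.
have tM' : trail ore ((x' :: B) ++ A') x' m2.
  by move: tM2 => /= /and3P[_ /andP[_ ->] ->]; rewrite eqxx.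
have tL' : trail ore ((y' :: B') ++ A) y' l2.
  by move: tL2 => /= /and3P[_ /andP[_ ->] ->]; rewrite eqxx.
have oE := sub_trail (@adj_ore _) tR.
have uCR' : uniq (C ++ rev R) by move: uCR; rewrite !cat_uniq has_rev rev_uniq.
have oE' := trail_rev (@ore_sym _) oE.
have our := adj_ore ur; have osv := adj_ore sv.
have K3 := cfg_swap K2.
have ovs : ore v s by rewrite ore_sym.
have oru : ore r u by rewrite ore_sym.
exists x, x', y, y'; split=> //; first by rewrite ux' vy'.
- rewrite (cfg_heads lC K2 uCR oE our osv).
  rewrite (cfg_heads2 lC K2 uCR oE (erefl _) tM' our osv).
  rewrite ore_sym (cfg_heads2 lC K3 uCR' oE' (erefl _) tL' ovs oru).
  by rewrite (cfg_heads3 lC K2 uCR oE (erefl _) tM' (erefl _) tL' our osv).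
- rewrite (cfg_u_head lC K2 uCR oE our osv).
  rewrite (cfg_u_head2 lC K3 uCR' oE' (erefl _) tL' ovs oru).
  rewrite (cfg_u_head lC K3 uCR' oE' ovs oru).
  by rewrite (cfg_u_head2 lC K2 uCR oE (erefl _) tM' our osv).
- move=> z zR; have [E [r' [tE ur' uCE]]] := outer_prefix oR zR.
  have zR' : z \in rev R by rewrite mem_rev.
  have [F [s' [tF vs' uCF]]] := outer_prefix (outer_sym oR) zR'.
  rewrite (cfg_outer_head lC K2 uCE tE ur').
  rewrite (cfg_outer_head2 lC K2 uCE tE (erefl _) tM' ur').
  rewrite (cfg_outer_head lC K3 uCF tF vs').
  by rewrite (cfg_outer_head2 lC K3 uCF tF (erefl _) tL' vs').
Qed.

End Runs.

(** * Frames *)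

Section Frames.
Variable G : sgraph.
Implicit Types (x y z u v w : G) (C E R t M L A B : seq G).
Notation adj := (@adj G).
Notation ore := (@ore G).

Definition span (D : seq G) (x y : G) : Prop :=
  exists2 s, trail ore s x y & perm_eq s D.

Definition span2 (D : seq G) (x k i j : G) : Prop :=
  exists s t, [/\ trail ore s x k, trail ore t i j & perm_eq (s ++ t) D].

Lemma span_sym D x y : span D x y -> span D y x.
Proof. by case=> s h1 h2; exists (rev s); [trs | permt]. Qed.

Lemma span2_sym D x k i j : span2 D x k i j -> span2 D x k j i.
Proof. by case=> s [t [h1 h2 h3]]; exists s, (rev t); split; [trs | trs | permt]. Qed.

(* A cycle can cover [D] by a passage between any two of the exits [u], [a], [b]. For [x] in [D]
   other than an exit, it can do so by a passage between this exit and a second one together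
   with a path from [x] to the third. *)
Record end3 (D : seq G) (u a b : G) : Prop := End3 {
  end_ua : span D u a;
  end_ub : span D u b;
  end_ab : span D a b;
  end_u : forall x, x \in D -> x != u -> span2 D x a u b \/ span2 D x b u a;
  end_a : forall x, x \in D -> x != a -> span2 D x u a b \/ span2 D x b u a;
  end_b : forall x, x \in D -> x != b -> span2 D x u a b \/ span2 D x a u b;
  end_uniq : uniq [:: u; a; b] }.

Lemma end3_sym D u a b : end3 D u a b -> end3 D u b a.
Proof.
case=> h1 h2 h3 h4 h5 h6 h7; split=> //.
- exact: span_sym.
- by move=> x xD xu; case: (h4 x xD xu); auto.
- by move=> x xD xu; case: (h6 x xD xu) => [/span2_sym|]; auto.
- by move=> x xD xu; case: (h5 x xD xu) => [/span2_sym|]; auto.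
- by move: h7; rewrite /= !inE !negb_or => /and3P[/andP[-> ->]] + _; rewrite eq_sym => ->.
Qed.

Lemma end3_mem D u a b : end3 D u a b -> [&& u \in D, a \in D & b \in D].
Proof.
case=> -[s h1 p1] [t h2 p2] _ _ _ _ _.
have /andP[ua uu] := trail_mem h1; have /andP[_ ub] := trail_mem h2.
by rewrite -!(perm_mem p1) ua uu (perm_mem p1) -(perm_mem p2) ub.
Qed.

Lemma span_ext D i a p : span D i a -> ore a p -> span (p :: D) i p.
Proof. by case=> s h1 h2 h3; exists (s ++ [:: p]); [trs | permt]. Qed.

Lemma span2_ext1 D x a i j p : span2 D x a i j -> ore a p -> span2 (p :: D) x p i j.
Proof.
by case=> s [t [h1 h2 h3]] h4; exists (s ++ [:: p]), t; split; [trs | trs | permt].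
Qed.

Lemma span2_ext2 D x k i j p : span2 D x k i j -> ore i p -> span2 (p :: D) x k p j.
Proof.
by case=> s [t [h1 h2 h3]] h4; exists s, ([:: p] ++ t); split; [trs | trs | permt].
Qed.

Lemma span2_via D x k i j p : span2 D x k i j -> ore p x -> ore i p ->
  span (p :: D) j k.
Proof.
case=> s [t [h1 h2 h3]] h4 h5.
by exists (rev t ++ [:: p] ++ s); [trs | permt].
Qed.

Lemma span2_start D x k i j p : span2 D x k i j -> ore p x -> span2 (p :: D) i j p k.
Proof.
by case=> s [t [h1 h2 h3]] h4; exists t, ([:: p] ++ s); split; [trs | trs | permt].
Qed.

Lemma span_span2 D i j p : span D i j -> span2 (p :: D) p p i j.
Proof. by case=> s h1 h2; exists [:: p], s; split; [trs | trs | permt]. Qed.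

(** The new exit [p] replaces [a]. A passage between the other exits [u] and [b] collects [p] on the
    way, between [a] and [x], by joining the two paths of a [span2]. *)
Lemma end3_grow D u a b p x : end3 D u a b -> p \notin D -> ore a p ->
  x \in D -> x != a -> ore p x -> end3 (p :: D) u p b.
Proof.
move=> H pD ap xD xa px; have /and3P[uD aD bD] := end3_mem H.
have npu : p != u by apply: contraNneq pD => ->.
have npb : p != b by apply: contraNneq pD => ->.
case: H => h1 h2 h3 h4 h5 h6 h7.
have h2' : span (p :: D) u b.
  case: (h5 x xD xa) => h; last by apply: (span2_via (span2_sym h)) => //.
  by apply: span_sym; apply: span2_via h _ _.
split=> //.
- exact: span_ext ap.
- by apply: span_sym; apply: span_ext ap; apply: span_sym.
- move=> y; rewrite inE => /predU1P[-> _|yD yu]; first by left; apply: span_span2.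
  case: (h4 y yD yu) => h; [left|right]; first exact: span2_ext1 h ap.
  by apply: span2_sym; apply: span2_ext2 ap; apply: span2_sym.
- move=> y; rewrite inE => /predU1P[->|yD _]; first by rewrite eqxx.
  have [->|ya] := eqVneq y a.
    case: (h5 x xD xa) => h; last by left; have := span2_start (span2_sym h) px.
    by right; have := span2_start h px => /span2_sym.
  case: (h5 y yD ya) => h; [left|right]; first exact: span2_ext2 h ap.
  by apply: span2_sym; apply: span2_ext2 ap; apply: span2_sym.
- move=> y; rewrite inE => /predU1P[-> _|yD yb]; first by right; apply: span_span2.
  case: (h6 y yD yb) => h; [left|right]; last exact: span2_ext1 h ap.
  exact: span2_ext2 h ap.
- have ub : u != b by move: h7; rewrite /= !inE negb_or => /and3P[/andP[]].
  by rewrite /= !inE negb_or [u == p]eq_sym npu ub npb.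
Qed.

(** A passage from [u] to one new exit leaves [D] at the old exit of the other one and crosses the
    pair [p], [q]. *)
Lemma end3_grow2 D u a b p q : end3 D u a b -> p \notin D -> q \notin D ->
  ore a p -> ore b q -> ore p q -> end3 (p :: q :: D) u p q.
Proof.
move=> H pD qD ap bq pq; have /and3P[uD aD bD] := end3_mem H.
have npu : u != p by apply: contraNneq pD => <-.
have nqu : u != q by apply: contraNneq qD => <-.
have pqD s : perm_eq s (q :: p :: D) -> perm_eq s (p :: q :: D).
  by move/perm_trans; apply; rewrite -(cat1s q) -(cat1s p) perm_catCA.
have sw2 x k i j : span2 (q :: p :: D) x k i j -> span2 (p :: q :: D) x k i j.
  by case=> s [t [e1 e2 e3]]; exists s, t; split=> //; apply: pqD.
have sw x y : span (q :: p :: D) x y -> span (p :: q :: D) x y.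
  by case=> s e1 e2; exists s => //; apply: pqD.
case: H => h1 h2 h3 h4 h5 h6 h7.
have qp : ore q p by rewrite ore_sym.
have up : span (p :: q :: D) u p by apply: (span_ext (span_ext h2 bq)).
have uq : span (p :: q :: D) u q by apply: sw; apply: (span_ext (span_ext h1 ap)).
have qpq i : span D u i -> span2 (p :: q :: D) i u p q.
  by case=> s e1 e2; exists (rev s), ([:: p] ++ [:: q]); split; [trs|trs|permt].
split=> //.
- case: h3 => s e1 e2; exists ([:: p] ++ s ++ [:: q]); [trs|permt].
- move=> y; rewrite !inE => /or3P[/eqP->|/eqP->|yD] yu.
  + by left; apply: span_span2; apply: span_ext bq.
  + by right; apply: sw2; apply: span_span2; apply: span_ext ap.
  + case: (h4 y yD yu) => h; [left|right].
      apply: span2_ext1 ap; apply: span2_sym; apply: span2_ext2 bq; exact: span2_sym.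
    apply: sw2; apply: span2_ext1 bq; apply: span2_sym; apply: span2_ext2 ap; exact: span2_sym.
- move=> y; rewrite !inE => /or3P[/eqP->|/eqP->|yD] yp; first by rewrite eqxx in yp.
    by right; apply: sw2; apply: span_span2; apply: span_ext ap.
  have [->|ya] := eqVneq y a; first by left; apply: qpq.
  case: (h5 y yD ya) => h; [left|right].
    apply: span2_ext2 ap; apply: span2_sym; apply: span2_ext2 bq; exact: span2_sym.
  apply: sw2; apply: span2_ext1 bq; apply: span2_sym; apply: span2_ext2 ap; exact: span2_sym.
- move=> y; rewrite !inE => /or3P[/eqP->|/eqP->|yD] yq; last 1 first.
  + have [->|yb] := eqVneq y b; first by left; apply: qpq.
    case: (h6 y yD yb) => h; [left|right].
      apply: span2_ext2 ap; apply: span2_sym; apply: span2_ext2 bq; exact: span2_sym.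
    apply: span2_ext1 ap; apply: span2_sym; apply: span2_ext2 bq; exact: span2_sym.
  + by right; apply: span_span2; apply: span_ext bq.
  + by rewrite eqxx in yq.
- by rewrite /= !inE negb_or npu nqu (ore_neq pq).
Qed.

(* [C] consists of two connected ends, [D1] around [u] and [D2] around [v], and of two links
   [M], [L]. At first the ends are [u] and [v] with their two neighbours on [C]. *)
Record frame C u D1 a b M v D2 c d L : Prop := Frame {
  fr_perm : perm_eq C (D1 ++ M ++ D2 ++ L);
  fr_end1 : end3 D1 u a b;
  fr_end2 : end3 D2 v c d;
  fr_M : link adj M b c;
  fr_L : link adj L d a;
  fr_con1 : forall x, x \in D1 -> exists p, [/\ path adj u p, last u p = x & all (mem D1) p];
  fr_con2 : forall x, x \in D2 -> exists p, [/\ path adj v p, last v p = x & all (mem D2) p] }.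

Lemma frame_swap C u D1 a b M v D2 c d L :
  frame C u D1 a b M v D2 c d L -> frame C v D2 c d L u D1 a b M.
Proof. by case=> h1 *; split=> //; permt. Qed.

Lemma frame_rev C u D1 a b M v D2 c d L :
  frame C u D1 a b M v D2 c d L -> frame C u D1 b a (rev L) v D2 d c (rev M).
Proof.
case=> *; split=> //; try exact: end3_sym; try permt; apply: link_rev => //; exact: adj_sym.
Qed.

Section FrameFacts.
Variables (C : seq G) (u a b v c d r s p p' q q' : G) (D1 M D2 L R : seq G).
Hypotheses (lC : longest C) (uCR : uniq (C ++ R)).
Hypotheses (tR : trail ore R r s) (ur : ore u r) (sv : ore s v).
Hypotheses (tM : trail ore M p p') (bp : ore b p) (pc : ore p' c).
Hypotheses (tL : trail ore L q q') (dq : ore d q) (qa : ore q' a).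
Hypotheses (pC : perm_eq C (D1 ++ M ++ D2 ++ L)).
Hypotheses (e1 : end3 D1 u a b) (e2 : end3 D2 v c d).

Let R0 : R != [::]. Proof. exact: trail_neq0 tR. Qed.

(** The links [li], [lj], [lk] match the exits of the two ends. The cycle runs from [i] to [j], over
    [lj] to [j'], on to [y], across to [x], to [k], over [lk] to [k'], to [i'], and back over
    [li]. *)
Lemma cross_gen i j k i' j' k' li lj lk ti si tj sj tk sk x y :
  trail ore li ti si -> ore i ti -> ore si i' ->
  trail ore lj tj sj -> ore j tj -> ore sj j' ->
  trail ore lk tk sk -> ore k tk -> ore sk k' ->
  perm_eq (li ++ lj ++ lk) (M ++ L ++ R) ->
  span2 D1 x k i j -> span2 D2 y j' i' k' -> ~~ ore x y.
Proof.
move=> h1 h2 h3 h4 h5 h6 h7 h8 h9 h10 [s1 [t1 [g1 g2 g3]]] [s2 [t2 [g4 g5 g6]]].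
apply/negP=> xy.
by nocyc lC R (t1 ++ lj ++ rev s2 ++ s1 ++ lk ++ rev t2 ++ rev li).
Qed.

Lemma cross_edge x y : x \in D1 -> y \in D2 -> ore x y ->
  [\/ x = u /\ y = v, x = b /\ y = c | x = a /\ y = d].
Proof.
move=> xD yD xy.
have tLr : trail ore (rev L) q' q by trs.
have aq : ore a q' by oedge.
have qd : ore q d by oedge.
have gen := cross_gen.
have uq1 := end_uniq e1; have uq2 := end_uniq e2.
(* A cycle arises whenever the exits reached from [x] and from [y] are not matched by a link. In the
   six names the first letter is the exit reached from [x], the second the exit of [D1] matched with
   the one reached from [y]. *)
have bad_ab : span2 D1 x a u b -> span2 D2 y c v d -> False.
  move=> h1 h2; move: xy; apply/negP.
  by apply: (gen _ _ _ _ _ _ _ _ _ _ _ _ _ _ _ _ _ tR ur sv tM bp pc tLr aq qd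
    _ h1 h2); permt.
have bad_au : span2 D1 x a u b -> span2 D2 y v c d -> False.
  move=> h1 h2; move: xy; apply/negP.
  by apply: (gen _ _ _ _ _ _ _ _ _ _ _ _ _ _ _ _ _ tM bp pc tR ur sv tLr aq qd
    _ (span2_sym h1) h2); permt.
have bad_ba : span2 D1 x b u a -> span2 D2 y d v c -> False.
  move=> h1 h2; move: xy; apply/negP.
  by apply: (gen _ _ _ _ _ _ _ _ _ _ _ _ _ _ _ _ _ tR ur sv tLr aq qd tM bp pc
    _ h1 h2); permt.
have bad_bu : span2 D1 x b u a -> span2 D2 y v c d -> False.
  move=> h1 h2; move: xy; apply/negP.
  by apply: (gen _ _ _ _ _ _ _ _ _ _ _ _ _ _ _ _ _ tLr aq qd tR ur sv tM bp pc
    _ (span2_sym h1) (span2_sym h2)); permt.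
have bad_ua : span2 D1 x u a b -> span2 D2 y d v c -> False.
  move=> h1 h2; move: xy; apply/negP.
  by apply: (gen _ _ _ _ _ _ _ _ _ _ _ _ _ _ _ _ _ tM bp pc tLr aq qd tR ur sv
    _ (span2_sym h1) (span2_sym h2)); permt.
have bad_ub : span2 D1 x u a b -> span2 D2 y c v d -> False.
  move=> h1 h2; move: xy; apply/negP.
  by apply: (gen _ _ _ _ _ _ _ _ _ _ _ _ _ _ _ _ _ tLr aq qd tM bp pc tR ur sv
    _ h1 (span2_sym h2)); permt.
have Xu := end_u e1 xD; have Xa := end_a e1 xD; have Xb := end_b e1 xD.
have Yu := end_u e2 yD; have Yc := end_a e2 yD; have Yd := end_b e2 yD.
have eqP' (z w : G) : z = w \/ z != w by case: eqVneq; auto.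
case: (eqP' x u) => [xu|/Xu]; last first.
  case=> hx.
    have yd : y = d by case: (eqP' y d) => // /Yd[|] h; exfalso; auto.
    have xa : x = a.
      case: (eqP' x a) => // /Xa hx'; exfalso.
      have yv : y != v by move: uq2; rewrite yd eq_sym /= !inE !negb_or => /and3P[/andP[]].
      by case: (Yu yv) => h; [auto|]; case: hx' => ?; auto.
    by constructor 3.
  have yc : y = c by case: (eqP' y c) => // /Yc[|] h; exfalso; auto.
  have xb : x = b.
    case: (eqP' x b) => // /Xb hx'; exfalso.
    have yv : y != v by move: uq2; rewrite yc eq_sym /= !inE !negb_or => /and3P[/andP[]].
    by case: (Yu yv) => h; [|auto]; case: hx' => ?; auto.
  by constructor 2.
constructor 1; split=> //.
case: (eqP' y v) => // /Yu hy; exfalso.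
have [xa xb] : x != a /\ x != b.
  by move: uq1; rewrite xu /= !inE !negb_or => /and3P[/andP[-> ->]].
by case: (Xa xa) => ?; case: (Xb xb) => ?; case: hy => ?; auto.
Qed.

Lemma link_last_end x : x \in D1 -> x != b -> ~~ ore p' x.
Proof.
move=> xD xb; apply/negP=> h.
have [[s1 [t1 [g1 g2 g3]]]|[s1 [t1 [g1 g2 g3]]]] := end_b e1 xD xb.
  have [s2 k1 k2] := span_sym (span_sym (end_ub e2)).
  by nocyc lC R (t1 ++ M ++ s1 ++ R ++ s2 ++ L).
have [s2 k1 k2] := end_ub e2.
by nocyc lC R (t1 ++ M ++ s1 ++ rev L ++ rev s2 ++ rev R).
Qed.

(** Here [E] hangs on [v] alone, like the last one or two vertices of [R]; the cycle passes [D1]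
    from [a] to [b] and does not use the rest of [R]. *)
Lemma outer_end2 E z y : uniq (C ++ E) -> trail ore E s z ->
  y \in D2 -> y != v -> ~~ ore z y.
Proof.
move=> uCE tE yD yv; apply/negP=> h; have E0 := trail_neq0 tE.
have [s0 k1 k2] := end_ab e1.
have [[s1 [t1 [g1 g2 g3]]]|[s1 [t1 [g1 g2 g3]]]] := end_u e2 yD yv.
  by nocyc lC E (E ++ s1 ++ rev M ++ rev s0 ++ rev L ++ rev t1).
by nocyc lC E (E ++ s1 ++ L ++ s0 ++ M ++ rev t1).
Qed.

Lemma outer_link2 E z : uniq (C ++ E) -> trail ore E s z -> ~~ ore z p' && ~~ ore z q.
Proof.
move=> uCE tE; apply/andP; split; apply/negP=> h; have E0 := trail_neq0 tE.
  have [s0 k1 k2] := end_ab e1; have [s2 k3 k4] := end_ub e2.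
  by nocyc lC E (E ++ rev M ++ rev s0 ++ rev L ++ rev s2).
have [s0 k1 k2] := end_ab e1; have [s2 k3 k4] := end_ua e2.
by nocyc lC E (E ++ L ++ s0 ++ M ++ rev s2).
Qed.

End FrameFacts.
End Frames.

(** * A net in an end on which [ore] is adjacency *)

Ltac nlia :=
  repeat match goal with
  | H : is_true (leq _ _) |- _ => revert H
  | H : is_true (leq _ _ && leq _ _) |- _ => revert H
  | H : is_true (~~ (leq _ _ && leq _ _)) |- _ => revert H
  | H : is_true (@eq_op _ ?x _) |- _ => let T := type of x in
       lazymatch T with nat => revert H | _ => fail end
  | H : is_true (~~ (@eq_op _ ?x _)) |- _ => let T := type of x in
       lazymatch T with nat => revert H | _ => fail end
  | H : @eq nat _ _ |- _ => revert H
  end; clear; intros; lia.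

Section Net.
Variable G : sgraph.
Notation adj := (@adj G).
Notation ore := (@ore G).
Hypothesis hclaw : claw_cover G.

Variables (D : seq G) (v c d s c' d' : G).
Hypothesis clean : forall x y, x \in D -> y \in D -> ore x y -> adj x y.
Hypothesis con : forall x, x \in D -> exists p, [/\ path adj v p, last v p = x & all (mem D) p].
Hypotheses (vD : v \in D) (cD : c \in D) (dD : d \in D).
Hypotheses (vc : v != c) (vd : v != d) (cd : c != d).
Hypotheses (sD : s \notin D) (c'D : c' \notin D) (d'D : d' \notin D) (cd' : c' != d').
Hypotheses (vs : adj v s) (cc' : adj c c') (dd' : adj d d').
Hypothesis only_s : forall x, x \in D -> x != v -> ~~ ore s x.
Hypothesis only_c : forall x, x \in D -> x != c -> ~~ ore c' x.
Hypothesis only_d : forall x, x \in D -> x != d -> ~~ ore d' x.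
Hypotheses (sc' : ~~ ore s c') (sd' : ~~ ore s d') (ncd' : ~~ ore c' d').

Let e := [rel x y : G | [&& adj x y, x \in D & y \in D]].

Lemma e_connect x : x \in D -> connect e v x.
Proof.
move=> /con[p [pp <- pD]]; apply/connectP; exists p => //.
elim: p (v) vD pp pD => //= b p IH a aD /andP[ab pp] /andP[bD pD].
by rewrite ab aD bD IH.
Qed.

Let nadj x y : ~~ ore x y -> ~~ adj x y.
Proof. by apply: contra; apply: adj_ore. Qed.

(** A shortest path from [c] to [d] in [D], prolonged by [c'] and [d'], has no chord even in [ore].
    A shortest path from [v] towards it ends in a vertex [w], whose neighbours on the first path are
    exactly two consecutive vertices by the claw condition. They form the triangle with [w]. The
    last clause prepares the longer pendant path of W and Z2. *)
Lemma net_exists : exists x1 x2 x3 y1 y2 y3 : G,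
  [/\ [/\ x1 \in D, x2 \in D & x3 \in D],
      [&& adj x1 x2, adj x2 x3, adj x1 x3, adj x1 y1, adj x2 y2 & adj x3 y3],
      [&& ~~ ore y1 y2, ~~ ore y1 y3 & ~~ ore y2 y3],
      [&& ~~ ore x1 y2, ~~ ore x1 y3, ~~ ore x2 y1, ~~ ore x2 y3, ~~ ore x3 y1 & ~~ ore x3 y2] &
      (y2 \in D \/ y2 = c') /\
      ((exists z1, [/\ y1 \in D, z1 \in D \/ z1 = s &
          [&& adj y1 z1, ~~ adj x1 z1, ~~ adj x2 z1, ~~ adj x3 z1 & ~~ adj z1 y2]]) \/
       y1 = s)].
Proof.
have esym : symmetric e.
  by move=> x y; rewrite /= adj_sym; congr andb; rewrite andbC.
have [p sp] : exists p, shortest e (pred1 d) c p.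
  have /connectP[p0 pp0 lp0] : connect e c d.
    apply: (@connect_trans _ _ v); last exact: e_connect.
    by rewrite (sym_connect_sym esym) e_connect.
  by apply: (shortest_exists pp0); rewrite /= -lp0.
have up := shortest_uniq sp.
have chord i j := shortest_chord (i := i) (j := j) sp.
have [pp /= /eqP lp _] := sp.
have pD : all (mem D) (c :: p).
  rewrite /= cD /=; elim: p (c) pp {up lp sp chord} => //= b p IH a /andP[/and3P[_ _ bD] pp].
  by rewrite bD (IH b).
have [l El] : exists l, l = size p by exists (size p).
have l0 : 0 < l by rewrite El; case: (p) lp cd => //= ->; rewrite eqxx.
pose PP := c' :: rcons (c :: p) d'.
pose f i := nth c PP i.
have sPP : size PP = l.+3 by rewrite /PP /= size_rcons El.
have fS i : i <= l -> f i.+1 = nth c (c :: p) i.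
  by move=> il; rewrite /f -[nth _ _ _]/(nth c (rcons (c :: p) d') i) nth_rcons /= ltnS -El il.
have f0 : f 0 = c' by [].
have f1 : f 1 = c by rewrite fS.
have fl : f l.+1 = d by rewrite fS // -lp (last_nth c) El.
have fd : f l.+2 = d'.
  by rewrite /f -[nth _ _ _]/(nth c (rcons (c :: p) d') l.+1) nth_rcons /= El ltnn eqxx.
have fD i : 0 < i <= l.+1 -> f i \in D.
  by case: i => // i il; rewrite fS //; apply: (allP pD); apply: mem_nth; rewrite /= -El.
have uPP : uniq PP.
  rewrite /PP cons_uniq mem_rcons in_cons negb_or cd' rcons_uniq up andbT /=.
  by apply/andP; split; [apply: contra c'D | apply: contra d'D]; apply: (allP pD).
have finj i j : i < l.+3 -> j < l.+3 -> (f i == f j) = (i == j).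
  by move=> il jl; rewrite /f nth_uniq ?sPP.
have fadj i : i <= l.+1 -> adj (f i) (f i.+1).
  case: i => [_|i il]; first by rewrite f1 f0 adj_sym.
  have [->|il'] := eqVneq i l; first by rewrite fl fd.
  have {}il : i < size p by rewrite -El ltn_neqAle il' -ltnS.
  rewrite !fS ?El // 1?ltnW //; move/pathP: pp => /(_ c i il) /and3P[h _ _]; exact: h.
have ford i j : i.+1 < j <= l.+2 -> ~~ ore (f i) (f j).
  case/andP=> ij jl; case: i ij => [|i] ij.
    have [->|jl'] := eqVneq j l.+2; first by rewrite f0 fd.
    have jD : 0 < j <= l.+1 by nlia.
    by apply: only_c (fD _ jD) _; rewrite -f1 finj //; nlia.
  have iD : 0 < i.+1 <= l.+1 by nlia.
  have [->|jl'] := eqVneq j l.+2.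
    rewrite fd ore_sym; apply: only_d (fD _ iD) _; rewrite -fl finj //; nlia.
  have jD : 0 < j <= l.+1 by nlia.
  apply/negP=> /(clean (fD _ iD) (fD _ jD)) h.
  case: j ij jl jl' jD h => // j ij jl jl' jD; rewrite !fS; try nlia; move=> h.
  have /chord : i < j <= size p by rewrite -El; nlia.
  rewrite /e /= h -!fS ?fD; [|nlia|nlia|nlia|nlia].
  by move=> /(_ isT); nlia.
(* Otherwise [v] and its two path neighbours, together with [s], violate the claw condition. As [v]
   is neither [c] nor [d], both neighbours lie in [D]. *)
have fv i : 0 < i <= l.+1 -> f i != v.
  move=> iD; apply/eqP=> fi.
  have i1 : i != 1 by apply/eqP=> i1; move: vc; rewrite -fi i1 f1 eqxx.
  have il : i != l.+1 by apply/eqP=> k1; move: vd; rewrite -fi k1 fl eqxx.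
  have a1 : adj v (f i.-1).
    by rewrite adj_sym -fi -{2}(prednK (n := i)) ?fadj //; nlia.
  have a2 : adj v (f i.+1) by rewrite -fi fadj //; nlia.
  have m1 : f i.-1 \in D by apply: fD; nlia.
  have m2 : f i.+1 \in D by apply: fD; nlia.
  have n1 : s != f i.-1 by apply: contraNneq sD => ->.
  have n2 : s != f i.+1 by apply: contraNneq sD => ->.
  have n3 : f i.-1 != f i.+1 by rewrite finj; nlia.
  have v1 : f i.-1 != v by rewrite eq_sym adj_neq.
  have v2 : f i.+1 != v by rewrite eq_sym adj_neq.
  case/or3P: (hclaw vs a1 a2 n1 n2 n3); apply/negP.
  - exact: only_s.
  - exact: only_s.
  - by apply: ford; nlia.
pose T := [pred x | has (adj x) (c :: p)].
have TP i x : 0 < i <= l.+1 -> adj x (f i) -> T x.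
  case: i => // i il h; apply/hasP; exists (f i.+1) => //.
  by rewrite fS // mem_nth //= -El.
have Tf i : 0 < i <= l.+1 -> T (f i).
  move=> il; have [i1|i1] := eqVneq i 1.
    by apply: (TP 2); [nlia|rewrite i1 fadj].
  by apply: (TP i.-1); [nlia|rewrite adj_sym -{2}(prednK (n := i)) ?fadj //; nlia].
have [q sq] : exists q, shortest e T v q.
  have /connectP[q0 pq0 lq0] := e_connect cD.
  by apply: (shortest_exists pq0); rewrite -lq0 -f1 Tf.
have [pq Tq _] := sq.
have qnT i := shortest_nontarget (i := i) sq.
have qchord i j := shortest_chord (i := i) (j := j) sq.
have qD : all (mem D) (v :: q).
  rewrite /= vD /=; elim: q (v) pq {sq Tq qnT qchord} => //= b q' IH a /andP[/and3P[_ _ bD] pq].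
  by rewrite bD (IH b).
have gD i : i <= size q -> nth v (v :: q) i \in D.
  by move=> iq; apply: (allP qD); apply: mem_nth.
have gadj i : i < size q -> adj (nth v (v :: q) i) (nth v (v :: q) i.+1).
  by move=> iq; move/pathP: pq => /(_ v i iq) /and3P[h _ _]; exact: h.
pose w := last v q.
have wE : w = nth v (v :: q) (size q) by rewrite /w (last_nth v).
have wD : w \in D by rewrite wE gD.
(* [y1] precedes [w] on the way from [s] through [v]; it is [s] when [w] is [v]. *)
pose y1 := if q is [::] then s else nth v (v :: q) (size q).-1.
have wy1 : adj w y1.
  rewrite /y1 wE; case: (q) gadj => // b q' gadj; rewrite adj_sym /=; exact: (gadj (size q')).
have y1c : y1 = s \/ [/\ y1 \in D, ~~ T y1 & q != [::]].
  rewrite /y1; case: (q) gD qnT => [|b q'] gD qnT; [by left|right].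
  by split=> //; [exact: (gD (size q') (leqnSn _)) | exact: (qnT (size q') (ltnSn _))].
(* If [w] lay on the path, its predecessor [y1] would already satisfy [T], unless [w] is [v], which
   [fv] covers. *)
have wP i : i <= l.+2 -> w != f i.
  move=> il; apply/eqP=> wf; have [iD|iD] := boolP (0 < i <= l.+1).
    case: y1c => [ys|[_ nT _]]; last first.
      by move/negP: nT; apply; apply: TP iD _; rewrite -wf adj_sym.
    have : w != v by rewrite wf fv.
    by move: ys sD; rewrite /y1 /w; case: (q) gD => [|b q'] gD //=; rewrite ?eqxx // => <-;
      have -> := gD (size q') (leqnSn _).
  case: i il wf iD => [|i] il wf iD; first by move: c'D; rewrite -f0 -wf wD.
  have il' : i = l.+1 by nlia.
  by move: d'D; rewrite -fd -il' -wf wD.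
have Yf i : i <= l.+2 -> ~~ ore y1 (f i).
  move=> il; case: y1c => [ys|[yD nT _]].
    rewrite ys; have [iD|iD] := boolP (0 < i <= l.+1).
      by apply: only_s; [exact: fD|exact: fv].
    case: i il iD => [|i] il iD; first by rewrite f0.
    by have il' : i = l.+1 by [nlia|]; rewrite il' fd.
  have [iD|iD] := boolP (0 < i <= l.+1).
    by apply: contra nT => /(clean yD (fD _ iD)) h; apply: TP iD h.
  case: i il iD => [|i] il iD.
    rewrite f0 ore_sym; apply: only_c => //; apply: contraNneq nT => ->.
    by rewrite -f1 Tf.
  have il' : i = l.+1 by nlia.
  rewrite il' fd ore_sym; apply: only_d => //; apply: contraNneq nT => ->.
  by rewrite -fl Tf //; nlia.
have yf i : 0 < i <= l.+1 -> y1 != f i.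
  move=> iD; case: y1c => [ys|[yD nT _]].
    by apply: contraNneq sD => e1; rewrite -ys e1 fD.
  by apply: contraNneq nT => ->; apply: Tf.
pose A i := (0 < i <= l.+1) && adj w (f i).
have exA : exists i, A i.
  have /hasP[z /(nthP c)[i il zi] wz] : T w by [].
  by exists i.+1; move: il => /=; rewrite -El => il; rewrite /A fS // zi wz andbT; nlia.
have ubA i : A i -> i <= l.+1 by case/andP; case/andP.
case: (ex_minnP exA) => i0 /andP[i0D wi0] min0.
case: (ex_maxnP exA ubA) => i1 /andP[i1D wi1] max1.
have wlow : ~~ ore w (f i0.-1).
  apply/negP=> h; have [i01|i01] := eqVneq i0 1.
    move: h; rewrite i01 f0 ore_sym; apply/negP; apply: only_c => //.
    by rewrite -f1 wP.
  have jD : 0 < i0.-1 <= l.+1 by nlia.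
  by have := min0 i0.-1; rewrite /A jD (clean wD (fD _ jD) h) => /(_ isT); nlia.
have whigh : ~~ ore w (f i1.+1).
  apply/negP=> h; have [i11|i11] := eqVneq i1 l.+1.
    move: h; rewrite i11 fd ore_sym; apply/negP; apply: only_d => //.
    by rewrite -fl wP.
  have jD : 0 < i1.+1 <= l.+1 by nlia.
  by have := max1 i1.+1; rewrite /A jD (clean wD (fD _ jD) h) => /(_ isT); nlia.
(* A single neighbour [f i0] of [w] would be the centre of a claw with leaves [w] and its two path
   neighbours. *)
have i01 : i0 < i1.
  have : i0 <= i1 by apply: min0; rewrite /A i1D wi1.
  rewrite leq_eqVlt => /predU1P[ii|//]; subst i1.
  have a1 : adj (f i0) (f i0.-1).
    by rewrite adj_sym -{2}(prednK (n := i0)) ?fadj //; nlia.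
  have a2 : adj (f i0) (f i0.+1) by rewrite fadj //; nlia.
  have a3 : adj (f i0) w by rewrite adj_sym.
  have n1 : f i0.-1 != f i0.+1 by rewrite finj; nlia.
  have n2 : f i0.-1 != w by rewrite eq_sym wP //; nlia.
  have n3 : f i0.+1 != w by rewrite eq_sym wP //; nlia.
  exfalso; case/or3P: (hclaw a1 a2 a3 n1 n2 n3) => h.
  - by move: h; apply/negP; apply: ford; nlia.
  - by rewrite ore_sym (negPf wlow) in h.
  - by rewrite ore_sym (negPf whigh) in h.
(* Otherwise [w] is the centre of a claw with leaves [y1], [f i0] and [f i1]. *)
have ii : i1 = i0.+1.
  apply/eqP/negPn/negP=> i1n.
  have n1 : y1 != f i0 by apply: yf.
  have n2 : y1 != f i1 by apply: yf.
  have n3 : f i0 != f i1 by rewrite finj; nlia.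
  case/or3P: (hclaw wy1 wi0 wi1 n1 n2 n3); apply/negP.
  - by apply: Yf; nlia.
  - by apply: Yf; nlia.
  - by apply: ford; nlia.
subst i1; rewrite -/(i0.+1) in whigh.
have b1 : adj (f i0) (f i0.-1) by rewrite adj_sym -{2}(prednK (n := i0)) ?fadj //; nlia.
have b2 : adj (f i0) (f i0.+1) by rewrite fadj //; nlia.
have b3 : adj (f i0.+1) (f i0.+2) by rewrite fadj //; nlia.
exists w, (f i0), (f i0.+1), y1, (f i0.-1), (f i0.+2).
have Y0 : ~~ ore y1 (f i0.-1) by apply: Yf; nlia.
have Y1 : ~~ ore y1 (f i0) by apply: Yf; nlia.
have Y2 : ~~ ore y1 (f i0.+1) by apply: Yf; nlia.
have Y3 : ~~ ore y1 (f i0.+2) by apply: Yf; nlia.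
have F1 : ~~ ore (f i0.-1) (f i0.+1) by apply: ford; nlia.
have F2 : ~~ ore (f i0.-1) (f i0.+2) by apply: ford; nlia.
have F3 : ~~ ore (f i0) (f i0.+2) by apply: ford; nlia.
split.
- by split=> //; apply: fD; nlia.
- by rewrite wi0 b2 wi1 wy1 b1 b3.
- by rewrite Y0 Y3 F2.
- by rewrite wlow whigh ore_sym Y1 F3 ore_sym Y2 ore_sym F1.
split.
  have [i01'|i01'] := eqVneq i0 1; [right; by rewrite i01'|left; apply: fD; nlia].
(* Beyond [y1] comes the vertex before it on the path from [v], or [s] when [y1] is [v]. *)
case: y1c => [->|[yD nT q0]]; [by right|left].
have [m2|m2] := leqP (size q) 1.
  have qs : size q = 1 by case: (q) q0 m2 => // a [|].
  have yv : y1 = v by rewrite /y1; case: (q) qs => // a [|].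
  exists s; split=> //; [by right|].
  have o i : 0 < i <= l.+1 -> ~~ adj (f i) s.
    by move=> iD; rewrite adj_sym nadj // only_s ?fD ?fv.
  rewrite yv vs o ?o //.
  have -> /= : ~~ adj w s.
    by rewrite adj_sym nadj // only_s //; rewrite yv in wy1; rewrite adj_neq.
  have [i01'|i01'] := eqVneq i0 1; first by rewrite i01' nadj.
  by rewrite adj_sym o //; nlia.
pose z := nth v (v :: q) (size q).-2.
have zD : z \in D by apply: gD; nlia.
have zT : ~~ T z by apply: qnT; nlia.
exists z; split=> //; first by left.
have o i : 0 < i <= l.+1 -> ~~ adj (f i) z.
  by move=> iD; apply: contra zT; rewrite adj_sym; apply: TP.
rewrite !o ?o //.
have -> /= : ~~ adj w z.
  rewrite adj_sym; apply/negP=> h; have /qchord : (size q).-2 < size q <= size q by nlia.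
  by rewrite -wE /e /= h zD wD => /(_ isT); nlia.
apply/andP; split.
  have -> : y1 = nth v (v :: q) (size q).-2.+1.
    by rewrite /y1; case: (q) m2 => // a [|].
  by rewrite adj_sym gadj //; nlia.
have [i01'|i01'] := eqVneq i0 1; last by rewrite adj_sym o //; nlia.
rewrite i01' nadj // ore_sym only_c //; apply: contraNneq zT => ->; by rewrite -f1 Tf.
Qed.
End Net.

(** * Ends grown as far as possible *)

Section Tight.
Variable G : sgraph.
Implicit Types (x y z u v w : G) (C E R t M L A B : seq G).
Notation adj := (@adj G).
Notation ore := (@ore G).

Lemma end3_triangle u a b : ore u a -> ore u b -> ore a b -> end3 [:: u; a; b] u a b.
Proof.
move=> ua ub ab.
have sp x y z : ore x y -> ore y z -> perm_eq [:: x; y; z] [:: u; a; b] -> span [:: u; a; b] x z.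
  by move=> xy yz pe; exists ([:: x] ++ [:: y] ++ [:: z]) => //; trs.
have sp2 x y z : ore y z -> perm_eq [:: x; y; z] [:: u; a; b] -> span2 [:: u; a; b] x x y z.
  by move=> yz pe; exists [:: x], ([:: y] ++ [:: z]); split => //; trs.
have bu : ore b u by rewrite ore_sym.
have ba : ore b a by rewrite ore_sym.
have au : ore a u by rewrite ore_sym.
have Su : span2 [:: u; a; b] u u a b by apply: sp2 => //; permt.
have Sa : span2 [:: u; a; b] a a u b by apply: sp2 => //; permt.
have Sb : span2 [:: u; a; b] b b u a by apply: sp2 => //; permt.
split.
- by apply: (sp _ b) => //; permt.
- by apply: (sp _ a) => //; permt.
- by apply: (sp _ u) => //; permt.
- by move=> x; rewrite !inE => /or3P[] /eqP->; auto; rewrite eqxx.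
- by move=> x; rewrite !inE => /or3P[] /eqP->; auto; rewrite eqxx.
- by move=> x; rewrite !inE => /or3P[] /eqP->; auto; rewrite eqxx.
- by rewrite /= !inE negb_or !ore_neq.
Qed.

(* No end can absorb the first or last vertex of a link. *)
Record tight_frame C u D1 a b M p p' v D2 c d L q q' : Prop := TightFrame {
  tf_frame : frame C u D1 a b M v D2 c d L;
  tf_M : trail adj M p p';
  tf_L : trail adj L q q';
  tf_adj : [/\ adj b p, adj p' c, adj d q & adj q' a];
  tf_p : forall x, x \in D1 -> x != b -> ~~ ore p x;
  tf_q' : forall x, x \in D1 -> x != a -> ~~ ore q' x;
  tf_p' : forall x, x \in D2 -> x != c -> ~~ ore p' x;
  tf_q : forall x, x \in D2 -> x != d -> ~~ ore q x;
  tf_pq : ~~ ore p q' && ~~ ore q p' }.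

Lemma tight_frame_swap C u D1 a b M p p' v D2 c d L q q' :
  tight_frame C u D1 a b M p p' v D2 c d L q q' ->
  tight_frame C v D2 c d L q q' u D1 a b M p p'.
Proof.
by case=> h1 h2 h3 [? ? ? ?] *; split; rewrite 1?andbC //; apply: frame_swap.
Qed.

Lemma frame_uniq C u D1 a b M v D2 c d L : longest C -> frame C u D1 a b M v D2 c d L ->
  uniq (D1 ++ M ++ D2 ++ L).
Proof. by move=> lC F; rewrite -(perm_uniq (fr_perm F)) longest_uniq. Qed.

Lemma con_ext D u b p :
  (forall x, x \in D -> exists s, [/\ path adj u s, last u s = x & all (mem D) s]) ->
  b \in D -> adj b p ->
  forall x, x \in p :: D -> exists s, [/\ path adj u s, last u s = x & all (mem (p :: D)) s].
Proof.
move=> con bD bp x; have sub (s : seq G) : all (mem D) s -> all (mem (p :: D)) s.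
  by apply: sub_all => z; rewrite /= inE => ->; rewrite orbT.
rewrite inE => /predU1P[->|/con[s [h1 h2 h3]]]; last by exists s; rewrite sub.
have [s [h1 h2 h3]] := con b bD.
by exists (rcons s p); rewrite rcons_path last_rcons h1 h2 bp all_rcons sub //= mem_head.
Qed.

Lemma frame_grow C u D1 a b p M v D2 c d L x : longest C ->
  frame C u D1 a b (p :: M) v D2 c d L -> x \in D1 -> x != b -> ore p x ->
  frame C u (p :: D1) a p M v D2 c d L.
Proof.
move=> lC F xD xb px; have pD : p \notin D1.
  have := frame_uniq lC F; rewrite cat_uniq => /and3P[_ /hasPn h _].
  by apply: h; rewrite mem_head.
case: F => pC e1 e2 lM lL c1 c2.
have bp : adj b p by case/andP: lM.
have /and3P[_ _ bD] := end3_mem e1.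
split=> //.
- by permt.
- by apply/end3_sym/(end3_grow (end3_sym e1) pD _ xD xb px); apply: adj_ore.
- by case/andP: lM.
- exact: con_ext c1 bD bp.
Qed.

Lemma frame_grow2 C u D1 a b p M v D2 c d L q : longest C ->
  frame C u D1 a b (p :: M) v D2 c d (rcons L q) -> ore p q ->
  frame C u (q :: p :: D1) q p M v D2 c d L.
Proof.
move=> lC F pq; have [pD qD] : p \notin D1 /\ q \notin D1.
  have := frame_uniq lC F; rewrite cat_uniq => /and3P[_ /hasPn h _].
  by split; apply: h; rewrite ?mem_head // !(mem_cat, mem_rcons, inE) eqxx !orbT.
case: F => pC e1 e2 lM lL c1 c2.
have bp : adj b p by case/andP: lM.
have /andP[lL' qa] : link adj L d q && adj q a by rewrite -link_rcons.
have /and3P[_ aD bD] := end3_mem e1.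
have aq : adj a q by rewrite adj_sym.
split=> //.
- by rewrite -cats1 in pC; permt.
- by apply: (end3_grow2 e1 qD pD); oedge.
- by case/andP: lM.
- apply: (con_ext (b := a) _ _ aq); last by rewrite inE aD orbT.
  exact: con_ext c1 bD bp.
Qed.

Section Exists.
Variables (C R : seq G) (u v : G).
Hypotheses (lC : longest C) (oR : outer C R u v).

(** If [M] were empty, [C] could be covered without it: through [D1] from [u] to [a], along [L],
    through [D2] to [v], and back along [R]. *)
Lemma frame_links D1 a b M D2 c d L : frame C u D1 a b M v D2 c d L ->
  M != [::] /\ L != [::].
Proof.
have [r [s [tR ur sv uCR _]]] := outer_ends oR.
have R0 := trail_neq0 tR.
have key D1' a' b' M' D2' c' d' L' : frame C u D1' a' b' M' v D2' c' d' L' -> M' != [::].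
  case=> pC e1 e2 lM lL _ _; apply/eqP=> M0; rewrite M0 /= in pC.
  have [s1 h1 h2] := end_ua e1; have [s2 h3 h4] := end_ub e2.
  have [L0|L0] := eqVneq L' [::].
    rewrite L0 ?cats0 in pC lL; rewrite link0 in lL.
    by nocyc lC R (s1 ++ rev s2 ++ rev R).
  have [q [q' [tL dq qa]]] := link_trail lL L0.
  by nocyc lC R (s1 ++ rev L' ++ rev s2 ++ rev R).
move=> F; split; first exact: key F.
by rewrite -size_eq0 -size_rev size_eq0; exact: key (frame_rev F).
Qed.

Definition tight_end (D1 : seq G) (a b : G) (M L : seq G) : bool :=
  let p := head b M in let q := last a L in
  [&& all (fun x => (x == b) || ~~ ore p x) D1,
      all (fun x => (x == a) || ~~ ore q x) D1 & ~~ ore p q].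

Lemma tight_or_grow D1 a b M D2 c d L : frame C u D1 a b M v D2 c d L ->
  tight_end D1 a b M L \/
  exists D1' a' b' M' L', frame C u D1' a' b' M' v D2 c d L' /\
     size M' + size L' < size M + size L.
Proof.
move=> F; have [M0 L0] := frame_links F.
case: M M0 F => // p M _ F; case/lastP: L L0 F => // L q _ F.
rewrite /tight_end /= last_rcons.
have [h1|/allPn[x xD]] := boolP (all (fun x => (x == b) || ~~ ore p x) D1); last first.
  rewrite negb_or negbK => /andP[xb px]; right.
  by exists (p :: D1), a, p, M, (rcons L q); split; [exact: frame_grow xD xb px|].
have [h2|/allPn[x xD]] := boolP (all (fun x => (x == a) || ~~ ore q x) D1); last first.
  rewrite negb_or negbK => /andP[xa qx]; right.
  have F' := frame_rev F; rewrite rev_rcons in F'.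
  have F2 := frame_rev (frame_grow lC F' xD xa qx).
  exists (q :: D1), q, b, (p :: M), L; split; first by rewrite !revK in F2.
  by rewrite size_rcons addnS.
have [h3|h3] := boolP (ore p q); last by left.
right; exists (q :: p :: D1), q, p, M, L; split; first exact: frame_grow2 F h3.
by rewrite size_rcons /=; lia.
Qed.
End Exists.

Lemma tight_end_trail D1 a b M L p p' q q' : tight_end D1 a b M L ->
  trail adj M p p' -> trail adj L q q' ->
  [/\ forall x, x \in D1 -> x != b -> ~~ ore p x,
      forall x, x \in D1 -> x != a -> ~~ ore q' x & ~~ ore p q'].
Proof.
rewrite /tight_end => + tM tL.
have -> : head b M = p by case: (M) tM => // z M' /and3P[/eqP].
have -> : last a L = q' by case: (L) tL => // z L' /and3P[_ _ /eqP].
case/and3P=> /allP h1 /allP h2 h3; split=> // x xD /negPf nx.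
  by have := h1 x xD; rewrite nx.
by have := h2 x xD; rewrite nx.
Qed.

Lemma tight_frame_grow C R u v D1 a b M D2 c d L : longest C -> outer C R u v ->
  frame C u D1 a b M v D2 c d L ->
  exists D1 a b M p p' D2 c d L q q', tight_frame C u D1 a b M p p' v D2 c d L q q'.
Proof.
move=> lC oR; have [k] := ubnP (size M + size L).
elim: k D1 a b M D2 c d L => // k IH D1 a b M D2 c d L; rewrite ltnS => sML F.
have [h1|[D1' [a' [b' [M' [L' [F' s']]]]]]] := tight_or_grow lC oR F; last first.
  by apply: IH F'; apply: leq_trans s' sML.
have [h2|[D2' [c' [d' [L' [M' [F' s']]]]]]] :=
  tight_or_grow lC (outer_sym oR) (frame_swap F); last first.
  by apply: IH (frame_swap F'); rewrite addnC; apply: leq_trans s' _; rewrite addnC.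
have [M0 L0] := frame_links lC oR F.
have [p [p' [tM bp pc]]] := link_trail (fr_M F) M0.
have [q [q' [tL dq qa]]] := link_trail (fr_L F) L0.
have [t1 t2 t3] := tight_end_trail h1 tM tL.
have [t4 t5 t6] := tight_end_trail h2 tL tM.
by exists D1, a, b, M, p, p', D2, c, d, L, q, q'; split=> //; rewrite t3.
Qed.

Hypothesis hclaw : claw_cover G.

(** The chords of [cfg] make the first ends triangles of [ore]. The three vertices differ and the
    arcs can lose both end vertices, since [u] is joined to [m0] but not to [m1], and likewise for
    [v]. *)
Lemma frame_exists C R u v : longest C -> outer C R u v ->
  exists D1 a b M D2 c d L, frame C u D1 a b M v D2 c d L.
Proof.
move=> lC oR; have [M [m0 [m1 [L [l0 [l1 H]]]]]] := gcfg_exists lC oR.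
have K := gcfg_cfg hclaw lC oR H.
have um1 := cfg_u_tail lC oR K.
have vl1 := cfg_u_tail lC (outer_sym oR) (cfg_swap K).
have m01 : m0 != m1 by apply: contraNneq um1 => <-; case: K.
have l01 : l0 != l1 by apply: contraNneq vl1 => <-; case: K.
case: H => tM tL um mv vl lu pC.
have [Mi eM lMi] := link_of_trail m01 tM.
have [Li eL lLi] := link_of_trail l01 tL.
exists [:: u; l1; m0], l1, m0, Mi, [:: v; m1; l0], m1, l0, Li; split=> //.
- by rewrite eM eL -!cats1 in pC; permt.
- by apply: end3_triangle; [rewrite ore_sym; exact: cfg_lu K | exact: cfg_um K | exact: cfg_lm K].
- by apply: end3_triangle; [rewrite ore_sym; exact: cfg_mv K | exact: cfg_vl K | exact: cfg_ml K].
- move=> x; rewrite !inE => /or3P[] /eqP->; [exists [::]|exists [:: l1]|exists [:: m0]];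
  by rewrite //= ?um ?(adj_sym u) ?lu !inE !eqxx ?orbT.
- move=> x; rewrite !inE => /or3P[] /eqP->; [exists [::]|exists [:: m1]|exists [:: l0]];
  by rewrite //= ?vl ?(adj_sym v m1) ?mv !inE !eqxx ?orbT.
Qed.
End Tight.

(** * Two heavy vertices in a clean end *)

Section Final.
Variable G : sgraph.
Implicit Types (x y z u v w : G) (C E R M L A B : seq G).
Notation adj := (@adj G).
Notation ore := (@ore G).
Hypothesis hclaw : claw_cover G.

(* By degree sums, one end of a tight frame is clean. *)
Definition clean (D : seq G) : bool := all (fun x => all (fun y => ore x y ==> adj x y) D) D.

Lemma cleanP D : clean D -> forall x y, x \in D -> y \in D -> ore x y -> adj x y.
Proof. by move=> /allP h x y /h/allP h' /h'/implyP. Qed.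

Lemma not_clean D : ~~ clean D -> exists x y,
  [/\ x \in D, y \in D, x != y & #|G| <= deg x + deg y].
Proof.
case/allPn=> x xD /allPn[y yD]; rewrite negb_imply => /andP[/andP[xy h] nxy].
by exists x, y; split=> //; rewrite (negPf nxy) in h.
Qed.

Lemma not_ore_deg x y : x != y -> ~~ ore x y -> deg x + deg y < #|G|.
Proof. by rewrite /ore /= => ->; rewrite negb_or -ltnNge => /andP[]. Qed.

Definition two_heavy (D : seq G) :=
  exists x y : G, [/\ x \in D, y \in D, x != y & heavy x && heavy y].

(** Heavy vertices are joined, so one of [y2], [y3] is light, and its pair with [x1] makes [x1]
    heavy; [y1] and [y3] do the same for [x2]. *)
Lemma net_two_heavy x1 x2 x3 y1 y2 y3 : net_cover G ->
  [&& adj x1 x2, adj x2 x3, adj x1 x3, adj x1 y1, adj x2 y2 & adj x3 y3] ->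
  [&& ~~ ore y1 y2, ~~ ore y1 y3 & ~~ ore y2 y3] ->
  [&& ~~ ore x1 y2, ~~ ore x1 y3, ~~ ore x2 y1, ~~ ore x2 y3, ~~ ore x3 y1 & ~~ ore x3 y2] ->
  heavy x1 && heavy x2.
Proof.
have n x y : ~~ ore x y -> ~~ adj x y by apply: contra; apply: adj_ore.
have d (a b c : G) : adj a c -> ~~ ore b c -> a != b.
  by move=> ac bc; apply: contraNneq bc => <-; apply: adj_ore.
move=> hN a1 /and3P[n1 n2 n3] /and5P[n4 n5 n6 n7 /andP[n8 n9]].
have := hN _ _ _ _ _ _ a1; rewrite !n //= => /(_ isT isT).
case/and5P: a1 => _ _ _ a1 /andP[a2 a3].
have y23 : ~~ (heavy y2 && heavy y3).
  apply: contra n3 => /andP[h1 h2]; apply: heavy_ore h1 h2 _.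
  apply: contraNneq n7 => <-; exact: adj_ore.
have y13 : ~~ (heavy y1 && heavy y3).
  apply: contra n2 => /andP[h1 h2]; apply: heavy_ore h1 h2 _.
  apply: contraNneq n5 => <-; exact: adj_ore.
case/and5P=> + + + + _.
by case: (heavy x1) y23 y13; case: (heavy x2); case: (heavy y1); case: (heavy y2); case: (heavy y3).
Qed.

Section Ends.
Variables (C R : seq G) (u v : G).
Hypotheses (lC : longest C) (oR : outer C R u v).
Variables (D1 M D2 L : seq G) (a b p p' c d q q' : G).
Hypothesis F : tight_frame C u D1 a b M p p' v D2 c d L q q'.

Lemma tight_cross x y : x \in D1 -> y \in D2 -> ore x y ->
  [\/ x = u /\ y = v, x = b /\ y = c | x = a /\ y = d].
Proof.
have [r [s [tR ur sv uCR _]]] := outer_ends oR.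
case: F => -[pC e1 e2 _ _ _ _] tM tL [bp pc dq qa] _ _ _ _ _.
have o := sub_trail (@adj_ore _).
apply: (cross_edge lC uCR (o _ _ _ _ tR) _ _ (o _ _ _ _ tM) _ _ (o _ _ _ _ tL) _ _ pC e1 e2);
  exact: adj_ore.
Qed.

Lemma tight_disjoint x y : x \in D1 -> y \in D2 -> x != y.
Proof.
move=> xD yD; apply: contraTneq yD => <-.
have := frame_uniq lC (tf_frame F); rewrite cat_uniq => /and3P[_ /hasPn h _].
by apply/negP=> xD2; have := h x; rewrite !mem_cat xD2 !orbT xD => /(_ isT).
Qed.

Lemma tight_cross_uniq z w w' : z \in D1 -> w \in D2 -> w' \in D2 ->
  ore z w -> ore z w' -> w = w'.
Proof.
move=> zD wD w'D /(tight_cross zD wD) h1 /(tight_cross zD w'D) h2.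
have := end_uniq (fr_end1 (tf_frame F)); rewrite /= !inE negb_or => /and3P[/andP[ua ub] ab _].
by case: h1 => -[e1 ->]; case: h2 => -[e2 ->] //; exfalso;
   move: ua ub ab; rewrite -?e1 -?e2 ?eqxx // => ?; rewrite -?e1 -?e2 ?eqxx.
Qed.

Lemma tight_outer_end E (s z y : G) : uniq (C ++ E) -> trail ore E s z -> ore s v ->
  y \in D2 -> y != v -> ~~ ore z y.
Proof.
case: F => -[pC e1 e2 _ _ _ _] tM tL [bp pc dq qa] _ _ _ _ _ uE tE sv.
have o := sub_trail (@adj_ore _).
exact: (outer_end2 lC sv (o _ _ _ _ tM) (adj_ore bp) (adj_ore pc) (o _ _ _ _ tL)
  (adj_ore dq) (adj_ore qa) pC e1 e2 uE tE).
Qed.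

Lemma tight_outer_link E (s z : G) : uniq (C ++ E) -> trail ore E s z -> ore s v ->
  ~~ ore z p' && ~~ ore z q.
Proof.
case: F => -[pC e1 e2 _ _ _ _] tM tL [bp pc dq qa] _ _ _ _ _ uE tE sv.
have o := sub_trail (@adj_ore _).
exact: (outer_link2 lC sv (o _ _ _ _ tM) (adj_ore bp) (adj_ore pc) (o _ _ _ _ tL)
  (adj_ore dq) (adj_ore qa) pC e1 e2 uE tE).
Qed.

(** The vertex before [s] on [u :: R] prolongs the pendant path of a net whose pendant vertex is
    [s]. If [R] is the single vertex [s], this is [u], and the edge [uv] must be absent. *)
Lemma tight_second_outer (s : G) : last u R = s ->
  (forall (t s : G) R1, R = rcons (rcons R1 t) s -> ~~ adj t v) -> (R = [:: s] -> ~~ adj u v) ->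
  exists t, [/\ adj s t, forall x, x \in D2 -> ~~ adj x t & ~~ adj t p'].
Proof.
have [r [s' [tR ur sv uCR _]]] := outer_ends oR.
have R0 := trail_neq0 tR.
have o := sub_trail (@adj_ore _).
have na x y : ~~ ore x y -> ~~ adj x y by apply: contra; apply: adj_ore.
have toe := tight_outer_end; have tol := tight_outer_link; have tc := tight_cross.
case: F => -[pC e1 e2 _ _ _ _] tM tL [bp pc dq qa] _ _ _ _ _ ls h1 h2.
have vs : adj v s.
  move: tR sv; rewrite -ls; case: (R) R0 => // z R' _ /and3P[_ _ /eqP lz].
  by rewrite adj_sym /= lz.
have svo : ore s v by rewrite ore_sym adj_ore.
case/lastP: R tR uCR R0 ls h1 h2 => // R1 s1 tR uCR R0; rewrite last_rcons => ?; subst s1.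
case/lastP: R1 tR uCR R0 => [|R1 t] tR uCR R0 h1 h2.
  have us : adj u s by move: tR ur => /= /andP[/eqP-> _].
  have /and3P[uD _ _] := end3_mem e1.
  have := end_uniq e1; rewrite /= !inE negb_or => /and3P[/andP[ua ub] ab _].
  exists u; split; first by rewrite adj_sym.
    move=> x xD; have [->|xv] := eqVneq x v; first by rewrite adj_sym h2.
    apply: na; rewrite ore_sym; apply/negP=> /(tc _ _ uD xD).
    case=> -[e3 e4]; first by rewrite e4 eqxx in xv.
      by rewrite e3 eqxx in ub.
    by rewrite e3 eqxx in ua.
  rewrite adj_sym na //.
  by apply: (link_last_end lC uCR (o _ _ _ _ tR) (adj_ore ur) (adj_ore sv) (o _ _ _ _ tM)
    (adj_ore bp) (o _ _ _ _ tL) (adj_ore dq) (adj_ore qa) pC e1 e2).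
have st : adj s t.
  move: tR; rewrite -cats1 => tR.
  have [|//|a1 [b1 [g1 g2 g3]]] := trail_split _ _ tR; first by case: (R1).
  by rewrite (trail_last g1) adj_sym (trail_hd g3).
have uE : uniq (C ++ [:: s; t]).
  have sub : subseq (C ++ [:: t; s]) (C ++ rcons (rcons R1 t) s).
    by rewrite -!cats1 -catA cat_subseq ?suffix_subseq.
  have := subseq_uniq sub uCR; rewrite (perm_uniq (s2 := C ++ [:: s; t])) //.
  by rewrite perm_cat2l; permt.
have tE : trail ore [:: s; t] s t by rewrite /= !eqxx adj_ore.
exists t; split=> //.
  move=> x xD; have [->|xv] := eqVneq x v; first by rewrite adj_sym (h1 t s R1).
  by rewrite adj_sym na // (toe _ _ _ _ uE tE svo xD xv).
by rewrite na //; case/andP: (tol _ _ _ uE tE svo).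
Qed.

(* The second to last vertex of [u :: R] is not adjacent to [v]. *)
Definition far_apart := (forall (t s : G) R1, R = rcons (rcons R1 t) s -> ~~ adj t v) /\
  (forall s, R = [:: s] -> ~~ adj u v).

Lemma clean_two_heavy : clean D2 ->
  net_cover G \/ (wounded_cover G \/ Z2_cover G) /\ far_apart -> two_heavy D2.
Proof.
move=> /cleanP cD2 hS.
have [r [s [tR ur sv uCR rC]]] := outer_ends oR.
have na x y : ~~ ore x y -> ~~ adj x y by apply: contra; apply: adj_ore.
have e2 := fr_end2 (tf_frame F).
have /and3P[vD cD dD] := end3_mem e2.
have := end_uniq e2; rewrite /= !inE negb_or => /and3P[/andP[vc vd] cd _].
have [_ pc dq _] := tf_adj F.
have /and3P[_ _ /and3P[_ hML /and3P[uD2 hL _]]] : [&& true, true, uniq M,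
    ~~ has (mem M) (D2 ++ L), uniq D2, ~~ has (mem D2) L & uniq L].
  by have := frame_uniq lC (tf_frame F); rewrite !cat_uniq =>
    /and3P[_ _ /and3P[-> -> /and3P[-> -> ->]]].
have /andP[_ p'M] := trail_mem (tf_M F).
have /andP[qL _] := trail_mem (tf_L F).
have p'D : p' \notin D2.
  by apply/negP=> h; move/hasPn/(_ p'): hML; rewrite mem_cat h /= p'M => /(_ isT).
have qD : q \notin D2 by move/hasPn/(_ q qL): hL.
have pq : p' != q.
  by apply/eqP=> e; move/hasPn/(_ q): hML; rewrite mem_cat qL orbT -e /= p'M => /(_ isT).
have /andP[_ sR] := trail_mem tR.
have RC : forall x, x \in R -> x \notin C.
  by move: uCR; rewrite cat_uniq => /and3P[_ /hasPn h _] x /h.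
have sC := RC s sR.
have sD : s \notin D2.
  by apply: contra sC => h; rewrite (perm_mem (fr_perm (tf_frame F))) !mem_cat h !orbT.
have uE : uniq (C ++ [:: s]) by rewrite cats1 rcons_uniq sC (longest_uniq lC).
have tE : trail ore [:: s] s s by apply: trail1.
have svo := adj_ore sv.
have /andP[sp' sq] := tight_outer_link uE tE svo.
have ls : last u R = s by case: (R) tR => // z R' /and3P[_ _ /eqP].
have [x1 [x2 [x3 [y1 [y2 [y3 [[x1D x2D x3D] h1 h2 h3 [h4 h5]]]]]]]] :=
  net_exists hclaw cD2 (fr_con2 (tf_frame F)) vD cD dD vc vd cd sD p'D qD pq
    ltac:(by rewrite adj_sym) ltac:(by rewrite adj_sym) dq
    (fun x xD xv => tight_outer_end uE tE svo xD xv) (tf_p' F) (tf_q F) sp' sq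
    ltac:(by rewrite ore_sym; case/andP: (tf_pq F)).
have x12 : x1 != x2 by case/and5P: h1 => /adj_neq.
have x23 : x2 != x3 by case/and5P: h1 => _ /adj_neq.
have slight : ~~ heavy s := longest_light lC sC.
case: hS => [hN|[hS [far1 far2]]].
  by exists x1, x2; split=> //; apply: net_two_heavy hN h1 h2 h3.
have [t [st tD tp']] := tight_second_outer ls far1 (far2 s).
(* [z] prolongs the pendant vertex [y1]: it comes with the net, or is [t] when [y1] is [s]. *)
have [z [yz xz zy2 zs]] : exists z, [/\ adj y1 z,
    [&& ~~ adj x1 z, ~~ adj x2 z & ~~ adj x3 z], ~~ adj z y2 &
    (y1 \in D2 /\ (z \in D2 \/ z = s)) \/ y1 = s].
  case: h5 => [[z [g1 g2 /and5P[g3 g4 g5 g6 g7]]]|y1s].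
    by exists z; split=> //; [rewrite g4 g5 | left].
  exists t; split; [by rewrite y1s | by rewrite !tD | | by right].
  by case: h4 => [/tD|->//]; rewrite adj_sym.
case/and5P: h1 => a1 a2 a3 a4 /andP[a5 a6].
case/and3P: h2 => b1 b2 b3; case/and5P: h3 => c1 c2 c3 c4 /andP[c5 c6].
case/and3P: xz => d1 d2 d3.
case: hS => hS.
  have := hS x1 x2 x3 y1 z y2; rewrite a1 a2 a3 a4 yz a5 d1 d2 d3 zy2 !na //=.
  move=> /(_ isT isT isT) /and5P[_ g2 g3 g4 g5].
  (* If [y1] were heavy, [y2] would be light, so [x3] would be heavy and joined to [y1]. *)
  have y1l : ~~ heavy y1.
    apply/negP=> hy1.
    have y2l : ~~ heavy y2.
      apply: contra b1 => hy2; apply: heavy_ore hy1 hy2 _.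
      by apply: contraNneq c3 => ->; rewrite ore_sym adj_ore // adj_sym.
    rewrite (negPf y2l) orbF in g5.
    by move/negP: c5; apply; apply: heavy_ore => //; apply: contraNneq d3 => ->.
  rewrite (negPf y1l) !orbF in g2 g3.
  by exists x2, x3; rewrite g2 g3.
have := hS x1 x2 x3 y1 z; rewrite a1 a2 a3 a4 yz d1 d2 d3 !na // 1?ore_sym //=.
move=> /(_ isT isT) /and3P[g1 g2 g3].
(* A heavy [y1] is not [s], so it lies in [D2]; its partner is [x1] or [z], whichever is heavy. *)
have [hy|hy] := boolP (heavy y1); last first.
  by rewrite (negPf hy) !orbF in g1 g2; exists x2, x3; rewrite g1 g2.
case: zs => [[y1D zD]|e]; last by rewrite e (negPf slight) in hy.
case/orP: g3 => hx; first by exists x1, y1; rewrite hx hy; split=> //; apply: adj_neq.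
case: zD => [zD|e]; last by rewrite e (negPf slight) in hx.
by exists y1, z; rewrite hx hy; split=> //; apply: adj_neq.
Qed.
End Ends.

(** Two heavy vertices in one end exclude any in the other, as such a vertex would lie in two cross
    pairs. Then all pairs of [ore] in the other end are edges, and [clean_two_heavy] produces heavy
    vertices there. *)
Lemma tight_contra C R u v D1 a b M p p' D2 c d L q q' : longest C -> outer C R u v ->
  tight_frame C u D1 a b M p p' v D2 c d L q q' ->
  net_cover G \/ (wounded_cover G \/ Z2_cover G) /\ (far_apart R u v /\ far_apart (rev R) v u) ->
  False.
Proof.
move=> lC oR F hS.
have oR' := outer_sym oR; have F' := tight_frame_swap F.
have hS1 : net_cover G \/ (wounded_cover G \/ Z2_cover G) /\ far_apart R u v.
  by case: hS => [?|[? []]]; [left|right].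
have hS2 : net_cover G \/ (wounded_cover G \/ Z2_cover G) /\ far_apart (rev R) v u.
  by case: hS => [?|[? []]]; [left|right].
have key R0 u0 v0 D0 a0 b0 M0 p0 p0' D0' c0 d0 L0 q0 q0' : outer C R0 u0 v0 ->
    tight_frame C u0 D0 a0 b0 M0 p0 p0' v0 D0' c0 d0 L0 q0 q0' ->
    two_heavy D0' -> clean D0 /\ ~ two_heavy D0.
  move=> o f [x [y [xD yD xy /andP[hx hy]]]].
  have light z : z \in D0 -> ~~ heavy z.
    move=> zD; apply/negP=> hz; case/eqP: xy.
    have zx := tight_disjoint lC f zD xD; have zy := tight_disjoint lC f zD yD.
    by apply: (tight_cross_uniq lC o f zD xD yD); apply: heavy_ore.
  split; last by case=> z [_ [zD _ _ /andP[hz _]]]; have := light z zD; rewrite hz.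
  apply/allP=> z zD; apply/allP=> w wD; apply/implyP=> zw.
  exact: ore_light zw (light z zD) (light w wD).
(* For bad pairs [x], [x'] and [y], [y'] the four degrees sum to at least 2n. So each of the two
   ways of pairing [D1] with [D2] contains a cross pair, and these two cross pairs share a
   vertex. *)
have cl : clean D1 || clean D2.
  have [//|/not_clean[x [x' [xD x'D xx hx]]]] := boolP (clean D1).
  have [//|/not_clean[y [y' [yD y'D yy hy]]]] := boolP (clean D2).
  have k z z' w w' : z \in D1 -> z' \in D1 -> w \in D2 -> w' \in D2 ->
     #|G| <= deg z + deg z' -> #|G| <= deg w + deg w' -> ore z w || ore z' w'.
    move=> h1 h2 h3 h4 h5 h6; apply/negPn; rewrite negb_or; apply/negP => /andP[h7 h8].
    have := not_ore_deg (tight_disjoint lC F h1 h3) h7.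
    have := not_ore_deg (tight_disjoint lC F h2 h4) h8.
    lia.
  have hy' : #|G| <= deg y' + deg y by rewrite addnC.
  have un := tight_cross_uniq lC oR F; have un' := tight_cross_uniq lC oR' F'.
  exfalso.
  case/orP: (k _ _ _ _ xD x'D yD y'D hx hy) => h1; case/orP: (k _ _ _ _ xD x'D y'D yD hx hy') => h2.
  - by move: yy; rewrite (un _ _ _ xD yD y'D h1 h2) eqxx.
  - by move: xx; rewrite (un' y x x') ?eqxx // ore_sym.
  - by move: xx; rewrite (un' y' x x') ?eqxx // ore_sym.
  - by move: yy; rewrite (un _ _ _ x'D yD y'D h2 h1) eqxx.
case/orP: cl => cl.
  have h1 := clean_two_heavy lC oR' F' cl hS2.
  have [c2 n2] := key _ _ _ _ _ _ _ _ _ _ _ _ _ _ _ oR' F' h1.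
  exact/n2/(clean_two_heavy lC oR F c2 hS1).
have h1 := clean_two_heavy lC oR F cl hS1.
have [c2 n2] := key _ _ _ _ _ _ _ _ _ _ _ _ _ _ _ oR F h1.
exact/n2/(clean_two_heavy lC oR' F' c2 hS2).
Qed.
End Final.

(** * Patterns using the ends of the runs at [u] and [v] *)

Section Close.
Variable G : sgraph.
Implicit Types (x y z u v w : G) (C E R M L A B : seq G).
Notation adj := (@adj G).
Notation ore := (@ore G).
Hypothesis hclaw : claw_cover G.

Let na x y : ~~ ore x y -> ~~ adj x y. Proof. by apply: contra; apply: adj_ore. Qed.

Lemma outer_light C R u v z : longest C -> outer C R u v -> z \in R -> ~~ heavy z.
Proof.
move=> lC [_ _ _ _ [_ uCR]] zR; apply: (longest_light lC).
by move: uCR; rewrite cat_uniq => /and3P[_ /hasPn h _]; apply: h.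
Qed.

(** As [r] is light, its pairs with [x] and with [y] in patterns on the triangle [u], [v], [r] make
    [x] and [y] heavy, but these are not joined. W has both pairs at once; Z2 is applied from [u]
    and from [v]. *)
Lemma triangle_contra C r u v : longest C -> outer C [:: r] u v -> adj u v ->
  wounded_cover G \/ Z2_cover G -> False.
Proof.
move=> lC oR uv; have [r1 [s1 [tR ur sv _ _]]] := outer_ends oR.
move: tR; rewrite /= => /andP[/eqP ? /eqP ?]; subst r1 s1.
have rl := outer_light lC oR (mem_head r [::]).
have [x [x' [y [y' [[ux xx' vy yy'] /andP[nux' nvy'] /and4P[xy x'y xy' x'y']
   /and4P[uy uy' vx vx'] /(_ r (mem_head _ _)) /and4P[rx rx' ry ry']]]]]] :=
   runs_exist hclaw lC oR.
have vr : adj v r by rewrite adj_sym.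
have nxy : x != y by apply: contraNneq uy => <-; apply: adj_ore.
case=> hS.
  have := hS u v r x x' y; rewrite uv vr ur ux xx' vy nux' !na //= => /(_ isT isT isT).
  rewrite (negPf rl) /= => /and5P[_ _ hx _ hy].
  by case/negP: xy; apply: heavy_ore.
have := hS u v r x x'; rewrite uv vr ur ux xx' nux' !na //= => /(_ isT isT).
rewrite (negPf rl) /= => /and3P[_ hx _].
have vu : adj v u by rewrite adj_sym.
have := hS v u r y y'; rewrite vu vr vy yy' nvy' ur !na //= => /(_ isT isT).
rewrite (negPf rl) /= => /and3P[_ hy _].
by case/negP: xy; apply: heavy_ore.
Qed.

(** If [u] and [v] are not adjacent, six consecutive vertices starting with [x'], [x], [u] and
    continuing along [R], [v], [y] induce a P6; the light vertices of [R] then force two unjoined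
    heavy vertices, or are themselves at distance 2. *)
Lemma P6_edge C R u v : P6_cover G -> longest C -> outer C R u v ->
  [/\ adj u v, heavy u & heavy v].
Proof.
move=> hP lC oR0; have [R' oR [c1 c2 c3]] := chordless_exists oR0.
move: R' oR c1 c2 c3 {oR0} => {}R oR c1 c2 c3.
have [r1 [s1 [tR ur sv _ _]]] := outer_ends oR.
have light z : z \in R -> ~~ heavy z := outer_light lC oR.
have [x [x' [y [y' [[ux xx' vy yy'] /andP[nux' nvy'] /and4P[xy x'y xy' x'y']
   /and4P[uy uy' vx vx'] oR']]]]] := runs_exist hclaw lC oR.
have x'x : adj x' x by rewrite adj_sym.
have xu : adj x u by rewrite adj_sym.
have nx'u : ~~ adj x' u by rewrite adj_sym.
have nxv : ~~ adj x v by rewrite adj_sym na.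
have nx'v : ~~ adj x' v by rewrite adj_sym na.
have rA z : z \in R -> [&& ~~ adj x z, ~~ adj x' z & ~~ adj z y].
  by move=> /oR' /and4P[h1 h2 h3 _]; rewrite ![adj _ z]adj_sym !na.
have nxy : x != y by apply: contraNneq uy => <-; apply: adj_ore.
have nxv' : v != x by apply: contraNneq xy => <-; apply: adj_ore.
have uv : adj u v.
  apply/negPn/negP=> nuv.
  case: R tR light rA c1 c2 c3 {oR oR'} => [|r [|r2 [|r3 R]]] // tR light rA c1 c2 c3.
  - move: tR => /= /andP[/eqP ? /eqP ?]; subst r1 s1.
    have /and3P[a1 a2 a3] := rA r (mem_head _ _).
    have := hP x' x u r v y; rewrite x'x xu ur sv vy nx'u a2 nx'v a1 nxv nuv a3 !na //=.
    move=> /(_ isT isT isT isT); rewrite (negPf (light r (mem_head _ _))) !orbF.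
    by case/and4P=> _ hx _ hy; case/negP: xy; apply: heavy_ore.
  - move: tR => /= /and3P[/eqP ? /andP[r12 _] /eqP ?]; subst r1 s1.
    have r2R : r2 \in [:: r; r2] by rewrite !inE eqxx orbT.
    have /and3P[a1 a2 a3] := rA r (mem_head _ _).
    have /and3P[b1 b2 b3] := rA r2 r2R.
    have n1 := c1 r r2 [::] (erefl _); have n2 := c2 _ _ _ (erefl _).
    have := hP x' x u r r2 v; rewrite x'x xu ur sv r12 nx'u a2 nx'v a1 nxv nuv b1 b2 n1 n2 /=.
    move=> /(_ isT isT isT isT); rewrite (negPf (light r (mem_head _ _))) !orbF.
    by case/and4P=> _ hx _ hv; case/negP: vx; apply: heavy_ore.
  - move: tR => /= /and3P[/eqP ? /and3P[r12 r23 _] _]; subst r1.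
    have r2R : r2 \in [:: r, r2, r3 & R] by rewrite !inE eqxx orbT.
    have r3R : r3 \in [:: r, r2, r3 & R] by rewrite !inE eqxx !orbT.
    have /and3P[a1 a2 a3] := rA r (mem_head _ _).
    have /and3P[b1 b2 b3] := rA r2 r2R.
    have /and3P[d1 d2 d3] := rA r3 r3R.
    have n2 := c2 _ _ _ (erefl _); have /andP[n3 n4] := c3 _ _ _ _ (erefl _).
    have := hP x' x u r r2 r3; rewrite x'x xu ur r12 r23 nx'u a2 b2 d2 a1 b1 d1 n2 n3 n4 /=.
    move=> /(_ isT isT isT isT); rewrite (negPf (light r (mem_head _ _))).
    by rewrite (negPf (light r3 r3R)) !andbF.
(* On the path through the edge [uv], a light [u] would make [x'] and [y] heavy, and a light [v]
   would make [x] and [y'] heavy; neither pair is joined. *)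
have := hP x' x u v y y'; rewrite x'x xu uv vy yy' nx'u nx'v nxv nvy' !na //=.
move=> /(_ isT isT isT isT) /and4P[h1 h2 h3 h4]; split=> //.
  apply/negPn/negP=> hu; rewrite (negPf hu) orbF in h1; rewrite (negPf hu) /= in h3.
  case/negP: x'y; apply: heavy_ore => //.
  by apply: contraNneq vx' => ->; apply: adj_ore.
apply/negPn/negP=> hv; rewrite (negPf hv) orbF in h2; rewrite (negPf hv) /= in h4.
case/negP: xy'; apply: heavy_ore => //.
by apply: contraNneq xy => ->; rewrite ore_sym; apply: adj_ore.
Qed.
End Close.

Lemma cat_split2 (T : Type) (X Y s t : seq T) (x y : T) : X ++ Y = s ++ [:: x, y & t] ->
  [\/ exists2 t2, X = s ++ [:: x, y & t2] & t = t2 ++ Y,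
      X = rcons s x /\ Y = y :: t |
      exists2 s2, s = X ++ s2 & Y = s2 ++ [:: x, y & t]].
Proof.
elim: X s => [|a X IH] s /=; first by move=> ->; constructor 3; exists s.
case: s => [|b s] /= [-> {a}].
  case: X {IH} => [|c X] /=; first by move=> ->; constructor 2.
  by move=> [-> <-]; constructor 1; exists X.
case/IH=> [[t2 -> ->]|[-> ->]|[s2 -> ->]].
- by constructor 1; exists t2.
- by constructor 2.
- by constructor 3; exists s2.
Qed.

Lemma perm_neq (T : eqType) (C s t : seq T) x y : uniq C -> perm_eq C (s ++ t) ->
  x \in s -> y \in t -> x != y.
Proof.
move=> uC pC xs yt; move: uC; rewrite (perm_uniq pC) cat_uniq => /and3P[_ /hasPn h _].
by apply: contraTneq yt => <-; apply/negP=> /h; rewrite /= xs.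
Qed.

(** * The case of P6 *)

Section P6.
Variable G : sgraph.
Implicit Types (x y z u v w : G) (E R A B : seq G).
Notation adj := (@adj G).
Notation ore := (@ore G).
Hypotheses (hclaw : claw_cover G) (hP6 : P6_cover G).

Let na x y : ~~ ore x y -> ~~ adj x y. Proof. by apply: contra; apply: adj_ore. Qed.

Lemma trail_cut (e : rel G) A x B y z : trail e (A ++ x :: B) y z ->
  A != [::] -> B != [::] ->
  exists a b, [/\ trail e A y a, e a x, e x b & trail e B b z].
Proof.
move=> tr A0 B0; have [a [x' [tA ax tB]]] := trail_split A0 (isT : x :: B != [::]) tr.
rewrite -cat1s in tB.
have [x'' [b [t1 xb tB']]] := trail_split (isT : [:: x] != [::]) B0 tB.
have e1 := trail_hd t1; have e2 := trail_last (s := [::]) t1; subst x' x''.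
by exists a, b.
Qed.

Section Config.
Variables (C M L R : seq G) (u v m0 m1 l0 l1 r s : G).
Hypotheses (lC : longest C) (oR : outer C R u v).
Hypothesis cC : gcfg C u M m0 m1 v L l0 l1.
Hypotheses (tR : trail adj R r s) (ur : adj u r) (sv : adj s v).
Hypothesis uCR : uniq (C ++ R).
Hypothesis min : forall C' R' u' v' M' m0' m1' L' l0' l1', longest C' -> outer C' R' u' v' ->
  gcfg C' u' M' m0' m1' v' L' l0' l1' -> size M <= size M'.

Let K : cfg C u M m0 m1 v L l0 l1. Proof. exact: gcfg_cfg oR cC. Qed.
Let tM : trail adj M m0 m1. Proof. by case: cC. Qed.
Let tL : trail adj L l0 l1. Proof. by case: cC. Qed.
Let um : adj u m0. Proof. by case: cC. Qed.
Let mv : adj m1 v. Proof. by case: cC. Qed.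
Let vl : adj v l0. Proof. by case: cC. Qed.
Let lu : adj l1 u. Proof. by case: cC. Qed.
Let pC : perm_eq C ([:: u] ++ M ++ [:: v] ++ L). Proof. by case: cC. Qed.
Let uv : adj u v. Proof. by case: (P6_edge hclaw hP6 lC oR). Qed.
Let hu : heavy u. Proof. by case: (P6_edge hclaw hP6 lC oR). Qed.
Let hv : heavy v. Proof. by case: (P6_edge hclaw hP6 lC oR). Qed.
Let R0 : R != [::]. Proof. exact: trail_neq0 tR. Qed.
Let uC : uniq C. Proof. exact: longest_uniq lC. Qed.

Let um1 : ~~ ore u m1. Proof. exact: cfg_u_tail lC oR K. Qed.
Let vl1 : ~~ ore v l1. Proof. exact: cfg_u_tail lC (outer_sym oR) (cfg_swap K). Qed.
Let ul0 : ~~ ore u l0. Proof. exact: cfg_u_tail lC oR (cfg_rev K). Qed.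
Let vm0 : ~~ ore v m0.
Proof. exact: cfg_u_tail lC (outer_sym oR) (cfg_swap (cfg_rev K)). Qed.

Let neq (s1 t1 : seq G) x y : perm_eq C (s1 ++ t1) -> x \in s1 -> y \in t1 -> x != y.
Proof. exact: perm_neq. Qed.

Let m0M : m0 \in M. Proof. by case/andP: (trail_mem tM). Qed.
Let m1M : m1 \in M. Proof. by case/andP: (trail_mem tM). Qed.
Let l0L : l0 \in L. Proof. by case/andP: (trail_mem tL). Qed.
Let l1L : l1 \in L. Proof. by case/andP: (trail_mem tL). Qed.

Let Mu z : z \in M -> z != u.
Proof. by move=> zM; rewrite eq_sym; apply: (neq pC); rewrite ?mem_head // mem_cat zM. Qed.
Let Mv z : z \in M -> z != v.
Proof.
move=> zM; apply: (neq (s1 := [:: u] ++ M) (t1 := [:: v] ++ L)); first by permt.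
  by rewrite mem_cat zM orbT.
exact: mem_head.
Qed.
Let ML z w : z \in M -> w \in L -> z != w.
Proof.
move=> zM wL; apply: (neq (s1 := [:: u] ++ M) (t1 := [:: v] ++ L)); first by permt.
  by rewrite mem_cat zM orbT.
by rewrite inE wL orbT.
Qed.
Let Lv z : z \in L -> z != v.
Proof.
move=> zL; rewrite eq_sym; apply: (neq (s1 := [:: u] ++ M ++ [:: v]) (t1 := L)) => //.
  by permt.
by rewrite !mem_cat mem_head !orbT.
Qed.
Let Lu z : z \in L -> z != u.
Proof. by move=> zL; rewrite eq_sym; apply: (neq pC); rewrite ?mem_head // !mem_cat zL !orbT. Qed.
Let MM A B x y : M = A ++ B -> x \in A -> y \in B -> x != y.
Proof.
move=> eM xA yB; apply: (neq (s1 := [:: u] ++ A) (t1 := B ++ [:: v] ++ L)).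
- by have pC' := pC; rewrite eM in pC'; permt.
- by rewrite mem_cat xA orbT.
- by rewrite mem_cat yB.
Qed.

Let light_u x : x != u -> ~~ ore u x -> ~~ heavy x.
Proof. by move=> xu; apply: contra => hx; apply: heavy_ore => //; rewrite eq_sym. Qed.
Let light_v x : x != v -> ~~ ore v x -> ~~ heavy x.
Proof. by move=> xu; apply: contra => hx; apply: heavy_ore => //; rewrite eq_sym. Qed.

Let m0l : ~~ heavy m0. Proof. exact: light_v (Mv m0M) vm0. Qed.
Let m1l : ~~ heavy m1. Proof. exact: light_u (Mu m1M) um1. Qed.
Let l0l : ~~ heavy l0. Proof. exact: light_u (Lu l0L) ul0. Qed.
Let l1l : ~~ heavy l1. Proof. exact: light_v (Lv l1L) vl1. Qed.
Let lm : adj l1 m0. Proof. exact: ore_light (cfg_lm K) l1l m0l. Qed.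
Let ml : adj m1 l0. Proof. exact: ore_light (cfg_ml K) m1l l0l. Qed.

Let RC z : z \in R -> z \notin C.
Proof. by move: uCR; rewrite cat_uniq => /and3P[_ /hasPn h _] /h. Qed.
Let rR : r \in R. Proof. by case/andP: (trail_mem tR). Qed.
Let sR : s \in R. Proof. by case/andP: (trail_mem tR). Qed.
Let rl : ~~ heavy r. Proof. exact: longest_light lC (RC rR). Qed.
Let sl : ~~ heavy s. Proof. exact: longest_light lC (RC sR). Qed.
Let uniq1 z : z \in R -> uniq (C ++ [:: z]).
Proof. by move=> zR; rewrite cats1 rcons_uniq RC. Qed.

Let MC z : z \in M -> z \in C.
Proof. by move=> zM; rewrite (perm_mem pC) !mem_cat zM orbT. Qed.

(** An edge from [r] to [z] makes [r] alone an outer path from [u] to [z], with the shorter arc [A];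
    an edge from [s] does the same with [B]. *)
Lemma min_chord z A B a b : M = A ++ z :: B -> trail adj A m0 a -> adj a z -> adj z b ->
  trail adj B b m1 -> ~~ adj r z && ~~ adj s z.
Proof.
move=> eM tA az zb tB; have pC' := pC; rewrite eM -(cat1s z) in pC'.
have zC : z \in C by apply: MC; rewrite eM mem_cat mem_head orbT.
have zM : z \in M by rewrite eM mem_cat mem_head orbT.
have uinC : u \in C by case: oR.
have vinC : v \in C by case: oR.
apply/andP; split; apply/negP=> h.
  have oR' : outer C [:: r] u z.
    split=> //; first by rewrite eq_sym Mu.
    by split; [rewrite /link /= ur h | apply: uniq1].
  have := min (C' := C) (R' := [:: r]) (u' := u) (M' := A) (m0' := m0) (m1' := a) (v' := z)
    (L' := B ++ [:: v] ++ L) (l0' := b) (l1' := l1) lC oR'.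
  have H : gcfg C u A m0 a z (B ++ [:: v] ++ L) b l1.
    split=> //; first by trs.
    by permt.
  by move/(_ H); rewrite eM size_cat /=; clear; lia.
have oR' : outer C [:: s] z v.
  split=> //; first by rewrite Mv.
  by split; [rewrite link_cons link0 sv andbT adj_sym | apply: uniq1].
have := min (C' := C) (R' := [:: s]) (u' := z) (M' := B) (m0' := b) (m1' := m1) (v' := v)
    (L' := L ++ [:: u] ++ A) (l0' := l0) (l1' := a) lC oR'.
have H : gcfg C z B b m1 v (L ++ [:: u] ++ A) l0 a.
  split=> //; first by trs.
  by permt.
by move/(_ H); rewrite eM size_cat /=; clear; lia.
Qed.

Lemma outer_M z : z \in M -> ~~ adj r z && ~~ adj s z.
Proof.
have rm0 : ~~ ore r m0.
  apply/negP=> h; have U := uniq1 rR.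
  by nocyc lC [:: r] ([:: r] ++ M ++ [:: v] ++ L ++ [:: u]).
have sm1 : ~~ ore s m1.
  apply/negP=> h; have U := uniq1 sR.
  by nocyc lC [:: s] ([:: s] ++ rev M ++ [:: u] ++ rev L ++ [:: v]).
have rm1 : ~~ ore r m1.
  apply/negP=> h; have U := uniq1 rR.
  by nocyc lC [:: r] ([:: r] ++ rev M ++ rev L ++ [:: v] ++ [:: u]).
have sm0 : ~~ ore s m0.
  apply/negP=> h; have U := uniq1 sR.
  by nocyc lC [:: s] ([:: s] ++ M ++ L ++ [:: u] ++ [:: v]).
move=> zM; case/splitPr eM : {1}M / zM => [A B].
have [A0|A0] := eqVneq A [::].
  have -> : z = m0 by move: tM; rewrite eM A0 => /trail_hd.
  by rewrite !na.
have [B0|B0] := eqVneq B [::].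
  have -> : z = m1 by move: tM; rewrite eM B0 cats1 => /trail_last.
  by rewrite !na.
have tM' := tM; rewrite eM in tM'.
have [a [b [t1 az zb t2]]] := trail_cut tM' A0 B0.
exact: min_chord eM t1 az zb t2.
Qed.

(** A heavy [h] is joined to both heavy vertices [u] and [v], so it can be moved next to either one.
    A pair between [u] or [v] and a cycle neighbour of [h] then closes a cycle containing [R]. *)
Lemma heavy_nbr h A B : M = A ++ h :: B -> heavy h -> exists a b,
  [/\ trail adj A m0 a, adj a h, adj h b, trail adj B b m1 &
     [/\ ~~ ore u a, ~~ ore u b, ~~ ore v a & ~~ ore v b]].
Proof.
move=> eM hh; have tM' := tM; rewrite eM in tM'.
have hM : h \in M by rewrite eM mem_cat mem_head orbT.
have A0 : A != [::].
  apply: contraTneq hh => A0; suff -> : h = m0 by [].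
  by move: tM'; rewrite A0 => /trail_hd.
have B0 : B != [::].
  apply: contraTneq hh => B0; suff -> : h = m1 by [].
  by move: tM'; rewrite B0 cats1 => /trail_last.
have [a [b [t1 ah hb t2]]] := trail_cut tM' A0 B0.
have ohu : ore h u by apply: heavy_ore => //; apply: Mu.
have ohv : ore h v by apply: heavy_ore => //; apply: Mv.
have pC' := pC; rewrite eM -(cat1s h) in pC'.
exists a, b; split=> //; split; apply/negP=> x.
- by nocyc lC R (rev A ++ rev L ++ rev B ++ [:: h] ++ [:: v] ++ rev R ++ [:: u]).
- by nocyc lC R (B ++ L ++ A ++ [:: h] ++ [:: v] ++ rev R ++ [:: u]).
- by nocyc lC R (rev A ++ rev L ++ rev B ++ [:: h] ++ [:: u] ++ R ++ [:: v]).
- by nocyc lC R (B ++ L ++ A ++ [:: h] ++ [:: u] ++ R ++ [:: v]).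
Qed.

(** The claw at [h] with leaves [a], [b] and the adjacent one of [u], [v] leaves only the pair [a],
    [b], an edge since both are light. *)
Lemma heavy_bypass h A B a b : M = A ++ h :: B -> heavy h -> adj h u || adj h v ->
  trail adj A m0 a -> trail adj B b m1 -> adj a h -> adj h b ->
  [/\ adj a b, ~~ heavy a & ~~ heavy b].
Proof.
move=> eM hh huv tA tB ah hb; have [a' [b' [t1 _ _ t2 [ua ub va vb]]]] := heavy_nbr eM hh.
have ea : a' = a.
  by move: t1 tA; case: (A) => // z A' /and3P[_ _ /eqP<-] /and3P[_ _ /eqP].
have eb : b' = b.
  by move: t2 tB; case: (B) => // z A' /and3P[/eqP-> _ _] /and3P[/eqP].
subst a' b'; have aA : a \in A by case/andP: (trail_mem tA).
have bB : b \in B by case/andP: (trail_mem tB).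
have aM : a \in M by rewrite eM mem_cat aA.
have bM : b \in M by rewrite eM mem_cat inE bB !orbT.
have al := light_u (Mu aM) ua; have bl := light_u (Mu bM) ub.
have ab : a != b by apply: (MM eM) => //; rewrite inE bB orbT.
have ha : adj h a by rewrite adj_sym.
split=> //; apply: ore_light (al) (bl).
have ua' : u != a by rewrite eq_sym Mu. have ub' : u != b by rewrite eq_sym Mu.
have va' : v != a by rewrite eq_sym Mv. have vb' : v != b by rewrite eq_sym Mv.
case/orP: huv => x.
  by have := hclaw x ha hb ua' ub' ab; rewrite (negPf ua) (negPf ub).
by have := hclaw x ha hb va' vb' ab; rewrite (negPf va) (negPf vb).
Qed.

Section SecondNbr.
Variables (q : G) (A B : seq G).
Hypotheses (eM : M = A ++ q :: B) (uq : adj u q) (ql : ~~ heavy q) (A0 : A != [::]).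

Let qM : q \in M. Proof. by rewrite eM mem_cat mem_head orbT. Qed.
Let B0 : B != [::].
Proof.
apply/eqP=> B0; move: tM; rewrite eM B0 cats1 => /trail_last e.
by case/negP: um1; rewrite -e adj_ore.
Qed.
Let pC' : perm_eq C ([:: u] ++ A ++ [:: q] ++ B ++ [:: v] ++ L).
Proof. by have pC' := pC; rewrite eM in pC'; permt. Qed.

(** If [u] were adjacent to [a], moving [A] behind [L] would leave the shorter arc [q B]. A mere
    degree sum is reduced to such reroutings by [crossing]. *)
Lemma second_pred a b : trail adj A m0 a -> adj a q -> adj q b -> trail adj B b m1 ->
  ~~ ore u a.
Proof.
move=> tA aq qb tB; apply/negP=> ua.
have tqB : trail adj ([:: q] ++ B) q m1 by trs.
have tLA : trail adj (L ++ A) l0 a by trs.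
have [ua'|nua] := boolP (adj u a).
  have H : gcfg C u ([:: q] ++ B) q m1 v (L ++ A) l0 a.
    by split=> //; [rewrite adj_sym | permt].
  have := min lC oR H; rewrite eM size_cat /=.
  by case: (A) A0 => //= a0 A1 _; clear; lia.
have hd : #|G| <= deg u + deg a by move: ua; rewrite /ore /= (negPf nua) => /andP[].
pose P := ([:: q] ++ B) ++ [:: v] ++ (L ++ A).
have pP : perm_eq C (u :: P) by rewrite -[u :: P]/([:: u] ++ P) /P; permt.
have uP : uniq (u :: P) by rewrite -(perm_uniq pP).
have tvP : trail adj ([:: v] ++ (L ++ A)) v a by trs.
have tP : trail adj P q a by apply: trail_cat tqB tvP mv.
have lP : last u P = a by move: tP => /and3P[_ _ /eqP].
case: (crossing uP); rewrite ?lP //.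
  case=> w [wP uw aw]; have U : uniq (C ++ [:: w]).
    by rewrite cats1 rcons_uniq uC (perm_mem pP) wP.
  by nocyc lC [:: w] ([:: w] ++ [:: u] ++ P).
case=> -[|u0 s0] [x [y [t [eP uy ax]]]].
  by case: eP => ex _; case/negP: nua; rewrite ex adj_sym.
case: eP => _; rewrite /P => eP.
(* The crossing pair lies inside [q B], at the step from [m1] to [v], or inside [v L A]. The middle
   case gives a longer cycle, the others a shorter arc, except at [v l0], which [ul0] excludes. *)
case: (cat_split2 eP) => [[t2 e1 e2]|[e1 e2]|[s2 e1 e2]].
- rewrite e1 in tqB.
  have eS : s0 ++ [:: x, y & t2] = rcons s0 x ++ y :: t2 by rewrite -cats1 -catA.
  rewrite eS in tqB.
  have [|//|x' [y' [h1 h2 h3]]] := trail_split _ _ tqB; first by case: (s0).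
  have ex := trail_last h1; have ey := trail_hd h3; subst x' y'.
  have xa : adj a x by [].
  have H : gcfg C u (y :: t2) y m1 v ((L ++ A) ++ rev (rcons s0 x)) l0 q.
    split=> //; first by trs.
      by rewrite adj_sym.
    have := pP; rewrite /P e1 eS -(cat1s y) -[u :: _]/([:: u] ++ _) => pP'.
    by rewrite -(cat1s y); permt.
  have := min lC oR H; rewrite eM size_cat -(cat1s q) e1 !size_cat /=.
  by case: (A) A0 => //= a0 A1 _; clear; lia.
- case: e2 => ey _; rewrite e1 in tqB.
  have ex := trail_last tqB; subst x y; rewrite -e1 in tqB.
  have pP' := pP; rewrite -[u :: _]/([:: u] ++ _) /P in pP'.
  by nocyc lC R (R ++ [:: v] ++ (L ++ A) ++ rev ([:: q] ++ B) ++ [:: u]).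
- case: s2 e1 e2 => [|z s2] e1 /= [e2].
    move=> e3; case/negP: ul0; suff -> : l0 = y by rewrite adj_ore.
    by move: tLA; rewrite e3 => /trail_hd.
  move=> e3; have eS : s2 ++ [:: x, y & t] = rcons s2 x ++ y :: t by rewrite -cats1 -catA.
  have tLA' := tLA; rewrite e3 eS in tLA'.
  have [|//|x' [y' [h1 h2 h3]]] := trail_split _ _ tLA'; first by case: (s2).
  have ex := trail_last h1; have ey := trail_hd h3; subst x' y'.
  have xa : adj x a by rewrite adj_sym.
  have H : gcfg C u ([:: q] ++ B) q m1 v (rcons s2 x ++ rev (y :: t)) l0 y.
    split=> //; [by trs | by rewrite adj_sym |].
    have pP' := pP; rewrite -[u :: _]/([:: u] ++ _) /P e3 eS in pP'.
    by permt.
  have := min lC oR H; rewrite eM size_cat /=.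
  by case: (A) A0 => //= a0 A1 _; clear; lia.
Qed.
End SecondNbr.

(** The cycle neighbours of a heavy vertex of [M] are not joined to [u], but [q] is. *)
Lemma light_nbr q A B a b : M = A ++ q :: B -> adj u q ->
  trail adj A m0 a -> adj a q -> adj q b -> trail adj B b m1 -> ~~ heavy a && ~~ heavy b.
Proof.
move=> eM uq tA aq qb tB; have ouq := adj_ore uq; apply/andP; split; apply/negP=> h.
  case/lastP: A eM tA => // A a' eM tA; have ea := trail_last tA; subst a'.
  rewrite -cats1 -catA in eM.
  have [a1 [b1 [_ _ _ t2 [_ ub _ _]]]] := heavy_nbr eM h.
  by move: ub; rewrite -(trail_hd t2) ouq.
case: B eM tB => // b' B eM tB; have eb := trail_hd tB; subst b'.
rewrite -cat_rcons in eM.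
have [a1 [b1 [t1 _ _ _ [ua _ _ _]]]] := heavy_nbr eM h.
by move: ua; rewrite -(trail_last t1) ouq.
Qed.

(** Claws at [u] containing [r] join [q] to [m0] and to [l1]. A claw at [q] with leaves [u], [a],
    [b] joins [u] and [b], only by degree sum because [second_pred] applied to [b] forbids the edge;
    the one with [l1], [a], [b] gives [l1 b]. *)
Lemma second_nbr q A B : M = A ++ q :: B -> adj u q -> ~~ heavy q -> A != [::] ->
  exists a b, [/\ trail adj A m0 a, adj a q, adj q b, trail adj B b m1 &
    [/\ ~~ ore u a, ore u b && ~~ adj u b, adj l1 b, adj q l1 & adj q m0]].
Proof.
move=> eM uq ql A0; have tM' := tM; rewrite eM in tM'.
have qM : q \in M by rewrite eM mem_cat mem_head orbT.
have B0 : B != [::].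
  apply/eqP=> B0; move: tM'; rewrite B0 cats1 => /trail_last e.
  by case/negP: um1; rewrite -e adj_ore.
have [a [b [tA aq qb tB]]] := trail_cut tM' A0 B0.
have /andP[al bl] := light_nbr eM uq tA aq qb tB.
have pC' := pC; rewrite eM -(cat1s q) in pC'.
have aA : a \in A by case/andP: (trail_mem tA).
have m0A : m0 \in A by case/andP: (trail_mem tA).
have bB : b \in B by case/andP: (trail_mem tB).
have aM : a \in M by rewrite eM mem_cat aA.
have bM : b \in M by rewrite eM mem_cat inE bB !orbT.
have /andP[nrq _] := outer_M qM.
have ru : adj r u by rewrite adj_sym.
have rq : r != q by apply: contraTneq (MC qM) => <-; apply: RC.
have qadj w : adj u w -> w \in C -> ~~ heavy w -> q != w -> ~~ ore r w -> adj q w.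
  move=> uw wC wl qw rw.
  have rw' : r != w by apply: contraTneq wC => <-; apply: RC.
  have := hclaw ur uq uw rq rw' qw; rewrite (negPf rw) /= => /orP[h|h].
    by case/negP: nrq; apply: ore_light h rl ql.
  exact: ore_light h ql wl.
have U := uniq1 rR.
have rm0 : ~~ ore r m0.
  by apply/negP=> h; nocyc lC [:: r] ([:: r] ++ M ++ [:: v] ++ L ++ [:: u]).
have rl1 : ~~ ore r l1.
  by apply/negP=> h; nocyc lC [:: r] ([:: r] ++ rev L ++ [:: v] ++ rev M ++ [:: u]).
have qm0 : adj q m0.
  apply: qadj => //; [exact: MC| rewrite eq_sym; apply: (MM eM) => //; exact: mem_head].
have ul1 : adj u l1 by rewrite adj_sym.
have l1C : l1 \in C by rewrite (perm_mem pC) !mem_cat l1L !orbT.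
have ql1 : adj q l1 by apply: qadj => //; apply: ML.
have ua := second_pred eM uq A0 tA aq qb tB.
have nab : ~~ adj a b.
  apply/negP=> ab; have tAB : trail adj (A ++ B) m0 m1 by trs.
  have H : gcfg C u (A ++ B) m0 m1 v (L ++ [:: q]) l0 q.
    by split=> //; [trs | rewrite adj_sym | permt].
  by have := min lC oR H; rewrite eM !size_cat /=; clear; lia.
have nub : ~~ adj u b.
  apply/negP=> ub; case: (B) eM tB pC' bB => // b' B' eM' tB' pC' bB'.
  have eb := trail_hd tB'; subst b'.
  rewrite -cat_rcons in eM'.
  have B'0 : B' != [::].
    apply: contraTneq ub => B'0; move: tB'; rewrite B'0 => /(trail_last (s := [::])) ->.
    exact: na.
  have [b1 [c1 [t1 bc t2]]] := trail_split (s := [:: b]) isT B'0 tB'.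
  have eb := trail_last (s := [::]) t1; subst b1.
  have tAq : trail adj (rcons A q) m0 q by rewrite -cats1; trs.
  have Aq0 : rcons A q != [::] by case: (A).
  by have := second_pred eM' ub Aq0 tAq qb bc t2; rewrite adj_ore.
have qa : adj q a by rewrite adj_sym.
have ab : a != b by apply: (MM eM) => //; rewrite inE bB orbT.
have oub : ore u b.
  have qu : adj q u by rewrite adj_sym.
  have ua' : u != a by rewrite eq_sym Mu.
  have ub' : u != b by rewrite eq_sym Mu.
  have := hclaw qu qa qb ua' ub' ab; rewrite (negPf ua) /= => /orP[//|h].
  by case/negP: nab; apply: ore_light h al bl.
have nl1a : ~~ adj l1 a.
  apply/negP=> h.
  have tqB : trail adj ([:: q] ++ B) q m1 by trs.
  have H : gcfg C u ([:: q] ++ B) q m1 v (L ++ rev A) l0 m0.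
    by split=> //; [trs | rewrite adj_sym | permt].
  have := min lC oR H; rewrite eM size_cat /=.
  by case: (A) A0 => //= a0 A1 _; clear; lia.
have l1b : adj l1 b.
  have la : l1 != a by rewrite eq_sym ML.
  have lb : l1 != b by rewrite eq_sym ML.
  case/or3P: (hclaw ql1 qa qb la lb ab) => h.
  - by case/negP: nl1a; apply: ore_light h l1l al.
  - exact: ore_light h l1l bl.
  - by case/negP: nab; apply: ore_light h al bl.
by exists a, b; split=> //; split=> //; rewrite oub nub.
Qed.

(** Let [x] end the run of neighbours of [m0] on [L] read backwards from [l1], and let [x'] come
    next. With the edge [m0 m1], the vertices [s], [v], [m1], [m0], [x], [x'] would induce a P6
    whose vertices [s] and [m1] are both light. *)
Lemma ends_not_adj : ~~ adj m0 m1.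
Proof.
apply/negP=> m01.
have m0l0 : ~~ ore m0 l0.
  by apply: (cfg_heads lC K uCR (sub_trail (@adj_ore _) tR)); apply: adj_ore.
have m0l1 : adj m0 l1 by rewrite adj_sym.
have tL' := trail_rev (@adj_sym _) tL.
have [X [x [x' [Y [eL mX mx mx']]]]] := run_exists tL' m0l1 (na m0l0).
have {}eL : L = rev (x' :: Y) ++ [:: x] ++ rev X.
  by rewrite -(revK L) eL rev_cat -(cat1s x) rev_cat catA.
have tL2 := tL; rewrite eL in tL2; have pC2 := pC; rewrite eL in pC2.
set L1 := rev (x' :: Y) in eL tL2 pC2; set X' := rev X in eL tL2 pC2.
have L10 : L1 != [::] by rewrite -size_eq0 size_rev.
have [x1 [x2 [tL1 xx t2]]] := trail_split L10 (isT : [:: x] ++ X' != [::]) tL2.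
have e1 : x1 = x' by move: tL1; rewrite /L1 rev_cons => /trail_last.
have e2 := trail_hd t2; subst x1 x2.
have tx1 : trail ore [:: x] x x by apply: trail1.
have [y0 [tX m0y0]] : exists y0, trail ore (X' ++ [:: u]) y0 u /\ ore m0 y0.
  have [X0|X0] := eqVneq X' [::].
    by exists u; rewrite X0 trail1 ore_sym adj_ore.
  have [x3 [y0 [t3 _ tX]]] := trail_split (s := [:: x]) isT X0 t2.
  exists y0; split; first by trs.
  apply: adj_ore; apply: (allP mX); rewrite -mem_rev.
  by case/andP: (trail_mem tX).
have xL : x \in L by rewrite eL !mem_cat mem_head orbT.
have x'L : x' \in L by rewrite eL !mem_cat /L1 mem_rev mem_head.
have Us := uniq1 sR.
have x1m : ~~ ore m1 x.
  by apply/negP=> h; nocyc lC R ([:: v] ++ L1 ++ [:: x] ++ rev M ++ (X' ++ [:: u]) ++ R).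
have x1v : ~~ ore v x.
  by apply/negP=> h; nocyc lC R ([:: v] ++ [:: x] ++ rev L1 ++ rev M ++ (X' ++ [:: u]) ++ R).
have x1s : ~~ ore s x.
  by apply/negP=> h;
    nocyc lC [:: s] ([:: s] ++ [:: x] ++ rev L1 ++ rev M ++ (X' ++ [:: u]) ++ [:: v]).
have tX2 : trail ore (([:: x] ++ X') ++ [:: u]) x u by trs.
have m0x := adj_ore mx.
have x2m : ~~ ore m1 x'.
  by apply/negP=> h; nocyc lC R ([:: v] ++ L1 ++ rev M ++ (([:: x] ++ X') ++ [:: u]) ++ R).
have x2v : ~~ ore v x'.
  by apply/negP=> h; nocyc lC R ([:: v] ++ rev L1 ++ rev M ++ (([:: x] ++ X') ++ [:: u]) ++ R).
have x2s : ~~ ore s x'.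
  by apply/negP=> h;
    nocyc lC [:: s] ([:: s] ++ rev L1 ++ rev M ++ (([:: x] ++ X') ++ [:: u]) ++ [:: v]).
have vm : adj v m1 by rewrite adj_sym.
have m10 : adj m1 m0 by rewrite adj_sym.
have x'x : adj x x' by rewrite adj_sym.
have /andP[_ s0] := outer_M m0M; have /andP[_ s1] := outer_M m1M.
have := hP6 (v0 := s) (v1 := v) (v2 := m1) (v3 := m0) (v4 := x) (v5 := x').
rewrite sv vm m10 mx x'x s0 s1 mx' !na //= => /(_ isT isT isT isT).
by rewrite (negPf sl) (negPf m1l).
Qed.

(** The claw at [q] with leaves [u], [a], [m1] would join [a] and [m1]; the edges [l1 b] and [q m0]
    of [second_nbr] then close a longer cycle. *)
Lemma tail_nbr_not_second q A B : M = A ++ q :: B -> adj u q -> ~~ heavy q -> A != [::] ->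
  ~~ adj m1 q.
Proof.
move=> eM uq ql A0; apply/negP=> h.
have [a [b [tA aq qb tB [ua oub l1b ql1 qm0]]]] := second_nbr eM uq ql A0.
have pC' := pC; rewrite eM -(cat1s q) in pC'.
have aA : a \in A by case/andP: (trail_mem tA).
have aM : a \in M by rewrite eM mem_cat aA.
have m1B : m1 \in B by case/andP: (trail_mem tB).
have qu : adj q u by rewrite adj_sym.
have qa : adj q a by rewrite adj_sym.
have qm : adj q m1 by rewrite adj_sym.
have ua' : u != a by rewrite eq_sym Mu.
have um' : u != m1 by rewrite eq_sym Mu.
have am : a != m1 by apply: (MM eM) => //; rewrite inE m1B orbT.
have := hclaw qu qa qm ua' um' am; rewrite (negPf ua) (negPf um1) /= => am1.
by nocyc lC R (R ++ [:: v] ++ L ++ B ++ rev A ++ [:: q] ++ [:: u]).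
Qed.

(** Otherwise claws at [w] and [m1] join the two cycle neighbours [a], [b] of [w]. So [w] can be
    skipped on [M] and placed between [l1] and [m1], which makes room for [R]. *)
Lemma no_common w A B : M = A ++ w :: B -> A != [::] -> B != [::] ->
  adj w l1 -> adj w m1 -> ~~ adj w l0.
Proof.
move=> eM A0 B0 wl1 wm1; apply/negP=> wl0.
have tM' := tM; rewrite eM in tM'.
have [a [b [tA aw wb tB]]] := trail_cut tM' A0 B0.
have wa : adj w a by rewrite adj_sym.
have pC' := pC; rewrite eM -(cat1s w) in pC'.
have wM : w \in M by rewrite eM mem_cat mem_head orbT.
have aA : a \in A by case/andP: (trail_mem tA).
have bB : b \in B by case/andP: (trail_mem tB).
have m1B : m1 \in B by case/andP: (trail_mem tB).
have aM : a \in M by rewrite eM mem_cat aA.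
have bM : b \in M by rewrite eM mem_cat inE bB !orbT.
have al1 : ~~ ore a l1.
  by apply/negP=> h; nocyc lC R (A ++ rev L ++ [:: w] ++ B ++ [:: v] ++ rev R ++ [:: u]).
have al0 : ~~ ore a l0.
  by apply/negP=> h; nocyc lC R (A ++ L ++ [:: w] ++ B ++ [:: v] ++ rev R ++ [:: u]).
have bl1 : ~~ ore b l1.
  by apply/negP=> h; nocyc lC R (rev B ++ rev L ++ [:: w] ++ rev A ++ [:: u] ++ R ++ [:: v]).
have bl0 : ~~ ore b l0.
  by apply/negP=> h; nocyc lC R (rev B ++ L ++ [:: w] ++ rev A ++ [:: u] ++ R ++ [:: v]).
have l1m1 : ~~ ore l1 m1.
  have ru : ore r u by rewrite ore_sym adj_ore.
  have := cfg_heads lC (cfg_rev K) uCR (sub_trail (@adj_ore _) tR).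
  by apply; apply: adj_ore.
have l01 : l0 != l1 by apply: contraNneq ul0 => ->; rewrite ore_sym adj_ore.
have al0' : a != l0 by apply: ML.
have al1' : a != l1 by apply: ML.
have bl1' : b != l1 by apply: ML.
have am1 : a != m1 by apply: (MM eM) => //; rewrite inE m1B orbT.
have ab : a != b by apply: (MM eM) => //; rewrite inE bB orbT.
have l1m1' : l1 != m1 by rewrite eq_sym ML.
have al : ~~ heavy a.
  apply/negP=> h; have au : ore a u by apply: heavy_ore => //; apply: Mu.
  by nocyc lC R (A ++ [:: u] ++ R ++ [:: v] ++ rev B ++ [:: w] ++ L).
have bl : ~~ heavy b.
  apply/negP=> h; have bv : ore b v by apply: heavy_ore => //; apply: Mv.
  by nocyc lC R (rev B ++ [:: v] ++ rev R ++ [:: u] ++ A ++ [:: w] ++ rev L).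
have ol : ore l0 l1.
  have := hclaw wa wl0 wl1 al0' al1' l01.
  by rewrite (negPf al0) (negPf al1).
have am : adj a m1.
  have := hclaw wa wl1 wm1 al1' am1 l1m1'.
  by rewrite (negPf al1) (negPf l1m1) orbF /= => h; apply: ore_light h al m1l.
have oab : ore a b.
  have [bm|bm] := eqVneq b m1; first by rewrite bm adj_ore.
  have bm1 : adj b m1.
    have := hclaw wb wl1 wm1 bl1' bm l1m1'.
    by rewrite (negPf bl1) (negPf l1m1) orbF /= => h; apply: ore_light h bl m1l.
  have ma : adj m1 a by rewrite adj_sym.
  have mb : adj m1 b by rewrite adj_sym.
  have l0a : l0 != a by rewrite eq_sym.
  have l0b : l0 != b by rewrite eq_sym ML.
  have := hclaw ml ma mb l0a l0b ab.
  by rewrite ore_sym (negPf al0) ore_sym (negPf bl0).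
by nocyc lC R ([:: v] ++ L ++ [:: w] ++ rev B ++ rev A ++ [:: u] ++ R).
Qed.

(** The path [s v m1 w q l1] forces the edge [w l1], so [w l0] is absent by [no_common]. Then
    [r u q w m1 l0] forces the edge [q l0], which gives a longer cycle, after a claw at [q] unless
    [q] is [m0]. *)
Lemma no_middle w q : w \in M -> q \in M -> ~~ heavy q -> adj u q -> adj m1 w -> adj w q ->
  ~~ adj m1 q -> ~~ adj u w -> ~~ adj v w -> ~~ adj v q -> False.
Proof.
move=> wM qM ql uq m1w wq nm1q nuw nvw nvq.
have wm1 : adj w m1 by rewrite adj_sym.
have qw : adj q w by rewrite adj_sym.
have vm1 : adj v m1 by rewrite adj_sym.
have m0l0 : ~~ ore m0 l0.
  by apply: (cfg_heads lC K uCR (sub_trail (@adj_ore _) tR)); apply: adj_ore.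
have l1m1 : ~~ ore l1 m1.
  by apply: (cfg_heads lC (cfg_rev K) uCR (sub_trail (@adj_ore _) tR)); apply: adj_ore.
have Ur := uniq1 rR; have Us := uniq1 sR.
have sl1 : ~~ ore s l1.
  by apply/negP=> h; nocyc lC [:: s] ([:: s] ++ rev L ++ rev M ++ [:: u] ++ [:: v]).
have rl0 : ~~ ore r l0.
  by apply/negP=> h; nocyc lC [:: r] ([:: r] ++ L ++ M ++ [:: v] ++ [:: u]).
have q_split : q = m0 \/ exists A B, M = A ++ q :: B /\ A != [::].
  case/splitPr eM : {1}M / qM => [A B].
  have [A0|A0] := eqVneq A [::]; last by right; exists A, B.
  by left; move: tM; rewrite eM A0 => /trail_hd.
have ql1 : adj q l1.
  case: q_split => [->|[A [B [eM A0]]]]; first by rewrite adj_sym.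
  by have [a [b [_ _ _ _ [_ _ _ ? _]]]] := second_nbr eM uq ql A0.
have /andP[rm1 sm1] := outer_M m1M; have /andP[rw sw] := outer_M wM.
have /andP[rq sq] := outer_M qM.
have wl1 : adj w l1.
  apply/negPn/negP=> nwl1.
  have := hP6 (v0 := s) (v1 := v) (v2 := m1) (v3 := w) (v4 := q) (v5 := l1).
  rewrite sv vm1 m1w wq ql1 sm1 sw sq nvw nvq nm1q nwl1 !na //= 1?ore_sym //.
  by move=> /(_ isT isT isT isT); rewrite (negPf sl) (negPf m1l).
have [A [B [eM A0 B0]]] : exists A B, [/\ M = A ++ w :: B, A != [::] & B != [::]].
  case/splitPr eM : {1}M / wM => [A B]; exists A, B; split=> //.
    apply: contraNneq nuw => A0; suff -> : w = m0 by [].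
    by move: tM; rewrite eM A0 => /trail_hd.
  apply: contraNneq nvw => B0; suff -> : w = m1 by [].
  by move: tM; rewrite eM B0 cats1 => /trail_last.
have wl0 := no_common eM A0 B0 wl1 wm1.
have ql0 : adj q l0.
  apply/negPn/negP=> nql0.
  have := hP6 (v0 := r) (v1 := u) (v2 := q) (v3 := w) (v4 := m1) (v5 := l0).
  rewrite adj_sym ur uq qw wm1 ml rq rw rm1 nuw [adj q m1]adj_sym nm1q nql0 wl0 !na //=.
  by move=> /(_ isT isT isT isT); rewrite (negPf rl) (negPf ql).
case: q_split => [e|[A' [B' [eM' A'0]]]].
  by case/negP: m0l0; rewrite -e adj_ore.
have [a [b [tA aq qb tB [ua oub l1b _ qm0]]]] := second_nbr eM' uq ql A'0.
have pC' := pC; rewrite eM' -(cat1s q) in pC'.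
have aA : a \in A' by case/andP: (trail_mem tA).
have aM : a \in M by rewrite eM' mem_cat aA.
have qu : adj q u by rewrite adj_sym.
have qa : adj q a by rewrite adj_sym.
have ua' : u != a by rewrite eq_sym Mu.
have ul0' : u != l0 by rewrite eq_sym Lu.
have al0 : a != l0 by apply: ML.
have := hclaw qu qa ql0 ua' ul0' al0; rewrite (negPf ua) (negPf ul0) /= => oal0.
by nocyc lC R ([:: v] ++ rev B' ++ rev L ++ rev A' ++ [:: q] ++ [:: u] ++ R).
Qed.

(* A heavy neighbour of [u] or [v] on [M] can be left out of [M], by [heavy_bypass]. *)
Definition kept z := (z \in M) && ~~ (heavy z && (adj z u || adj z v)).

Definition kept_edge x y := [&& kept x, kept y & adj x y].

(** If the predecessor of [x] is dropped, the vertex before it is light and adjacent to [x] by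
    [heavy_bypass], hence kept. *)
Lemma kept_connect x A B : M = A ++ x :: B -> kept x -> connect kept_edge m0 x.
Proof.
have [n nA] := ubnP (size A); elim: n A x B nA => // n IH A x B; rewrite ltnS => nA eM kx.
case/lastP: A nA eM => [|A a] nA eM.
  by rewrite -(_ : x = m0) //; move: tM; rewrite eM => /trail_hd.
have tM' := tM; rewrite eM in tM'.
have [|//|a1 [x1 [tA ax tB]]] := trail_split _ _ tM'; first by case: (A).
have e := trail_last tA; have e' := trail_hd tB; subst a1 x1.
have aM : a \in M by rewrite eM -cats1 !mem_cat inE eqxx orbT.
rewrite size_rcons in nA.
have eM' : M = A ++ a :: x :: B by rewrite eM cat_rcons.
have [ka|ka] := boolP (kept a).
  by apply: connect_trans (IH _ _ _ nA eM' ka) (connect1 _); rewrite /kept_edge ka kx.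
move: ka; rewrite /kept aM negbK => /andP[ha aw].
have [b [x1 [tA' ba ax' tB' _]]] := heavy_nbr eM' ha.
have e := trail_hd tB'; subst x1.
have [bx bl xl] := heavy_bypass eM' ha aw tA' tB' ba ax.
case/lastP: A {tM' tA eM} eM' nA tA' => // A b' eM nA tA'.
have e := trail_last tA'; subst b'; rewrite size_rcons in nA; rewrite cat_rcons in eM.
have kb : kept b by rewrite /kept (negPf bl) andbT eM mem_cat mem_head orbT.
by apply: connect_trans (IH _ _ _ (ltnW nA) eM kb) (connect1 _); rewrite /kept_edge kb kx.
Qed.

(* A shortest path inside the kept part of [M] from [m1] to the light neighbours of [u] has at
   most two edges, for otherwise it extends to the induced path [s v m1 x y z]. *)
Lemma no_min_config : (forall q, q \in M -> ~~ heavy q -> adj v q -> q = m1) -> False.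
Proof.
move=> only.
have km z : z \in M -> ~~ heavy z -> kept z by move=> zM zl; rewrite /kept zM (negPf zl).
have sym : symmetric kept_edge by move=> x y; rewrite /kept_edge andbCA adj_sym.
have : connect kept_edge m1 m0.
  rewrite (sym_connect_sym sym).
  by case/splitPr eM : {1}M / m1M => [A B]; apply: kept_connect eM (km _ m1M m1l).
case/connectP=> p0 pp0 lp0.
pose T z := ~~ heavy z && adj u z.
have Tl : T (last m1 p0) by rewrite -lp0 /T m0l.
have [p sp] := shortest_exists pp0 Tl; have [pp Tp _] := sp; have up := shortest_uniq sp.
have kp z : z \in p -> kept z.
  move=> zp; case/splitPr: zp pp => [p1 p2]; rewrite cat_path /= => /and3P[_ /and3P[_ ? _] _].
  by [].
have pM z : z \in p -> z \in M by move/kp => /andP[].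
have nv z : z \in p -> ~~ adj v z.
  move=> zp; apply/negP=> vz; have /andP[zM] := kp z zp.
  have [zh|zl _] := boolP (heavy z); first by rewrite [adj z v]adj_sym vz orbT.
  by move: up => /= /andP[]; rewrite -(only z zM zl vz) zp.
(* A kept neighbour of [u] is light, so it satisfies [T] and can only be the last vertex of a
   shortest path. *)
have nu i : 0 < i < size p -> ~~ adj u (nth m1 (m1 :: p) i).
  case: i => // i /andP[_ ip] /=; apply/negP=> uz.
  have zp : nth m1 p i \in p by rewrite mem_nth // ltnW.
  have /andP[zM] := kp _ zp; have := shortest_nontarget sp ip.
  by rewrite /T /= uz andbT negbK [adj _ u]adj_sym uz => ->.
have nch i j z : z = nth m1 (m1 :: p) i -> i.+1 < j <= size p ->
    ~~ adj z (nth m1 (m1 :: p) j).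
  have kk k k' : k <= size p -> k' = nth m1 (m1 :: p) k -> kept k'.
    case: k => [_ ->|k kp' ->]; first exact: km.
    by apply: kp; rewrite /= mem_nth.
  move=> ez /andP[ij jp]; apply/negP=> h.
  have h' : kept_edge (nth m1 (m1 :: p) i) (nth m1 (m1 :: p) j).
    have ip : i <= size p := ltnW (ltnW (leq_trans ij jp)).
    by rewrite /kept_edge (kk i _ ip erefl) (kk j _ jp erefl) -ez.
  have ej : j = i.+1 by apply: shortest_chord sp _ h'; rewrite (ltnW ij).
  by move: ij; rewrite ej ltnn.
have vm1 : adj v m1 by rewrite adj_sym.
case: p sp pp Tp up kp pM nv nu nch => [|x [|y [|z p]]] sp pp Tp up kp pM nv nu nch.
- by case/andP: Tp => _ /= h; case/negP: um1; apply: adj_ore.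
- move: Tp pp => /= /andP[xl ux] /andP[/and3P[_ _ m1x] _].
  case/splitPr eM : {1}M / (pM x (mem_head _ _)) => [A B].
  have [A0|A0] := eqVneq A [::]; last by case/negP: (tail_nbr_not_second eM ux xl A0).
  case/negP: ends_not_adj; rewrite adj_sym; suff <- : x = m0 by [].
  by move: tM; rewrite eM A0 => /trail_hd.
- move: Tp pp => /= /andP[yl uy] /and3P[/and3P[_ _ m1x] /and3P[_ _ xy] _].
  have xp : x \in [:: x; y] by rewrite mem_head.
  have yp : y \in [:: x; y] by rewrite !inE eqxx orbT.
  exact: no_middle (pM x xp) (pM y yp) yl uy m1x xy (nch 0 2 _ erefl isT) (nu 1 isT)
    (nv x xp) (nv y yp).
move: pp => /= /and4P[/and3P[_ _ m1x] /and3P[_ _ xy] /and3P[_ _ yz] _].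
have xp : x \in [:: x, y, z & p] by rewrite mem_head.
have yp : y \in [:: x, y, z & p] by rewrite !inE eqxx orbT.
have zp : z \in [:: x, y, z & p] by rewrite !inE eqxx !orbT.
have /andP[_ s1] := outer_M m1M; have /andP[_ s2] := outer_M (pM x xp).
have /andP[_ s3] := outer_M (pM y yp); have /andP[_ s4] := outer_M (pM z zp).
have := hP6 (v0 := s) (v1 := v) (v2 := m1) (v3 := x) (v4 := y) (v5 := z).
rewrite sv vm1 m1x xy yz s1 s2 s3 s4 !nv // (nch 0 2 _ erefl) // (nch 0 3 _ erefl) //.
by rewrite (nch 1 3 _ erefl) // => /(_ isT isT isT isT); rewrite (negPf sl) (negPf m1l).
Qed.

Lemma second_nbr_tail q A B : M = A ++ q :: B -> adj u q -> ~~ heavy q -> A != [::] ->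
  exists b, [/\ v != b, ore u b, ~~ adj u b & ~~ ore v b].
Proof.
move=> eM uq ql A0.
have [a [b [tA aq qb tB [_ /andP[oub nub] _ _ _]]]] := second_nbr eM uq ql A0.
have bB : b \in B by case/andP: (trail_mem tB).
exists b; split=> //; first by rewrite eq_sym Mv // eM mem_cat inE bB !orbT.
have pC' := pC; rewrite eM -(cat1s q) in pC'; have qu : adj q u by rewrite adj_sym.
apply/negP=> vb; have lm' := cfg_lm K; have ml' := cfg_ml K.
by nocyc lC R (A ++ [:: q] ++ [:: u] ++ R ++ [:: v] ++ B ++ L).
Qed.

(** In the second alternative d(u) + d(b) >= n > d(v) + d(b), so d(u) > d(v). It cannot occur when
    read from [u] and also when read from [v], and otherwise [no_min_config] applies on one side. *)
Lemma second_nbr_dec : (forall q, q \in M -> ~~ heavy q -> adj u q -> q = m0) \/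
  exists b, [/\ v != b, ore u b, ~~ adj u b & ~~ ore v b].
Proof.
have [/existsP[q /and4P[qM ql uq qm]]|/existsPn none] :=
  boolP [exists q, [&& q \in M, ~~ heavy q, adj u q & q != m0]].
  right; case/splitPr eM : {1}M / qM => [A B].
  apply: (second_nbr_tail eM uq ql); apply: contraNneq qm => A0.
  by move: tM; rewrite eM A0 => /trail_hd ->.
left=> q qM ql uq; apply/eqP; apply: contraNT (none q) => qm.
by rewrite qM ql uq.
Qed.

End Config.

(** Strong induction on the length of [M] supplies the minimality over all longest cycles and outer
    paths at once. *)
Lemma P6_contra C R u v : longest C -> outer C R u v -> False.
Proof.
move=> lC oR; have [M [m0 [m1 [L [l0 [l1 cC]]]]]] := gcfg_exists lC oR.
have [n] := ubnP (size M).
elim: n C R u v M m0 m1 L l0 l1 lC oR cC => // n IH C R u v M m0 m1 L l0 l1 lC oR cC.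
rewrite ltnS => Mn.
have min C' R' (u' v' : G) M' (m0' m1' : G) L' (l0' l1' : G) :
    longest C' -> outer C' R' u' v' -> gcfg C' u' M' m0' m1' v' L' l0' l1' -> size M <= size M'.
  move=> lC' oR' cC'; rewrite leqNgt; apply/negP=> h.
  exact: IH lC' oR' cC' (leq_trans h Mn).
have [r [s [tR ur sv uCR _]]] := outer_ends oR.
have cC' := gcfg_swap (gcfg_rev cC); have oR' := outer_sym oR.
have [r' [s' [tR' ur' sv' uCR' _]]] := outer_ends oR'.
have min' : forall C' R' (u' v' : G) M' (m0' m1' : G) L' (l0' l1' : G),
    longest C' -> outer C' R' u' v' -> gcfg C' u' M' m0' m1' v' L' l0' l1' ->
    size (rev M) <= size M' by rewrite size_rev.
have [|[b [vb ub nub nvb]]] := second_nbr_dec lC oR cC tR ur sv uCR min.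
  move=> only; apply: (no_min_config lC oR' cC' tR' ur' sv' uCR' min') => q.
  by rewrite mem_rev; apply: only.
have [|[b' [ub' vb' nvb' nub']]] := second_nbr_dec lC oR' cC' tR' ur' sv' uCR' min'.
  move=> only; apply: (no_min_config lC oR cC tR ur sv uCR min) => q qM.
  by apply: only; rewrite mem_rev.
move: ub vb' nvb nub'; rewrite !oreE (negPf nub) (negPf nvb') vb ub' /=.
move=> /andP[_ h1] /andP[_ h2] /norP[_ h3] /norP[_ h4]; clear -h1 h2 h3 h4; lia.
Qed.
End P6.

(** * The four cases put together *)

Lemma chordless_far_apart (G : sgraph) (R : seq G) u v : chordless R u v ->
  (forall s, R = [:: s] -> ~~ adj u v) -> far_apart R u v /\ far_apart (rev R) v u.
Proof.
case=> c1 c2 _ c; split; split=> // [t s R1|s] e.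
  by rewrite adj_sym; apply: (c2 _ s (rev R1)); rewrite -(revK R) e !rev_rcons.
by rewrite adj_sym; apply: (c s); rewrite -(revK R) e.
Qed.

Unset Implicit Arguments.

Theorem theorem13 (G S : sgraph)
    (hconn : k_connected 2 G)
    (hS : [\/ S = P6, S = Z2, S = wounded | S = net])
    (hclaw : o_heavy claw G)
    (hheavy : f_heavy S G) :
  hamiltonian G.
Proof.
have cc := claw_heavy hclaw; have [C lC] := longest_exists hconn.
have [/forallP allC|/forallPn[x xC]] := boolP [forall x, x \in C].
  exists C; have [/and3P[/andP[cC uC] sC _] _] := lC.
  by split=> //; rewrite /ucycle cC.
have [R0 [u [v oR0]]] := outer_path_exists hconn lC xC.
have [R oR chR] := chordless_exists oR0.
suff : net_cover G \/ wounded_cover G \/ Z2_cover G -> False.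
  move=> contra; exfalso; case: hS hheavy => -> h.
  - exact: (P6_contra cc (P6_heavy h) lC oR).
  - by apply: contra; right; right; apply: Z2_heavy.
  - by apply: contra; right; left; apply: wounded_heavy.
  - by apply: contra; left; apply: net_heavy.
move=> hS'; have [D1 [a [b [M [D2 [c [d [L F]]]]]]]] := frame_exists cc lC oR.
have [D1' [a' [b' [M' [p [p' [D2' [c' [d' [L' [q [q' F']]]]]]]]]]]] := tight_frame_grow lC oR F.
case: hS' => [hN|hWZ]; first by apply: (tight_contra cc lC oR F'); left.
apply: (tight_contra cc lC oR F'); right; split=> //; apply: chordless_far_apart chR _ => s eR.
by apply/negP=> uv; move: oR; rewrite eR => oR; apply: (triangle_contra cc lC oR uv hWZ).
Qed.
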